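(* Let $K$ be an algebraically closed field of characteristic $p=0$. Let $X\subset\mathbb{P}^{n+1}$ be a hypersurface of dimension $n\ge 1$ and degree $d=4$ with $s(X)\le n-2$, and let $\lambda:=[n/2]$. Assume that $\Delta(X)$ is a finite set. Then $\sharp\Delta(X)\le 4(\lambda+1)$. Furthermore, equality holds if and only if $X$ is projectively equivalent to the hypersurface defined by $$X_{\lambda+1}X_0^3+\dots+X_{2\lambda+1}X_\lambda^3+X_{\lambda+1}^4+\dots+X_{n+1}^4=0.$$
   Context: A hypersurface $X\subset\mathbb{P}^{n+1}$ is irreducible and reduced; $X_0,\ldots,X_{n+1}$ are homogeneous coordinates. $s(X):=\dim\mathrm{Sing}(X)$, with $\dim\emptyset=-1$. A point $P\in X_{\rm sm}\cup(\mathbb{P}^{n+1}\setminus X)$ ($X_{\rm sm}$ the smooth locus) is a Galois point for $X$ if the function field extension $K(X)/K(\mathbb{P}^n)$ induced by the projection $\pi_P:X\dashrightarrow\mathbb{P}^n$ from $P$ is Galois. $\Delta(X)$ is the set of all Galois points contained in $X_{\rm sm}$. $[\,\cdot\,]$ is the integer part. Projectively equivalent means related by a projective transformation of $\mathbb{P}^{n+1}$. The first sum is $\sum_{i=0}^{\lambda}X_{\lambda+1+i}X_i^3$. *)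

(* Defs.v *)
From HB Require Import structures.
From mathcomp Require Import all_boot all_order all_algebra.
From mathcomp Require Import separable finmap.
From mathcomp Require Import boolp classical_sets cardinality.
From mathcomp Require Import mpoly.

Set Implicit Arguments.
Unset Strict Implicit.
Unset Printing Implicit Defensive.

Import GRing.Theory.
Local Open Scope ring_scope.
Local Open Scope classical_set_scope.
Local Open Scope quotient_scope.

(** [k] is meant to be a subfield of [L]. *)
Section GaloisExtension.
Variables (L : fieldType) (k : {pred L}).

Definition algebraic_ext : Prop :=
  forall x : L, exists p : {poly L}, [/\ p \is a polyOver k, p != 0 & root p x].

Definition irreducible_over (p : {poly L}) : Prop :=
  [/\ p \is a polyOver k, (1 < size p)%N
    & forall q r : {poly L}, q \is a polyOver k -> r \is a polyOver k ->
        p = q * r -> size q = 1%N \/ size r = 1%N].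

Definition normal_ext : Prop :=
  forall p : {poly L}, irreducible_over p -> (exists x, root p x) ->
    exists rs : seq L, p %= \prod_(r <- rs) ('X - r%:P).

Definition separable_ext : Prop :=
  forall p : {poly L}, irreducible_over p -> (exists x, root p x) ->
    separable_poly p.

Definition galois_ext : Prop := [/\ algebraic_ext, normal_ext & separable_ext].

End GaloisExtension.

Section ResidueDomain.
Variables (R : comNzRingType) (I : prime_idealr R).

Definition residue_domain : Type := {ideal_quot I}.

HB.instance Definition _ := GRing.ComNzRing.on residue_domain.

Definition residue_class (x : R) : residue_domain := \pi_{ideal_quot I} x.

HB.instance Definition _ :=
  GRing.RMorphism.copy residue_class (\pi_{ideal_quot I}).

Fact residue_class_surj y : exists x, residue_class x = y.
Proof. by exists (repr (y : {ideal_quot I})); rewrite /residue_class reprK. Qed.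

Fact residue_class_eq0 x : (residue_class x == 0) = (x \in I).
Proof.
by rewrite -[x in RHS]subr0 Quotient.idealrBE -/(residue_class 0) raddf0.
Qed.

Definition residue_unit : pred residue_domain :=
  fun x => `[< exists y, y * x = 1 >].

Definition residue_inv (x : residue_domain) : residue_domain :=
  if pselect (exists y, y * x = 1) is left e then sval (cid e) else x.

Fact residue_mulVx : {in residue_unit, left_inverse 1 residue_inv *%R}.
Proof.
move=> x /asboolP ex; rewrite /residue_inv; case: pselect => // e.
by case: (cid e).
Qed.

Fact residue_unitP x y : y * x = 1 -> residue_unit x.
Proof. by move=> yx; apply/asboolP; exists y. Qed.

Fact residue_inv_out : {in [predC residue_unit], residue_inv =1 id}.
Proof.
move=> x /negP nux; rewrite /residue_inv; case: pselect => // e.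
by case: nux; apply/asboolP.
Qed.

HB.instance Definition _ := GRing.ComNzRing_hasMulInverse.Build residue_domain
  residue_mulVx residue_unitP residue_inv_out.

Fact residue_idomain (x y : residue_domain) :
  x * y = 0 -> (x == 0) || (y == 0).
Proof. exact: Quotient.rquot_IdomainAxiom. Qed.

HB.instance Definition _ :=
  GRing.ComUnitRing_isIntegral.Build residue_domain residue_idomain.

End ResidueDomain.

Section SubfieldType.
Variables (E : fieldType) (S : divringClosed E).

Record subfield_type := SubfieldType {
  subfield_val : E;
  subfield_valP : subfield_val \in S }.

HB.instance Definition _ := [isSub for subfield_val].
HB.instance Definition _ := [Choice of subfield_type by <:].
HB.instance Definition _ := [SubChoice_isSubComUnitRing of subfield_type by <:].
HB.instance Definition _ :=
  [SubComUnitRing_isSubIntegralDomain of subfield_type by <:].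
HB.instance Definition _ :=
  [SubIntegralDomain_isSubField of subfield_type by <:].

End SubfieldType.

(** The points of P^m are the lines through the origin of K^(m+1). *)

Section ProjectiveSpace.
Variables (K : fieldType) (m : nat).

Record point := Point {
  line :> {vspace 'cV[K]_m.+1};
  line_dim : \dim line == 1%N }.

HB.instance Definition _ := [isSub for line].
HB.instance Definition _ := [Choice of point by <:].

Definition vanishes_at (G : {mpoly K[m.+1]}) (P : point) : Prop :=
  forall v : 'cV[K]_m.+1, v \in line P -> G.@[fun i => v i 0] = 0.

Definition zariski_closed (Z : set point) : Prop :=
  exists S : set {mpoly K[m.+1]},
    (forall G, S G -> exists e, G \is e.-homog) /\
    Z = [set P | forall G, S G -> vanishes_at G P].

Definition irreducible_closed (Z : set point) : Prop :=
  [/\ zariski_closed Z, Z !=set0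
    & forall A B : set point, zariski_closed A -> zariski_closed B ->
        Z `<=` A `|` B -> Z `<=` A \/ Z `<=` B].

Definition irreducible_chain (S : set point) (l : nat) (Z : nat -> set point) :=
  (forall i, (i <= l)%N -> irreducible_closed (Z i) /\ Z i `<=` S) /\
  (forall i, (i < l)%N -> Z i `<` Z i.+1).

(** [dim S <= k] for the Krull dimension of a closed set [S]; the bound
    [-1 <= k] reflects the convention [dim set0 = -1]. *)
Definition dim_le (S : set point) (k : int) : Prop :=
  -1 <= k /\ forall l Z, irreducible_chain S l Z -> l%:Z <= k.

End ProjectiveSpace.

(** [lin_subst M A] is [A] composed with the linear map [v |-> M *m v]. *)
Definition lin_subst (K : fieldType) (r m : nat) (M : 'M[K]_(r, m))
    (A : {mpoly K[r]}) : {mpoly K[m]} :=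
  A \mPo [tuple \sum_(j < m) M i j *: 'X_j | i < r].

Definition mpoly_dvd (K : fieldType) (m : nat) (F G : {mpoly K[m]}) : Prop :=
  exists H, G = H * F.

(** The hypersurface [eqn = 0] is irreducible and reduced, i.e. integral, when
    the ideal generated by [eqn] is prime. *)
Record hypersurface (K : fieldType) (n d : nat) := Hypersurface {
  eqn :> {mpoly K[n.+2]};
  eqn_homog : eqn \is d.-homog;
  eqn_neq0 : eqn != 0;
  eqn_proper : ~ mpoly_dvd eqn 1;
  eqn_prime : forall G H, mpoly_dvd eqn (G * H) ->
    mpoly_dvd eqn G \/ mpoly_dvd eqn H }.

Section Hypersurface.
Variables (K : fieldType) (n d : nat) (X : hypersurface K n d).

Definition points : set (point K n.+1) := [set P | vanishes_at X P].

Definition Sing : set (point K n.+1) :=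
  [set P | points P /\ forall i : 'I_n.+2, vanishes_at X^`M(i) P].

Definition smooth_locus : set (point K n.+1) := points `\` Sing.

Definition hideal : {pred {mpoly K[n.+2]}} := fun G => `[< mpoly_dvd X G >].

Lemma hidealP G : reflect (mpoly_dvd X G) (G \in hideal).
Proof. exact: asboolP. Qed.

Fact hideal_closed : idealr_closed hideal.
Proof.
split; first by apply/hidealP; exists 0; rewrite mul0r.
  by apply/negP => /hidealP; exact: eqn_proper.
move=> a u v /hidealP[H ->] /hidealP[J ->]; apply/hidealP.
by exists (a * H + J); rewrite mulrDl mulrA.
Qed.

HB.instance Definition _ := isIdealr.Build {mpoly K[n.+2]} hideal hideal_closed.

Fact hideal_prime : prime_idealr_closed hideal.
Proof.
by move=> u v /hidealP/eqn_prime[] /hidealP -> //; rewrite orbT.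
Qed.

HB.instance Definition _ :=
  isPrimeIdealrClosed.Build {mpoly K[n.+2]} hideal hideal_prime.

(** The homogeneous coordinate ring of [X], with its residue class morphism;
    surjectivity and the kernel determine both up to isomorphism. The explicit
    quotient is hidden because unifying its structures is intractable. *)
Lemma coord_ring_exists :
  {D : idomainType & {f : {rmorphism {mpoly K[n.+2]} -> D} |
     (forall y, exists G, f G = y) /\
     (forall G, (f G == 0) = (G \in hideal))}}.
Proof.
exists (residue_domain hideal), (residue_class hideal).
by split; [exact: residue_class_surj | exact: residue_class_eq0].
Qed.

Definition coord_ring : idomainType := projT1 coord_ring_exists.

Definition coord_class : {rmorphism {mpoly K[n.+2]} -> coord_ring} :=
  sval (projT2 coord_ring_exists).

Lemma coord_class_surj y : exists G, coord_class G = y.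
Proof. by case: (svalP (projT2 coord_ring_exists)). Qed.

Lemma coord_class_eq0 G : (coord_class G == 0) = (G \in hideal).
Proof. by case: (svalP (projT2 coord_ring_exists)). Qed.

Definition coord_frac (A B : {mpoly K[n.+2]}) : {fraction coord_ring} :=
  FracField.tofrac (coord_class A) / FracField.tofrac (coord_class B).

Fact coord_frac_def B : B \notin hideal ->
  FracField.tofrac (coord_class B) != 0.
Proof. by rewrite tofrac_eq0 coord_class_eq0. Qed.

Fact coord_fracD A B A' B' : B \notin hideal -> B' \notin hideal ->
  coord_frac A B - coord_frac A' B' = coord_frac (A * B' - A' * B) (B * B').
Proof.
move=> /coord_frac_def nB /coord_frac_def nB'; rewrite /coord_frac.
by rewrite -mulNr addf_div // !(rmorphB, rmorphM) /= mulNr.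
Qed.

Fact coord_fracV A B A' B' : coord_frac A B / coord_frac A' B' =
  coord_frac (A * B') (B * A').
Proof.
by rewrite /coord_frac !rmorphM /= invf_div mulf_div.
Qed.

Fact hidealM A B : A \notin hideal -> B \notin hideal -> A * B \notin hideal.
Proof.
by move=> nA nB; apply/negP => /hideal_prime; rewrite (negPf nA) (negPf nB).
Qed.

Fact hideal1 : 1 \notin hideal.
Proof. by case: hideal_closed. Qed.

Definition homog_frac : {pred {fraction coord_ring}} :=
  fun x => `[< exists e A B, [/\ A \is e.-homog, B \is e.-homog,
                                 B \notin hideal & x = coord_frac A B] >].

Fact homog_frac_divring : divring_closed homog_frac.
Proof.
have S0 : 0 \in homog_frac.
  apply/asboolP; exists 0%N, 0, 1.
  by rewrite rpred0 dhomog1 hideal1 /coord_frac !raddf0 mul0r.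
split.
- apply/asboolP; exists 0%N, 1, 1; rewrite dhomog1 hideal1.
  by split=> //; rewrite /coord_frac divff // coord_frac_def // hideal1.
- move=> x y /asboolP[e [A [B [hA hB nB ->]]]].
  move=> /asboolP[e' [A' [B' [hA' hB' nB' ->]]]].
  apply/asboolP; exists (e + e')%N, (A * B' - A' * B), (B * B').
  rewrite hidealM // coord_fracD // dhomogM // rpredB //; first exact: dhomogM.
  by rewrite addnC dhomogM.
- move=> x y /asboolP[e [A [B [hA hB nB ->]]]].
  move=> /asboolP[e' [A' [B' [hA' hB' nB' ->]]]].
  have [A'I | nA'] := boolP (A' \in hideal).
    move: A'I; rewrite -coord_class_eq0 => /eqP A'0.
    by rewrite {2}/coord_frac A'0 raddf0 mul0r invr0 mulr0.
  apply/asboolP; exists (e + e')%N, (A * B'), (B * A').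
  by rewrite hidealM // coord_fracV !dhomogM.
Qed.

HB.instance Definition _ :=
  GRing.isDivringClosed.Build {fraction coord_ring} homog_frac
    homog_frac_divring.

(** [K(X)]: the elements of degree 0 in the fraction field of the
    homogeneous coordinate ring. *)
Definition function_field : fieldType := subfield_type homog_frac.

(** The linear forms [M] define the projection from [P] onto P^n. *)
Definition projection_from (P : point K n.+1) (M : 'M[K]_(n.+1, n.+2)) : Prop :=
  \rank M = n.+1 /\ forall v, v \in line P -> M *m v = 0.

(** The image of [K(P^n)] in [K(X)] under the pullback along the projection
    given by [M]: a fraction A / B of forms of equal degree on P^n is sent to
    A(M X) / B(M X). This does not depend on the choice of [M] for a given
    centre, so the existential in [galois_point] is harmless. *)
Definition pullback_field (M : 'M[K]_(n.+1, n.+2)) : {pred function_field} :=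
  fun x => `[< exists e (A B : {mpoly K[n.+1]}),
    [/\ A \is e.-homog, B \is e.-homog, lin_subst M B \notin hideal
      & subfield_val x = coord_frac (lin_subst M A) (lin_subst M B)] >].

Definition galois_point (P : point K n.+1) : Prop :=
  (smooth_locus `|` ~` points) P /\
  exists M, projection_from P M /\ galois_ext (pullback_field M).

Definition Delta : set (point K n.+1) :=
  [set P | galois_point P /\ smooth_locus P].

(** [X] is projectively equivalent to the hypersurface [G = 0]: some projective
    transformation carries the equation of one to that of the other, up to a
    nonzero constant. *)
Definition proj_equivalent (G : {mpoly K[n.+2]}) : Prop :=
  exists (T : 'M[K]_n.+2) (c : K),
    [/\ T \in unitmx, c != 0 & lin_subst T X = c *: G].

End Hypersurface.

Definition quartic (K : fieldType) (n : nat) : {mpoly K[n.+2]} :=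
  let lambda := n./2 in
  \sum_(0 <= i < lambda.+1) 'X_(inord (lambda + 1 + i)) * 'X_(inord i) ^+ 3
  + \sum_(lambda.+1 <= j < n.+2) 'X_(inord j) ^+ 4.

(* Main.v *)
(** In coordinates centred at a point P of X the equation F of X becomes
    L x^3 + Q x^2 + C x + G with coefficients in K[y]. If P is Galois, the
    discriminant D of this cubic, of degree 10, is a square E^2 in K(y). As
    dim Sing(X) <= n - 2, the span of P and a generic line misses Sing(X); along
    that line every root of E is a double zero of D in all directions, which
    would give a singular point unless Q^2 - 3LC vanishes there. A multiple root
    of E would moreover make L, Q, C and G vanish together, against the
    irreducibility of F. So Q^2 - 3LC, of degree 4, has five distinct zeros and
    vanishes; L divides Q, and F = l^3 L + F' with F' constant in the direction
    of P. Conversely, such a normal form exhibits K(X) as a Kummer extension of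
    degree 3.

    Let two Galois points v, w have forms (l, L) and (l', L'). Comparing
    D_v D_w F with D_w D_v F shows that either all of l, L vanish at w and all
    of l', L' vanish at v, or (l, L) and (l', L') span the same plane. This is
    an equivalence relation on the Galois points, its classes have at most four
    elements, and the classes are linearly independent: a class with at least
    two points contributes two dimensions and the summand l^3 L - k L^4 to F,
    while a single point contributes one dimension and obstructs the vectors
    from filling K^(n+2). (F has no direction of constancy, since moving a
    Galois point along it would give infinitely many.) Counting gives the
    bound; in the case of equality rescaling the summands gives the quartic. *)

From HB Require Import structures.
Require Import Defs.
From mathcomp Require Import all_boot all_order all_algebra.
From mathcomp Require Import separable finmap.
From mathcomp Require Import boolp classical_sets cardinality.
From mathcomp Require Import mpoly.
From mathcomp Require Import ring zify.

Set Implicit Arguments.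
Unset Strict Implicit.
Unset Printing Implicit Defensive.

Import GRing.Theory.
Local Open Scope ring_scope.

(** * Polynomials as functions on column vectors *)

(** Making E a polynomial in y would require unique factorisation in K[y]. Instead D is pulled back
    to the lines [s *: a + y] with [a] fixed and generic. It becomes a polynomial in s over the
    domain K[y], of degree exactly 10 because D(a) is its top coefficient, and pseudo-division
    yields c0^2 D = E^2 with c0 a nonzero element of K[y]. Since y stays free, it can be specialised
    to b + t w: a zero of E over b forces a zero of D of twice the order in every direction w, not
    merely along the line, and this is what produces singular points. The finitely many open
    conditions on b (nonvanishing of c0, of Bezout constants, of leading coefficients) are
    multiplied into one polynomial, and b is chosen off its zeros while avoiding Sing(X): the span
    of P, a and b is a projective plane, whose codimension n - 1 exceeds dim Sing(X). *)

Notation ev x := (meval (fun i => x i 0)).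

Section Mpoly.
Variables (K : fieldType) (m : nat).
Implicit Types (p q : {mpoly K[m]}) (x v : 'cV[K]_m).

Lemma mpoly_alg_ind (P : {mpoly K[m]} -> Prop) :
  (forall c, P c%:MP) -> (forall i, P 'X_i) ->
  (forall p q, P p -> P q -> P (p + q)) ->
  (forall p q, P p -> P q -> P (p * q)) -> forall p, P p.
Proof.
move=> PC PX PD PM p; elim/mpolyind: p => [|c mu p _ _ Pp].
  by rewrite -mpolyC0; exact: PC.
apply: PD => //; rewrite -mul_mpolyC; apply: (PM); first exact: PC.
rewrite mpolyXE_id; apply: (big_ind P) => [|p1 p2|i _].
- by rewrite -mpolyC1; exact: PC.
- exact: PM.
elim: (mu i) => [|k IH]; first by rewrite expr0 -mpolyC1.
by rewrite exprS; exact: PM.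
Qed.

Definition lf (r : 'rV[K]_m) x : K := (r *m x) 0 0.
Definition lin (r : 'rV[K]_m) : {mpoly K[m]} := \sum_j r 0 j *: 'X_j.
Definition dirD v p : {mpoly K[m]} := \sum_i v i 0 *: p^`M(i).

Lemma lfD r x y : lf r (x + y) = lf r x + lf r y.
Proof. by rewrite /lf mulmxDr mxE. Qed.

Lemma lfZ r a x : lf r (a *: x) = a * lf r x.
Proof. by rewrite /lf -scalemxAr mxE. Qed.

Lemma lfB r x y : lf r (x - y) = lf r x - lf r y.
Proof. by rewrite lfD -scaleN1r lfZ mulN1r. Qed.

Lemma lf0 r : lf r 0 = 0.
Proof. by rewrite /lf mulmx0 mxE. Qed.

Lemma lfDl r r' x : lf (r + r') x = lf r x + lf r' x.
Proof. by rewrite /lf mulmxDl mxE. Qed.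

Lemma lfZl a r x : lf (a *: r) x = a * lf r x.
Proof. by rewrite /lf -scalemxAl mxE. Qed.

Lemma lf_delta r i : lf r (delta_mx i 0) = r 0 i.
Proof. by rewrite /lf -colE mxE. Qed.

Lemma lf_eq r r' : (forall x, lf r x = lf r' x) -> r = r'.
Proof. by move=> e; apply/rowP=> i; rewrite -!lf_delta. Qed.

Lemma lf_neq0 r : r != 0 -> exists x, lf r x != 0.
Proof.
move/eqP=> r0; apply: contrapT => nx; apply: r0; apply: lf_eq => x.
rewrite [in RHS]/lf mul0mx mxE; apply/eqP; apply: contrapT => /negP e.
by apply: nx; exists x.
Qed.

Lemma ev_lin x r : ev x (lin r) = lf r x.
Proof.
rewrite /lin /lf rmorph_sum mxE /=; apply: eq_bigr => j _.
by rewrite mevalZ mevalXU.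
Qed.

Lemma lin_homog r : lin r \is 1.-homog.
Proof. by apply: rpred_sum => j _; apply: rpredZ; rewrite dhomogX /= mdeg1. Qed.

(** Restriction to the parametrised line [x + 'X *: v]. It turns [dirD v] into the formal
    derivative, so that orders of vanishing in a direction become divisibility by powers of ['X]. *)
Definition ln x v : {mpoly K[m]} -> {poly K} :=
  mmap polyC (fun i => (x i 0)%:P + v i 0 *: 'X).

HB.instance Definition _ x v := GRing.RMorphism.copy (ln x v)
  (mmap polyC (fun i => (x i 0)%:P + v i 0 *: 'X)).

Lemma lnC x v c : ln x v c%:MP = c%:P.
Proof. exact: mmapC. Qed.

Lemma lnX x v i : ln x v 'X_i = (x i 0)%:P + v i 0 *: 'X.
Proof. by rewrite /ln mmapX mmap1U. Qed.

Lemma ln_horner x v p s : (ln x v p).[s] = ev (x + s *: v) p.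
Proof.
elim/mpoly_alg_ind: p => [c|i|p q IHp IHq|p q IHp IHq].
- by rewrite lnC hornerC mevalC.
- by rewrite lnX mevalXU !hornerE !mxE mulrC.
- by rewrite rmorphD hornerD IHp IHq rmorphD.
- by rewrite rmorphM hornerM IHp IHq rmorphM.
Qed.

Lemma dirDD v p q : dirD v (p + q) = dirD v p + dirD v q.
Proof.
by rewrite /dirD -big_split; apply: eq_bigr => i _; rewrite mderivD scalerDr.
Qed.

Lemma dirDM v p q : dirD v (p * q) = dirD v p * q + p * dirD v q.
Proof.
rewrite /dirD mulr_suml mulr_sumr -big_split; apply: eq_bigr => i _ /=.
by rewrite mderivM scalerDr -scalerAl -scalerAr.
Qed.

Lemma dirDC v c : dirD v c%:MP = 0.
Proof. by rewrite /dirD big1 // => i _; rewrite mderivC scaler0. Qed.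

Lemma dirDX v i : dirD v 'X_i = (v i 0)%:MP.
Proof.
rewrite /dirD (bigD1 i) //= big1 ?addr0 => [|j ji].
  have -> : (U_(i) : 'X_{1..m})%MM = (0 + U_(i))%MM by rewrite add0m.
  by rewrite mderivX mnmDE mnm0E mnm1E eqxx scale1r addmK mpolyX0 alg_mpolyC.
by rewrite mderivX mnm1E eq_sym (negPf ji) scale0r scaler0.
Qed.

Lemma dirDl v v' p : dirD (v + v') p = dirD v p + dirD v' p.
Proof.
by rewrite /dirD -big_split; apply: eq_bigr => i _; rewrite mxE scalerDl.
Qed.

Lemma dirDZl a v p : dirD (a *: v) p = a *: dirD v p.
Proof.
by rewrite /dirD scaler_sumr; apply: eq_bigr => i _; rewrite mxE scalerA.
Qed.

Lemma dirDZ v c p : dirD v (c *: p) = c *: dirD v p.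
Proof. by rewrite -!mul_mpolyC dirDM dirDC mul0r add0r. Qed.

Lemma dirD_comm u v p : dirD u (dirD v p) = dirD v (dirD u p).
Proof.
have E w q : dirD w q = \sum_i w i 0 *: q^`M(i) by [].
rewrite [in LHS](E v) (E u p).
have DS (w : 'cV_m) (G : 'I_m -> {mpoly K[m]}) (z : 'cV_m) :
    dirD w (\sum_i z i 0 *: G i) = \sum_i z i 0 *: dirD w (G i).
  elim/big_rec2: _ => [|i y1 y2 _ <-]; first by rewrite -mpolyC0 dirDC.
  by rewrite dirDD dirDZ.
rewrite !DS /dirD.
under eq_bigr => i _ do rewrite scaler_sumr.
rewrite exchange_big /=; apply: eq_bigr => j _; rewrite scaler_sumr.
apply: eq_bigr => i _; rewrite !scalerA mulrC; congr (_ *: _).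
exact: mderiv_comm.
Qed.

Lemma dirD_delta i p : dirD (delta_mx i 0) p = p^`M(i).
Proof.
rewrite /dirD (bigD1 i) //= big1 ?addr0 => [|j ji].
  by rewrite mxE !eqxx scale1r.
by rewrite mxE (negPf ji) scale0r.
Qed.

Lemma dirD_homog v p d : p \is d.-homog -> dirD v p \is d.-1.-homog.
Proof.
move=> hp; apply: rpred_sum => i _; apply: rpredZ.
apply/dhomogP => mu; rewrite mcoeff_msupp mcoeff_mderiv => h.
have : (mu + U_(i))%MM \in msupp p.
  by rewrite mcoeff_msupp; apply: contraNneq h => ->; rewrite mul0rn.
by move/dhomogP: hp => hp /hp /=; rewrite mdegD mdeg1 addn1 => <-.
Qed.

Lemma ln_deriv x v p : (ln x v p)^`() = ln x v (dirD v p).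
Proof.
elim/mpoly_alg_ind: p => [c|i|p q IHp IHq|p q IHp IHq].
- by rewrite lnC derivC dirDC rmorph0.
- by rewrite lnX derivD derivC derivZ derivX add0r dirDX lnC alg_polyC.
- by rewrite rmorphD derivD IHp IHq dirDD rmorphD.
- by rewrite dirDM rmorphD !rmorphM derivM IHp IHq.
Qed.

Lemma ev_homogZ d p a x : p \is d.-homog -> ev (a *: x) p = a ^+ d * ev x p.
Proof.
move=> hp; rewrite !mevalE mulr_sumr !big_seq; apply: eq_bigr => mu mu_p.
rewrite mulrCA; congr (_ * _).
under eq_bigr => i _ do rewrite mxE exprMn.
rewrite big_split /= prodrXr; congr (_ ^+ _ * _).
by rewrite -mdegE; move/dhomogP: hp; apply.
Qed.

End Mpoly.

Section Infinite.
Variable K : fieldType.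
Hypothesis charK : [pchar K] =i pred0.

Lemma natf_eq0 n : (n%:R == 0 :> K) = (n == 0)%N.
Proof. by move/pcharf0P: charK => ->. Qed.

Lemma natr_inj : injective (fun n : nat => n%:R : K).
Proof.
move=> a b /= e; wlog ab : a b e / (a <= b)%N => [W|].
  by case/orP: (leq_total a b) => ab; [|symmetry]; apply: W.
apply/eqP; rewrite eqn_leq ab /= -subn_eq0 -natf_eq0 natrB // e subrr.
exact: eqxx.
Qed.

Lemma poly_neq0_horner (p : {poly K}) : p != 0 -> exists s, p.[s] != 0.
Proof.
move=> p0; apply: contrapT => nz.
have := max_poly_roots p0 (rs := [seq n%:R | n <- iota 0 (size p)]).
rewrite map_inj_uniq ?iota_uniq; last exact: natr_inj.
rewrite size_map size_iota ltnn => H; apply/notF/H => //.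
apply/allP => s _; rewrite /root; apply: contrapT => /negP e.
by apply: nz; exists s.
Qed.

Lemma poly_eq_horner (p q : {poly K}) : (forall s, p.[s] = q.[s]) -> p = q.
Proof.
move=> e; apply/eqP; rewrite -subr_eq0; apply: contrapT => /negP.
by case/poly_neq0_horner => s; rewrite hornerD hornerN e subrr eqxx.
Qed.

Lemma avoid_seq (s : seq K) : exists c, c \notin s.
Proof.
have /poly_neq0_horner[c] : \prod_(a <- s) ('X - a%:P) != 0 :> {poly K}.
  by rewrite monic_neq0 // monic_prod_XsubC.
by rewrite -/(root _ _) root_prod_XsubC; exists c.
Qed.

Variable m : nat.
Implicit Types (p q : {mpoly K[m]}) (x v : 'cV[K]_m).

(** The partial derivatives of a function that vanishes everywhere vanish too. Differentiating
    lowers the degree of a chosen monomial and multiplies its coefficient by a nonzero integer,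
    whence an induction on that degree. *)
Lemma mpoly_ev0 p : (forall x, ev x p = 0) -> p = 0.
Proof.
move=> p0; apply/mpolyP => mu; rewrite mcoeff0.
have [d] : exists d, mdeg mu = d by eexists.
elim: d p p0 mu => [|d IH] p p0 mu.
  move/eqP; rewrite mdeg_eq0 => /eqP ->.
  rewrite -[RHS](p0 0) mevalE [in LHS](mpolyE p) raddf_sum /=.
  apply: eq_bigr => nu _; rewrite mcoeffZ mcoeffX; congr (_ * _).
  have [->|nu0] := eqVneq nu 0%MM.
    by rewrite big1 // => i _; rewrite mnm0E expr0.
  have /existsP[i nui] : [exists i, nu i != 0%N].
    apply: contraT; rewrite negb_exists => /forallP H; case/eqP: nu0.
    by apply/mnmP => i; rewrite mnm0E; apply/eqP; rewrite -[_ == _]negbK.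
  by rewrite (bigD1 i) //= mxE expr0n (negPf nui) mul0r.
move=> dmu; have /existsP[i mui] : [exists i, mu i != 0%N].
  apply: contraT; rewrite negb_exists => /forallP H.
  suff mu0 : mu = 0%MM by move: dmu; rewrite mu0 mdeg0.
  by apply/mnmP => i; rewrite mnm0E; apply/eqP; rewrite -[_ == _]negbK.
have le : (U_(i) <= mu)%MM.
  apply/mnm_lepP => j; rewrite mnm1E; case: eqP => // <-.
  by rewrite lt0n.
have D0 : p^`M(i)@_(mu - U_(i)) = 0.
  apply: IH => [x|]; last first.
    by apply/eqP; rewrite -eqSS -dmu -{2}(submK le) mdegD mdeg1 addn1.
  have l0 : ln x (delta_mx i 0) p = 0.
    by apply: poly_eq_horner => s; rewrite ln_horner p0 horner0.
  have := ln_deriv x (delta_mx i 0) p; rewrite l0 deriv0 => /(congr1 (horner^~ 0)).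
  by rewrite ln_horner scale0r addr0 horner0 dirD_delta.
move/eqP: D0; rewrite mcoeff_mderiv submK // -mulr_natr mulf_eq0 natf_eq0.
by rewrite orbF => /eqP.
Qed.

Lemma mpoly_ev_eq p q : (forall x, ev x p = ev x q) -> p = q.
Proof.
move=> e; apply/eqP; rewrite -subr_eq0; apply/eqP; apply: mpoly_ev0 => x.
by rewrite rmorphB /= e subrr.
Qed.

Lemma mpoly_neq0_ev p : p != 0 -> exists x, ev x p != 0.
Proof.
move/eqP=> p0; apply: contrapT => nz; apply: p0; apply: mpoly_ev0 => x.
by apply/eqP; apply: contrapT => /negP e; apply: nz; exists x.
Qed.

Lemma poly_deriv0 (q : {poly K}) : q^`() = 0 -> q = (q`_0)%:P.
Proof.
move=> q0; apply/polyP => -[|i]; rewrite coefC //=.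
have := congr1 (fun q : {poly K} => q`_i) q0; rewrite coef_deriv coef0 => /eqP.
by rewrite -mulr_natr mulf_eq0 natf_eq0 orbF => /eqP.
Qed.

Lemma dirD0_shift v p x s : dirD v p = 0 -> ev (x + s *: v) p = ev x p.
Proof.
move=> d0; rewrite -ln_horner.
have /poly_deriv0 -> : (ln x v p)^`() = 0 by rewrite ln_deriv d0 rmorph0.
by rewrite hornerC -horner_coef0 ln_horner scale0r addr0.
Qed.

Lemma ev_dirD v p x (q : {poly K}) :
  (forall s, ev (x + s *: v) p = q.[s]) -> ev x (dirD v p) = q^`().[0].
Proof.
move=> e; have <- : ln x v p = q.
  by apply: poly_eq_horner => s; rewrite ln_horner.
by rewrite ln_deriv ln_horner scale0r addr0.
Qed.

(** Both sides are the derivative at s = 0 of p((1 + s) x) = (1 + s)^d p(x). *)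
Lemma euler p d x : p \is d.-homog -> ev x (dirD x p) = d%:R * ev x p.
Proof.
move=> hp; rewrite (@ev_dirD _ _ _ (('X + 1) ^+ d * (ev x p)%:P)) => [|s].
  rewrite derivM derivC mulr0 addr0 deriv_exp derivD derivX -polyC1 derivC addr0.
  by rewrite mul1r hornerM hornerMn horner_exp !hornerE expr1n.
rewrite -[X in X + _]scale1r -scalerDl (ev_homogZ _ _ hp) !hornerE.
by rewrite [s + 1]addrC.
Qed.

Lemma homog1P p : p \is 1.-homog -> exists r, p = lin r.
Proof.
move=> hp; exists (\row_j p@_(U_(j))); apply/mpolyP => mu.
rewrite /lin raddf_sum /=; under eq_bigr => i _ do rewrite mcoeffZ mcoeffX mxE.
have [/mdeg1P[i /eqP ->]|mu1] := boolP (mdeg mu == 1%N).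
  rewrite (bigD1 i) //= eqxx mulr1 big1 ?addr0 // => j ji.
  rewrite (_ : _ == _ = false) ?mulr0 //; apply/negP => /eqP/mnmP/(_ j).
  by rewrite !mnm1E eqxx eq_sym (negPf ji).
rewrite big1 => [|i _]; first by rewrite (dhomog_nemf_coeff hp).
rewrite (_ : _ == _ = false) ?mulr0 //; apply: contraNF mu1 => /eqP <-.
by rewrite mdeg1.
Qed.

End Infinite.

HB.instance Definition _ (K : fieldType) r m (M : 'M[K]_(r, m)) :=
  GRing.RMorphism.copy (lin_subst M)
    (comp_mpoly [tuple \sum_(j < m) M i j *: 'X_j | i < r]).

Lemma ev_lin_subst (K : fieldType) r m (M : 'M[K]_(r, m)) A (x : 'cV[K]_m) :
  ev x (lin_subst M A) = ev (M *m x) A.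
Proof.
rewrite comp_mpoly_meval; apply: meval_eq => i.
rewrite tnth_mktuple rmorph_sum mxE /=; apply: eq_bigr => j _.
by rewrite mevalZ mevalXU.
Qed.

Lemma lin_subst_homog (K : fieldType) r m (M : 'M[K]_(r, m)) A d :
  A \is d.-homog -> lin_subst M A \is d.-homog.
Proof.
move=> hA; rewrite /lin_subst comp_mpolyEX big_seq.
apply: rpred_sum => mu muA; apply: rpredZ; rewrite comp_mpolyX.
have <- : mdeg mu = d by move/dhomogP: hA; exact.
rewrite mdegE; elim/big_ind2: _ => [|d1 p1 d2 p2 h1 h2|i _].
- exact: dhomog1.
- exact: dhomogM.
rewrite tnth_mktuple; move: (mu i) => k; rewrite -{2}[k]mul1n.
apply: dhomogMn.
by apply: rpred_sum => j _; apply: rpredZ; rewrite dhomogX /= mdeg1.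
Qed.

(** * Forms with one variable singled out, and changes of coordinates *)

Section Bihomog.
Variables (K : fieldType) (m : nat).
Implicit Type q : {poly {mpoly K[m]}}.

(** Homogeneity of total degree [d] when ['X] itself has degree 1. *)
Definition bihomog d q : Prop :=
  forall i, if (i <= d)%N then q`_i \is (d - i).-homog else q`_i == 0.

Lemma bihomog_size d q : bihomog d q -> (size q <= d.+1)%N.
Proof.
by move=> hq; apply/leq_sizeP => i di; move: (hq i); rewrite leqNgt di => /eqP.
Qed.

Lemma bihomogD d q q' : bihomog d q -> bihomog d q' -> bihomog d (q + q').
Proof.
move=> hq hq' i; move: (hq i) (hq' i); rewrite coefD; case: ifP => _.
  exact: rpredD.
by move=> /eqP -> /eqP ->; rewrite addr0.
Qed.

Lemma bihomogM d e q q' :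
  bihomog d q -> bihomog e q' -> bihomog (d + e) (q * q').
Proof.
move=> hq hq' i; rewrite coefM; case: ifP => ide.
  apply: rpred_sum => j _; move: (hq j) (hq' (i - j)%N).
  have ji : (j <= i)%N by rewrite -ltnS.
  case: ifP => jd; last by move=> /eqP ->; rewrite mul0r rpred0.
  case: ifP => ije; last by move=> _ /eqP ->; rewrite mulr0 rpred0.
  have -> : (d + e - i = (d - j) + (e - (i - j)))%N.
    by rewrite addnBA // addnBAC // -subnDA subnKC.
  exact: dhomogM.
rewrite big1 // => j _; have ji : (j <= i)%N by rewrite -ltnS.
move: (hq j) (hq' (i - j)%N).
case: ifP => jd; last by move=> /eqP ->; rewrite mul0r.
case: ifP => ije; last by move=> _ /eqP ->; rewrite mulr0.
by case/negP: ide; rewrite -(subnKC ji) leq_add.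
Qed.

Lemma bihomogC d p : p \is d.-homog -> bihomog d p%:P.
Proof.
move=> hp i; rewrite coefC; case: i => [|i] /=; first by rewrite subn0.
by rewrite rpred0; case: ifP.
Qed.

Lemma bihomogX (c : {mpoly K[m]}) : c \is 0.-homog -> bihomog 1 (c *: 'X).
Proof.
move=> hc i; rewrite coefZ coefX; case: i => [|[|i]] /=.
- by rewrite mulr0 rpred0.
- by rewrite mulr1.
by rewrite mulr0.
Qed.

End Bihomog.

Lemma mpolyC_homog (K : fieldType) m (c : K) : c%:MP_[m] \is 0.-homog.
Proof. by rewrite -[c%:MP]alg_mpolyC; apply: rpredZ; exact: dhomog1. Qed.

(* The substitution [x |-> 'X *: a + N *m y], with [y] the variables of the
   coefficients. Locked, like [ev2], [unsub] and [evF] below, because unifying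
   the unfolded morphisms is intractable. *)
HB.lock Definition sub (K : fieldType) (r m : nat) (a : 'cV[K]_r)
    (N : 'M[K]_(r, m)) : {mpoly K[r]} -> {poly {mpoly K[m]}} :=
  mmap (polyC \o @mpolyC m K)
    (fun j => (a j 0)%:MP *: 'X + (lin (row j N))%:P).

HB.lock Definition ev2 (K : fieldType) (m : nat) (u : 'cV[K]_m) (s : K)
    (q : {poly {mpoly K[m]}}) : K := (map_poly (ev u) q).[s].

Section Ev2.
Variables (K : fieldType) (m : nat) (u : 'cV[K]_m) (s : K).

Fact ev2_is_additive : additive (ev2 u s).
Proof.
by move=> p q; rewrite unlock [map_poly _ _]rmorphB hornerD hornerN.
Qed.

Fact ev2_is_multiplicative : multiplicative (ev2 u s).
Proof.
rewrite unlock; split=> [p q|]; first by rewrite [map_poly _ _]rmorphM hornerM.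
by rewrite [map_poly _ _]rmorph1 hornerC.
Qed.

HB.instance Definition _ :=
  GRing.isAdditive.Build {poly {mpoly K[m]}} K (ev2 u s) ev2_is_additive.
HB.instance Definition _ :=
  GRing.isMultiplicative.Build {poly {mpoly K[m]}} K (ev2 u s)
    ev2_is_multiplicative.

Lemma ev2_def q : ev2 u s q = (map_poly (ev u) q).[s].
Proof. by rewrite unlock. Qed.

Lemma ev2C c : ev2 u s c%:P = ev u c.
Proof. by rewrite ev2_def map_polyC hornerC. Qed.

Lemma ev2X : ev2 u s 'X = s.
Proof. by rewrite ev2_def map_polyX hornerX. Qed.

Lemma ev2D : {morph ev2 u s : p q / p + q}.
Proof. exact: rmorphD. Qed.

Lemma ev2M : {morph ev2 u s : p q / p * q}.
Proof. exact: rmorphM. Qed.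

Lemma ev2Z c p : ev2 u s (c *: p) = ev u c * ev2 u s p.
Proof. by rewrite -mul_polyC ev2M ev2C. Qed.

Lemma ev2E q : ev2 u s q = \sum_(i < size q) ev u q`_i * s ^+ i.
Proof.
rewrite -[in LHS](coefK q) poly_def rmorph_sum; apply: eq_bigr => i _ /=.
by rewrite ev2Z rmorphXn /= ev2X.
Qed.

End Ev2.

Lemma polympoly_ev_eq (K : fieldType) m (q q' : {poly {mpoly K[m]}}) :
  [pchar K] =i pred0 -> (forall u s, ev2 u s q = ev2 u s q') -> q = q'.
Proof.
move=> charK e; apply/polyP => i; apply: (mpoly_ev_eq charK) => u.
have /(congr1 (fun p : {poly K} => p`_i)) : map_poly (ev u) q = map_poly (ev u) q'.
  by apply: (poly_eq_horner charK) => s; rewrite -!ev2_def.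
by rewrite !coef_map.
Qed.

(** Inverse of [sub a N] as soon as [c] and [M] are the coordinates dual to [a] and [N]. *)
HB.lock Definition unsub (K : fieldType) (r m : nat) (c : 'rV[K]_r)
    (M : 'M[K]_(m, r)) (q : {poly {mpoly K[m]}}) : {mpoly K[r]} :=
  (map_poly (lin_subst M) q).[lin c].

Section Unsub.
Variables (K : fieldType) (r m : nat) (c : 'rV[K]_r) (M : 'M[K]_(m, r)).
Local Notation unsub := (unsub c M).

Lemma unsub_def q : unsub q = (map_poly (lin_subst M) q).[lin c].
Proof. by rewrite unlock. Qed.

Fact unsub_is_additive : additive unsub.
Proof.
by move=> p q; rewrite !unsub_def [map_poly _ _]rmorphB hornerD hornerN.
Qed.

Fact unsub_is_multiplicative : multiplicative unsub.
Proof.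
split=> [p q|]; rewrite !unsub_def; last by rewrite [map_poly _ _]rmorph1 hornerC.
by rewrite [map_poly _ _]rmorphM hornerM.
Qed.

HB.instance Definition _ :=
  GRing.isAdditive.Build {poly {mpoly K[m]}} {mpoly K[r]} unsub
    unsub_is_additive.
HB.instance Definition _ :=
  GRing.isMultiplicative.Build {poly {mpoly K[m]}} {mpoly K[r]} unsub
    unsub_is_multiplicative.

Lemma unsubC A : unsub A%:P = lin_subst M A.
Proof. by rewrite unsub_def map_polyC hornerC. Qed.

Lemma unsubX : unsub 'X = lin c.
Proof. by rewrite unsub_def map_polyX hornerX. Qed.

Lemma unsubM : {morph unsub : p q / p * q}. Proof. exact: rmorphM. Qed.
Lemma unsubD : {morph unsub : p q / p + q}. Proof. exact: rmorphD. Qed.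
Lemma unsubB : {morph unsub : p q / p - q}. Proof. exact: rmorphB. Qed.

Lemma unsubXn k : {morph unsub : p / p ^+ k}.
Proof. exact: rmorphXn. Qed.

End Unsub.

Section Sub.
Variables (K : fieldType) (r m : nat) (a : 'cV[K]_r) (N : 'M[K]_(r, m)).
Local Notation sub := (sub a N).

Fact sub_is_additive : additive sub.
Proof. by rewrite unlock; exact: raddfB. Qed.

Fact sub_is_multiplicative : multiplicative sub.
Proof. by rewrite unlock; split; [exact: rmorphM | exact: rmorph1]. Qed.

HB.instance Definition _ :=
  GRing.isAdditive.Build {mpoly K[r]} {poly {mpoly K[m]}} sub sub_is_additive.
HB.instance Definition _ :=
  GRing.isMultiplicative.Build {mpoly K[r]} {poly {mpoly K[m]}} sub
    sub_is_multiplicative.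

Lemma subC c : sub c%:MP = c%:MP%:P.
Proof. by rewrite unlock mmapC. Qed.

Lemma subX j : sub 'X_j = (a j 0)%:MP *: 'X + (lin (row j N))%:P.
Proof. by rewrite unlock mmapX mmap1U. Qed.

Lemma subD : {morph sub : p q / p + q}.
Proof. exact: rmorphD. Qed.

Lemma subM : {morph sub : p q / p * q}.
Proof. exact: rmorphM. Qed.

Lemma sub_ev p (u : 'cV[K]_m) s : ev2 u s (sub p) = ev (s *: a + N *m u) p.
Proof.
elim/mpoly_alg_ind: p => [c|j|p q IHp IHq|p q IHp IHq].
- by rewrite subC ev2C !mevalC.
- by rewrite subX ev2D ev2Z ev2X ev2C !mevalXU mevalC ev_lin !mxE /lf -row_mul !mxE mulrC.
- by rewrite subD ev2D IHp IHq mevalD.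
- by rewrite subM ev2M IHp IHq mevalM.
Qed.

Lemma sub_bihomog p d : p \is d.-homog -> bihomog d (sub p).
Proof.
move=> hp; rewrite [p]mpolyE rmorph_sum /= big_seq.
apply: big_ind => [|q q'|mu mup].
- by move=> i; rewrite coef0 rpred0; case: ifP.
- exact: bihomogD.
rewrite -mul_mpolyC subM subC -[d]add0n; apply: bihomogM.
  exact/bihomogC/mpolyC_homog.
have <- : mdeg mu = d by move/dhomogP: hp; exact.
rewrite mpolyXE_id rmorph_prod /= mdegE.
apply: (big_ind2 (fun d q => bihomog d q)) => [|d1 p1 d2 p2 h1 h2|i _].
- by apply: bihomogC; exact: dhomog1.
- exact: bihomogM.
rewrite rmorphXn /=; elim: (mu i) => [|k IH].
  by rewrite expr0; apply: bihomogC; exact: dhomog1.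
rewrite exprS -[k.+1]add1n; apply: bihomogM => //; rewrite subX.
apply: bihomogD; last exact/bihomogC/lin_homog.
exact/bihomogX/mpolyC_homog.
Qed.

(** At y = 0 the substituted polynomial is p(s a) = p(a) s^d, and by bihomogeneity the coefficient
    of s^d does not depend on y. *)
Lemma sub_coef_top p d : [pchar K] =i pred0 -> p \is d.-homog ->
  (sub p)`_d = (ev a p)%:MP.
Proof.
move=> charK hp; apply: (mpoly_ev_eq charK) => u; rewrite mevalC.
have h0 : map_poly (ev (0 : 'cV[K]_m)) (sub p) = (ev a p)%:P * 'X^d.
  apply: (poly_eq_horner charK) => t; transitivity (ev2 0 t (sub p)).
    by rewrite ev2_def.
  by rewrite sub_ev mulmx0 addr0 (ev_homogZ _ _ hp) !hornerE mulrC.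
have := sub_bihomog hp d; rewrite leqnn subnn => h.
have hu (x : 'cV[K]_m) : ev x (sub p)`_d = ev (0 : 'cV[K]_m) (sub p)`_d.
  by rewrite -[in RHS](scale0r x) (ev_homogZ _ _ h) expr0 mul1r.
have := congr1 (fun p : {poly K} => p`_d) h0.
by rewrite coef_map coefCM coefXn eqxx mulr1 hu.
Qed.

Section Inverse.
Hypothesis charK : [pchar K] =i pred0.
Variables (c : 'rV[K]_r) (M : 'M[K]_(m, r)).
Local Notation unsub := (unsub c M).

Lemma unsub_ev q (x : 'cV[K]_r) :
  ev x (unsub q) = ev2 (M *m x) (lf c x) q.
Proof.
rewrite ev2_def unsub_def -ev_lin -horner_map -map_poly_comp; congr (_.[_]).
by apply: eq_map_poly => A /=; rewrite ev_lin_subst.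
Qed.

Lemma unsubK : a *m c + N *m M = 1%:M -> cancel sub unsub.
Proof.
move=> e p; apply: (mpoly_ev_eq charK) => x.
rewrite unsub_ev sub_ev (_ : _ + _ = x) //.
rewrite -[RHS](mul1mx x) -e mulmxDl -!mulmxA; congr (_ + _).
by apply/colP => k; rewrite /lf [LHS]mxE [RHS]mxE big_ord1 mulrC.
Qed.

Lemma subK : c *m a = 1%:M -> c *m N = 0 -> M *m a = 0 -> M *m N = 1%:M ->
  cancel unsub sub.
Proof.
move=> ca cN Ma MN q; apply: (polympoly_ev_eq charK) => u s.
rewrite sub_ev unsub_ev mulmxDr mulmxA MN mul1mx -scalemxAr Ma scaler0 add0r.
by rewrite lfD lfZ /lf ca mulmxA cN mul0mx !mxE mulr1 addr0.
Qed.

End Inverse.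
End Sub.

Lemma projection_coords (K : fieldType) n (v : 'cV[K]_n.+2)
    (M : 'M[K]_(n.+1, n.+2)) (c : 'rV[K]_n.+2) :
  \rank M = n.+1 -> M *m v = 0 -> c *m v = 1%:M ->
  exists N : 'M[K]_(n.+2, n.+1),
    [/\ c *m N = 0, M *m N = 1%:M & v *m c + N *m M = 1%:M].
Proof.
move=> rM Mv cv; have rf : row_free M by rewrite /row_free rM.
(* A right inverse of [M], corrected along [v], which [M] kills, so that [c] kills it. *)
pose N := pinvmx M - v *m (c *m pinvmx M).
have cN : c *m N = 0 by rewrite mulmxBr [c *m (v *m _)]mulmxA cv mul1mx subrr.
have MN : M *m N = 1%:M by rewrite mulmxBr [M *m (v *m _)]mulmxA Mv mul0mx subr0 mulmxVp.
exists N; split=> //.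
(* A one-sided inverse of a square matrix is two-sided; the product in the other order is the
   remaining relation. *)
have : col_mx c M *m row_mx v N = 1%:M :> 'M_(1 + n.+1).
  by rewrite mul_col_row cv cN Mv MN -scalar_mx_block.
by move/mulmx1C; rewrite mul_row_col.
Qed.

Definition disc3 (R : comNzRingType) (l q c g : R) : R :=
  q ^+ 2 * c ^+ 2 - 4 * l * c ^+ 3 - 4 * q ^+ 3 * g - 27 * l ^+ 2 * g ^+ 2
  + 18 * l * q * c * g.

Lemma morph_disc3 (A B : comNzRingType) (h : {rmorphism A -> B}) l q c' g :
  h (disc3 l q c' g) = disc3 (h l) (h q) (h c') (h g).
Proof.
by rewrite /disc3; ring.
Qed.

Lemma vieta3 (R : comNzRingType) (x y z : R) :
  ('X - x%:P) * (('X - y%:P) * ('X - z%:P)) =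
  'X^3 - (x + y + z)%:P * 'X^2 + (x * y + x * z + y * z)%:P * 'X
  - (x * y * z)%:P.
Proof. by rewrite !polyCD !polyCM; ring. Qed.

(** * Cubic Galois extensions *)

Section CubicExtension.
Variables (L : fieldType) (S : divringClosed L).

Local Notation F := (subfield_type S).
Local Notation fval := (@subfield_val L S).

Definition fmap (p : {poly F}) : {poly L} := map_poly (val : F -> L) p.

Lemma fmapM : {morph fmap : p q / p * q}.
Proof. by move=> p q; rewrite /fmap rmorphM. Qed.

Lemma fmap_gcd p q : fmap (gcdp p q) = gcdp (fmap p) (fmap q).
Proof. exact: (gcdp_map (val : {rmorphism F -> L})). Qed.

Lemma fmap_deriv p : fmap p^`() = (fmap p)^`().
Proof. by rewrite /fmap -(deriv_map (val : {rmorphism F -> L})). Qed.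

Lemma fmap_coef p i : (fmap p)`_i = val p`_i.
Proof. exact: (coef_map (val : {rmorphism F -> L})). Qed.

Definition to_sub (x : L) : F := insubd 0 x.

Lemma to_subK x : x \in S -> fval (to_sub x) = x.
Proof. by move=> xS; rewrite -[LHS]/(val _) insubdK. Qed.

Definition poly_to_sub (p : {poly L}) : {poly F} := map_poly to_sub p.

Lemma to_sub0 : to_sub 0 = 0.
Proof. by apply: val_inj; rewrite /= to_subK // rpred0. Qed.

Lemma poly_to_subK p : p \is a polyOver S -> fmap (poly_to_sub p) = p.
Proof.
move/polyOverP => pS; apply/polyP => i.
by rewrite fmap_coef coef_map_id0 ?to_sub0 // /= to_subK.
Qed.

Lemma polyOver_map_val (p : {poly F}) : fmap p \is a polyOver S.
Proof. by apply/polyOverP => i; rewrite fmap_coef; exact: valP. Qed.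

(** The gcd is computed over the field [F], so its coefficients lie in [S], and irreducibility makes
    it constant or associate to [p]. The common root excludes a constant. *)
Lemma irreducible_dvd p q x : irreducible_over S p -> q \is a polyOver S ->
  root p x -> root q x -> p %| q.
Proof.
move=> [pS sp irr] qS px qx; pose p' := poly_to_sub p; pose q' := poly_to_sub q.
have Ep : fmap p' = p by exact: poly_to_subK.
have Eq : fmap q' = q by exact: poly_to_subK.
have [r Er] : exists r, p' = r * gcdp p' q' by apply/dvdpP; exact: dvdp_gcdl.
have := congr1 fmap Er.
rewrite Ep fmapM fmap_gcd Ep Eq => Er'.
case: (irr _ _ _ _ Er').
- exact: polyOver_map_val.
- by rewrite -Ep -Eq -fmap_gcd; exact: polyOver_map_val.
- move=> /eqP/size_poly1P[c c0 ec].
  have : p %= gcdp p q by rewrite {1}Er' ec mul_polyC eqp_scale.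
  by move/eqp_dvdl => ->; exact: dvdp_gcdr.
- move=> /eqP co.
  have : root (gcdp p q) x by rewrite root_gcd px.
  move/eqP: co => /eqP/size_poly1P[c c0 ->].
  by rewrite rootC (negPf c0).
Qed.

Variable t : L.
Hypothesis span : forall z, exists a b c, [/\ a \in S, b \in S, c \in S
  & z = a + b * t + c * t ^+ 2].

Section Kummer.
Variable w : L.
Hypotheses (char0 : [pchar L] =i pred0) (w1 : w ^+ 2 + w + 1 = 0).
Hypothesis t3 : t ^+ 3 \in S.

Lemma kummer_annihilator x : exists2 q : {poly L}, q \is a polyOver S &
  exists2 s, q = \prod_(r <- s) ('X - r%:P) & x \in s.
Proof.
have [a [b [c [aS bS cS ->]]]] := span x.
set u := b * t; set v := c * t ^+ 2.
(* The images of [x] under t -> t, t -> w t and t -> w^2 t, with w^2 written as -1 - w. Their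
   symmetric functions involve only t^3. *)
pose s := [:: a + u + v; a + w * u + (-1 - w) * v; a + (-1 - w) * u + w * v].
exists (\prod_(r <- s) ('X - r%:P)); last by exists s => //; rewrite inE eqxx.
rewrite /s !big_cons big_nil mulr1.
set x1 := a + u + v; set x2 := a + w * u + _; set x3 := a + _ * u + _.
rewrite vieta3.
have -> : x1 + x2 + x3 = 3 * a by rewrite /x1 /x2 /x3; ring.
have -> : x1 * x2 + x1 * x3 + x2 * x3 = 3 * a ^+ 2 - 3 * (b * c * t ^+ 3).
  rewrite [LHS](_ : _ = 3 * a ^+ 2 - 3 * (b * c * t ^+ 3)
     - (w ^+ 2 + w + 1) * (u - v) ^+ 2); last by rewrite /x1 /x2 /x3 /u /v; ring.
  by rewrite w1 mul0r subr0.
have -> : x1 * x2 * x3 = a ^+ 3 + b ^+ 3 * t ^+ 3 + c ^+ 3 * (t ^+ 3) ^+ 2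
    - 3 * (a * b * c * t ^+ 3).
  rewrite [LHS](_ : _ = a ^+ 3 + b ^+ 3 * t ^+ 3 + c ^+ 3 * (t ^+ 3) ^+ 2
    - 3 * (a * b * c * t ^+ 3)
     - (w ^+ 2 + w + 1) * (u - v) ^+ 2 * (a + u + v)).
    by rewrite w1 !mul0r subr0.
  by rewrite /x1 /x2 /x3 /u /v; ring.
have XS : 'X \is a polyOver S by exact: polyOverX.
have nS k : (k%:R : L) \in S by exact: rpred_nat.
by apply: rpredB; [apply: rpredD; [apply: rpredB|]|];
  do ?[exact: rpredX | apply: rpredM | rewrite polyOverC | exact: rpredX XS];
  do ?[done | apply: rpredX | apply: rpredM | apply: rpredB | apply: rpredD].
Qed.

(** An irreducible polynomial with root [x] divides the split annihilator of [x], hence splits. It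
    is separable because, in characteristic 0, it cannot divide its derivative. *)
Lemma kummer_galois : galois_ext S.
Proof.
have ann x := kummer_annihilator x.
split.
- move=> x; have [q qS [s Eq xs]] := ann x; exists q; split=> //.
    by rewrite Eq monic_neq0 // monic_prod_XsubC.
  by rewrite Eq root_prod_XsubC.
- move=> p pirr [x px]; have [q qS [s Eq xs]] := ann x.
  have : p %| q by apply: (irreducible_dvd pirr) px _; rewrite // Eq root_prod_XsubC.
  by rewrite Eq => /dvdp_prod_XsubC[mk pE]; exists (mask mk s).
move=> p pirr [x px]; rewrite unlock.
have [pS sp _] := pirr; have p0 : p != 0 by rewrite -size_poly_gt0; apply: leq_trans sp.
apply/negPn/negP => nco.
have [_ _ irr] := pirr; pose p' := poly_to_sub p.
have Ep : fmap p' = p by exact: poly_to_subK.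
have Ed : fmap p'^`() = p^`() by rewrite fmap_deriv Ep.
have [r Er] : exists r, p' = r * gcdp p' p'^`() by apply/dvdpP; exact: dvdp_gcdl.
have := congr1 fmap Er.
rewrite Ep fmapM fmap_gcd Ep Ed => Er'.
case: (irr _ _ _ _ Er').
- exact: polyOver_map_val.
- by rewrite -Ed -Ep -fmap_gcd; exact: polyOver_map_val.
- move=> /eqP/size_poly1P[c c0 ec].
  have : p %= gcdp p p^`() by rewrite {1}Er' ec mul_polyC eqp_scale.
  move/eqp_dvdl => E; have : p %| p^`() by rewrite E dvdp_gcdr.
  have d0 : p^`() != 0.
    apply: contraTneq sp => d0; rewrite -leqNgt.
    by rewrite (poly_deriv0 char0 d0) size_polyC leq_b1.
  move/(dvdp_leq d0); rewrite leqNgt lt_size_deriv //.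
by move=> /eqP co; case/negP: nco.
Qed.

End Kummer.

Section Discriminant.
Hypothesis indep : forall a b c, a \in S -> b \in S -> c \in S ->
  a + b * t + c * t ^+ 2 = 0 -> [/\ a = 0, b = 0 & c = 0].
Variables l q c g : L.
Hypotheses (lS : l \in S) (qS : q \in S) (cS : c \in S) (gS : g \in S).
Hypotheses (l0 : l != 0) (pt : l * t ^+ 3 + q * t ^+ 2 + c * t + g = 0).

(* If [A] is the matrix of multiplication by [e] on the basis 1, t, t^2, then
   [\det A ^+ 2 = d ^+ 3], so [d] is the square of [\det A / d]. *)
Lemma square_of_square_root d e : e ^+ 2 = d -> d \in S -> d != 0 ->
  exists2 f, f \in S & f ^+ 2 = d.
Proof.
move=> ed dS d0.
have row z : exists r : 'I_3 -> L, (forall j, r j \in S) /\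
    z = \sum_(j < 3) r j * t ^+ j.
  have [x [y [k [xS yS kS ->]]]] := span z.
  exists (fun j : 'I_3 => nth 0 [:: x; y; k] j); split.
    by case=> -[|[|[|]]].
  by rewrite !big_ord_recr big_ord0 /= add0r expr0 mulr1 expr1.
have [M HM] := choice (fun i : 'I_3 => row (e * t ^+ i)).
pose A := \matrix_(i, j) M i j.
have AS i j : A i j \in S by rewrite mxE; case: (HM i).
pose T : 'cV[L]_3 := \col_i t ^+ i.
have AT : A *m T = e *: T.
  apply/colP => i; rewrite !mxE; have [_ ->] := HM i.
  by apply: eq_bigr => j _; rewrite !mxE.
have free (r : 'rV[L]_3) : (forall j, r 0 j \in S) -> r *m T = 0 -> r = 0.
  move=> rS rT; have : (r *m T) 0 0 = 0 by rewrite rT mxE.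
  rewrite mxE !big_ord_recr big_ord0 /= !mxE add0r expr0 mulr1 expr1.
  set i0 := widen_ord _ _; set i1 := widen_ord _ _; set i2 := ord_max.
  case/indep; rewrite // => r0 r1 r2; apply/rowP => j; rewrite mxE.
  case: j => -[|[|[|//]]] j3.
  - by rewrite -r0; congr (r _ _); apply: val_inj.
  - by rewrite -r1; congr (r _ _); apply: val_inj.
  - by rewrite -r2; congr (r _ _); apply: val_inj.
have AA : A *m A = d%:M.
  apply/eqP; rewrite -subr_eq0; apply/eqP/row_matrixP => i; rewrite row0.
  apply: free => [j|].
    rewrite !mxE rpredB // ?rpred_sum // => [k _|]; first exact: rpredM.
    by case: (_ == _); rewrite ?mulr1n ?mulr0n ?rpred0.
  rewrite -row_mul mulmxBl -mulmxA !AT -scalemxAr AT scalerA -expr2 ed.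
  by rewrite mul_scalar_mx subrr row0.
have dA : (\det A) ^+ 2 = d ^+ 3.
  by rewrite expr2 -det_mulmx AA det_scalar.
exists (\det A / d).
  rewrite rpred_div //; apply: rpred_sum => s _; apply: rpredM.
    by rewrite rpredX // rpredN rpred1.
  by apply: rpred_prod => i _.
by rewrite exprMn dA exprVn; field.
Qed.

Lemma small_root (p : {poly L}) : p \is a polyOver S -> (size p <= 3)%N ->
  root p t -> p = 0.
Proof.
move=> /polyOverP pS sp /eqP; rewrite (horner_coef_wide _ sp).
rewrite !big_ord_recr big_ord0 /= add0r expr0 mulr1 expr1 => /indep[] // p0 p1 p2.
apply/polyP => i; rewrite coef0; case: i => [|[|[|i]]] //.
by apply: nth_default; apply: leq_trans sp _.
Qed.

(** The cubic is irreducible, as a proper factor with root [t] would have degree at most 2.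
    Normality and separability give it three distinct roots in [L], so its discriminant has a
    nonzero square root there. The descent to [S] rests on the odd degree of the extension and uses
    no automorphism. *)
Lemma galois_disc_square : galois_ext S ->
  disc3 l q c g != 0 /\ exists2 e, e \in S & e ^+ 2 = disc3 l q c g.
Proof.
move=> [_ normS sepS]; pose p := Poly [:: g; c; q; l].
have Ep : p = [:: g; c; q; l] :> seq L by exact: (@PolyK _ 0).
have sp : size p = 4%N by rewrite Ep.
have pS : p \is a polyOver S.
  by apply/polyOverP => i; rewrite Ep; case: i => [|[|[|[|i]]]] //=; rewrite nth_nil rpred0.
have pt0 : root p t.
  rewrite /root horner_coef sp !big_ord_recr big_ord0 Ep /= add0r expr0 mulr1.
  by rewrite expr1 -pt; apply/eqP; ring.
have p0 : p != 0 by rewrite -size_poly_gt0 sp.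
have pirr : irreducible_over S p.
  split=> //; first by rewrite sp.
  move=> u v uS vS puv; have := p0; rewrite puv mulf_eq0 negb_or => /andP[u0 v0].
  have := sp; rewrite puv size_mul // => suv.
  have : root u t || root v t by rewrite -rootM -puv.
  move: u0 v0; rewrite -!size_poly_gt0 => u0 v0.
  have [u1|u1] := leqP (size u) 1; first by left; apply/eqP; rewrite eqn_leq u1.
  have [v1|v1] := leqP (size v) 1; first by right; apply/eqP; rewrite eqn_leq v1.
  have aux (i j : nat) : (i + j).-1 = 4%N -> (1 < j)%N -> (i <= 3)%N by lia.
  case/orP => [/(small_root uS)|/(small_root vS)] H.
  - have u3 : (size u <= 3)%N by exact: aux suv v1.
    by rewrite (H u3) size_poly0 in u0.
  - have v3 : (size v <= 3)%N by rewrite addnC in suv; exact: aux suv u1.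
    by rewrite (H v3) size_poly0 in v0.
have [rs prs] := normS p pirr (ex_intro _ t pt0).
have srs : size rs = 3%N.
  by have := eqp_size prs; rewrite sp size_prod_XsubC => -[].
case: rs prs srs => [|x [|y [|z [|]]]] // prs _.
have := sepS p pirr (ex_intro _ t pt0).
rewrite (eqp_separable prs) separable_prod_XsubC /= !inE negb_or !andbT.
move=> /andP[/andP[xy xz] yz].
have [k pE] : exists k, p = k *: (\prod_(r <- [:: x; y; z]) ('X - r%:P)).
  have /eqpf_eq[k k0 ->] := prs; by exists k.
move: pE; rewrite !big_cons big_nil mulr1 vieta3 => pE.
have co i := congr1 (fun p : {poly L} => p`_i) pE.
have kl : l = k.
  by have := co 3%N; rewrite Ep !coefE /=; move=> ->; ring.
subst k.
have Eq : q = - l * (x + y + z).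
  by have := co 2%N; rewrite Ep !coefE /=; move=> ->; ring.
have Ec : c = l * (x * y + x * z + y * z).
  by have := co 1%N; rewrite Ep !coefE /=; move=> ->; ring.
have Eg : g = - l * (x * y * z).
  by have := co 0%N; rewrite Ep !coefE /=; move=> ->; ring.
pose e := (x - y) * (y - z) * (z - x).
have e0 : e != 0.
  by rewrite !mulf_neq0 // subr_eq0 // eq_sym.
have dE : disc3 l q c g = l ^+ 4 * e ^+ 2.
  by rewrite /disc3 /e Eq Ec Eg; ring.
have d0 : disc3 l q c g != 0 by rewrite dE mulf_neq0 // expf_neq0.
split=> //.
have dS : disc3 l q c g \in S.
  have nS k : (k%:R : L) \in S by exact: rpred_nat.
  by rewrite /disc3; do ?[done | exact: nS | apply: rpredB | apply: rpredD | apply: rpredM | apply: rpredX].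
apply: (@square_of_square_root _ (l ^+ 2 * e)) => //.
by rewrite dE; ring.
Qed.

End Discriminant.
End CubicExtension.

(** * The function field as a cubic extension *)

Section HomogComponents.
Variables (K : fieldType) (m : nat).
Implicit Types p q : {mpoly K[m]}.
Local Notation hc := (pihomog mdeg).

Lemma sum_pihomog p : exists k, p = \sum_(i < k) hc i p.
Proof. by exists (msize p); exact: pihomog_partitionE. Qed.

Lemma pihomog_sum d I (s : seq I) P (G : I -> {mpoly K[m]}) :
  hc d (\sum_(i <- s | P i) G i) = \sum_(i <- s | P i) hc d (G i).
Proof. exact: raddf_sum. Qed.

Lemma pihomog_homog d p e : p \is d.-homog -> hc e p = if e == d then p else 0.
Proof.
move=> hp; case: eqP => [->|/eqP ne]; first exact: pihomog_dE.
by rewrite (pihomog_ne0 _ hp) // eq_sym.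
Qed.

Lemma pihomogM d e p q : p \is e.-homog -> hc (d + e) (q * p) = hc d q * p.
Proof.
move=> hp; have [k E] := sum_pihomog q.
rewrite [in LHS]E mulr_suml pihomog_sum /= [in RHS]E pihomog_sum mulr_suml; apply: eq_bigr => i _ /=.
rewrite (@pihomog_homog (i + e)); last by apply: dhomogM => //; exact: pihomogP.
rewrite eqn_add2r (@pihomog_homog i _ d); last exact: pihomogP.
by case: ifP => //; rewrite mul0r.
Qed.

Lemma pihomogM_lt d e p q : p \is e.-homog -> (d < e)%N -> hc d (q * p) = 0.
Proof.
move=> hp de; have [k ->] := sum_pihomog q; rewrite mulr_suml pihomog_sum big1 // => i _ /=.
rewrite (@pihomog_homog (i + e)); last by apply: dhomogM => //; exact: pihomogP.
by rewrite (_ : _ == _ = false) //; apply/negP; lia.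
Qed.

Lemma pihomog_dvd d e p q : p \is e.-homog -> mpoly_dvd p (hc d (q * p)).
Proof.
move=> hp; have [de|ed] := ltnP d e.
  by exists 0; rewrite (pihomogM_lt _ hp de) mul0r.
by exists (hc (d - e) q); rewrite -{1}(subnK ed) pihomogM.
Qed.

End HomogComponents.

Lemma lin_subst_sum (K : fieldType) r m (M : 'M[K]_(r, m)) I (s : seq I) P
    (G : I -> {mpoly K[r]}) :
  lin_subst M (\sum_(i <- s | P i) G i) = \sum_(i <- s | P i) lin_subst M (G i).
Proof.
exact: (big_morph (lin_subst M) (rmorphD (lin_subst M)) (rmorph0 (lin_subst M))).
Qed.

Lemma pihomog_lin_subst (K : fieldType) r m (M : 'M[K]_(r, m)) d A :
  pihomog mdeg d (lin_subst M A) = lin_subst M (pihomog mdeg d A).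
Proof.
have [k E] := sum_pihomog A.
rewrite [in LHS]E lin_subst_sum pihomog_sum /= [in RHS]E.
rewrite pihomog_sum lin_subst_sum /=; apply: eq_bigr => i _ /=.
rewrite (@pihomog_homog _ _ i); last by apply: lin_subst_homog; exact: pihomogP.
rewrite (@pihomog_homog _ _ i _ d); last exact: pihomogP.
by case: ifP => //; rewrite rmorph0.
Qed.

Lemma eq_frac (F : fieldType) (a b q d : F) : b != 0 -> d != 0 ->
  d * a - q * b = 0 -> a / b = q / d.
Proof.
move=> b0 d0 /eqP; rewrite subr_eq0 => /eqP e.
by apply/eqP; rewrite eqr_div // mulrC e.
Qed.

HB.lock Definition evF (K : fieldType) (n d : nat) (X : hypersurface K n d)
    (c : 'rV[K]_n.+2) (M : 'M[K]_(n.+1, n.+2)) (q : {poly {mpoly K[n.+1]}}) :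
    {fraction coord_ring X} :=
  FracField.tofrac (coord_class X (unsub c M q)).

Section EvF.
Variables (K : fieldType) (n d : nat) (X : hypersurface K n d).
Variables (c : 'rV[K]_n.+2) (M : 'M[K]_(n.+1, n.+2)).
Local Notation evF := (evF X c M).

Lemma evFE q : evF q = FracField.tofrac (coord_class X (unsub c M q)).
Proof. by rewrite unlock. Qed.

Fact evF_is_additive : additive evF.
Proof.
by move=> p q; rewrite !evFE unsubB [coord_class X _]rmorphB tofracB.
Qed.

Fact evF_is_multiplicative : multiplicative evF.
Proof. by split=> [p q|]; rewrite !evFE ?rmorph1 // unsubM rmorphM tofracM. Qed.

HB.instance Definition _ :=
  GRing.isAdditive.Build {poly {mpoly K[n.+1]}} {fraction coord_ring X} evF
    evF_is_additive.
HB.instance Definition _ :=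
  GRing.isMultiplicative.Build {poly {mpoly K[n.+1]}} {fraction coord_ring X}
    evF evF_is_multiplicative.

Lemma evFD : {morph evF : p q / p + q}. Proof. exact: rmorphD. Qed.
Lemma evFB : {morph evF : p q / p - q}. Proof. exact: rmorphB. Qed.
Lemma evFM : {morph evF : p q / p * q}. Proof. exact: rmorphM. Qed.
Lemma evFXn k : {morph evF : p / p ^+ k}. Proof. exact: rmorphXn. Qed.
Lemma evF0 : evF 0 = 0. Proof. exact: rmorph0. Qed.
Lemma evF1 : evF 1 = 1. Proof. exact: rmorph1. Qed.

End EvF.

Section FunctionField.
Variables (K : closedFieldType) (n : nat) (X : hypersurface K n 4).
Hypothesis charK : [pchar K] =i pred0.
Variables (v : 'cV[K]_n.+2) (c : 'rV[K]_n.+2) (M : 'M[K]_(n.+1, n.+2))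
  (N : 'M[K]_(n.+2, n.+1)).
Hypotheses (Mv : M *m v = 0) (cv : c *m v = 1%:M) (cN : c *m N = 0)
  (MN : M *m N = 1%:M) (vcNM : v *m c + N *m M = 1%:M).

Local Notation R := {mpoly K[n.+1]}.
Local Notation f := (sub v N (Defs.eqn X)).
Local Notation evF := (evF X c M).
Local Notation ff := (function_field X).
Local Notation fval := (@subfield_val _ (homog_frac X)).

Hypothesis f3 : f`_3 != 0.
Hypothesis f4 : f`_4 = 0.

Lemma unsubf : unsub c M f = X.
Proof. exact: unsubK. Qed.

Lemma unsub_sub A : unsub c M (sub v N A) = A.
Proof. exact: unsubK. Qed.

Lemma sub_unsub q : sub v N (unsub c M q) = q.
Proof. exact: subK. Qed.

Lemma f_bihomog : bihomog 4 f.
Proof. exact/sub_bihomog/eqn_homog. Qed.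

Lemma size_f : size f = 4%N.
Proof.
apply/eqP; rewrite eqn_leq; apply/andP; split; last first.
  by rewrite ltnNge; apply/negP => /leq_sizeP/(_ 3%N (leqnn _))/eqP; apply/negP.
apply/leq_sizeP => -[|[|[|[|[|j]]]]] // _.
by have /leq_sizeP := bihomog_size f_bihomog; apply.
Qed.

Lemma f_neq0 : f != 0.
Proof. by rewrite -size_poly_gt0 size_f. Qed.

Lemma hidealE q : (unsub c M q \in hideal X) <-> exists h, q = h * f.
Proof.
split=> [/hidealP[H e]|[h ->]].
  by exists (sub v N H); rewrite -[LHS]sub_unsub e subM.
by apply/hidealP; exists (unsub c M h); rewrite unsubM unsubf.
Qed.

Lemma evF_eq0 q : evF q = 0 <-> exists h, q = h * f.
Proof.
rewrite -hidealE evFE -coord_class_eq0; split=> [/eqP|/eqP ->].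
  by rewrite tofrac_eq0.
by rewrite rmorph0.
Qed.

Lemma f_prime p q h : p * q = h * f ->
  (exists h, p = h * f) \/ (exists h, q = h * f).
Proof.
move=> e; have : mpoly_dvd X (unsub c M p * unsub c M q).
  by exists (unsub c M h); rewrite -unsubM e unsubM unsubf.
by case/eqn_prime => /hidealP/hidealE; [left | right].
Qed.

(** A nonzero multiple of [f] has degree at least 3 in ['X]. This is the source of the linear
    independence of 1, t, t^2 over the subfield. *)
Lemma evF_small (q : {poly R}) : (size q <= 3)%N -> evF q = 0 -> q = 0.
Proof.
move=> sq /evF_eq0[h e]; apply/eqP; apply: contraLR sq => q0.
have h0 : h != 0 by apply: contraNneq q0 => h0; rewrite e h0 mul0r.
rewrite e size_mul ?f_neq0 // size_f addnS /= -ltnNge -[X in (X < _)%N]add0n.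
by rewrite ltn_add2r size_poly_gt0.
Qed.

Lemma evFC_eq0 A : (evF A%:P == 0) = (A == 0).
Proof.
apply/eqP/eqP => [|->]; last by rewrite evF0.
move/evF_small => H; apply/eqP; rewrite -polyC_eq0; apply/eqP/H.
by apply: leq_trans (size_polyC_leq1 _) _.
Qed.

Lemma coord_fracE A B : coord_frac X A B = evF (sub v N A) / evF (sub v N B).
Proof. by rewrite !evFE !unsub_sub. Qed.

Import Pdiv.Idomain.

(** Division over the domain [R] is only up to constants of [R], so primality of [f] does the work:
    if the gcd had positive degree, it would be a multiple of [f], and [f] would divide a nonzero
    constant times [b], hence [b]. Modulo [f], the cofactor [u] inverts [b] up to the denominator
    [r]. *)
Lemma bezout_f b : ~ (exists h, b = h * f) ->
  exists u w (r : R), r != 0 /\ u * b + w * f = r%:P.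
Proof.
move=> nb; have [[u w] /= uw] := Bezoutp b f.
have g0 : gcdp b f != 0 by rewrite gcdp_eq0 negb_and f_neq0 orbT.
have sg : size (gcdp b f) = 1%N.
  have := dvdp_gcdr b f; rewrite dvdp_eq; set k := _ ^+ _; set h := _ %/ _.
  have k0 : k != 0 by rewrite expf_neq0 // lead_coef_eq0.
  move/eqP => e.
  have [|[h' eg]|[h' eh]] := @f_prime h (gcdp b f) k%:P.
  - by rewrite -e mul_polyC.
  - have hn0 : h != 0.
      apply/eqP => h0; move/eqP: e; rewrite h0 mul0r -mul_polyC mulf_eq0.
      by rewrite polyC_eq0 (negPf k0) (negPf f_neq0).
    have h'0 : h' != 0 by apply: contraNneq hn0 => h'0; rewrite eg h'0 mul0r.
    have := congr1 (fun p : {poly R} => size p) e.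
    rewrite size_scale // [RHS]size_mul // eg size_mul ?f_neq0 // size_f.
    move: h'0 g0; rewrite -!size_poly_gt0; move: (size h') (size (gcdp b f)).
    by move=> x y; lia.
  - have := dvdp_gcdl b f; rewrite dvdp_eq; set k' := _ ^+ _; set l := _ %/ _.
    have k'0 : k' != 0 by rewrite expf_neq0 // lead_coef_eq0.
    move/eqP; rewrite eh mulrA -mul_polyC => /f_prime[[h2 E]|//].
    have : evF k'%:P = 0 by apply/evF_eq0; exists h2.
    by move/eqP; rewrite evFC_eq0 (negPf k'0).
have /eqpP[[c1 c2] /= /andP[c10 c20] E] := uw.
have /size_poly1P[r r0 er] : size (gcdp b f) == 1%N by rewrite sg.
exists (c1 *: u), (c1 *: w), (c2 * r); split; first by rewrite mulf_neq0.
by rewrite -!scalerAl -scalerDr E er -mul_polyC polyCM.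
Qed.

(* Clearing denominators in [A / B] and reducing modulo [f] gives a relation
   whose homogeneous component is again such a relation. *)
Lemma homog_span e A B : A \is e.-homog -> B \is e.-homog -> B \notin hideal X ->
  exists k (d a0 a1 a2 : R), [/\ d != 0, d \is k.+2.-homog &
    [/\ a0 \is k.+2.-homog, a1 \is k.+1.-homog, a2 \is k.-homog &
     coord_frac X A B = (evF a0%:P + evF a1%:P * evF 'X + evF a2%:P * evF 'X ^+ 2)
       / evF d%:P]].
Proof.
move=> hA hB nB; set a := sub v N A; set b := sub v N B.
have nb : ~ exists h, b = h * f.
  by move/hidealE; rewrite unsub_sub; apply/negP.
have [u [w [r [r0 er]]]] := bezout_f nb.
(* Modulo [f] the fraction a / b equals a u / r, and pseudo-division by [f] brings the numerator
   down to degree at most 2 in ['X]. *)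
pose k0 := lead_coef f ^+ scalp (a * u) f; pose q0 := (a * u) %% f.
have k00 : k0 != 0 by rewrite expf_neq0 // lead_coef_eq0 f_neq0.
(* This factor of degree 2 makes room for coefficients of degrees [k.+1] and [k] in front of ['X]
   and ['X ^+ 2]. *)
pose y : R := 'X_ord0 ^+ 2.
pose d := k0 * r * y; pose q := y *: q0.
have hy : y \is 2.-homog by rewrite -[2%N]mul1n dhomogMn // dhomogX /= mdeg1.
have y0 : y != 0.
  by rewrite expf_neq0 // -msize_poly_eq0 msizeX mdeg1.
have d0 : d != 0 by exact: mulf_neq0 (mulf_neq0 k00 r0) y0.
have sq : (size q <= 3)%N.
  apply: leq_trans (size_scale_leq _ _) _; rewrite -ltnS -size_f ltn_modp.
  exact: f_neq0.
have [H eH] : exists H, d%:P * a - q * b = H * f.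
  exists (y%:P * (k0 *: a * w + (a * u) %/ f * b)).
  have E := divp_eq (a * u) f; rewrite -/k0 -/q0 in E.
  have -> : q = y%:P * (k0 *: (a * u) - (a * u) %/ f * f).
    by rewrite E addrC addKr mul_polyC.
  by rewrite !polyCM -er -!mul_polyC; ring.
have eK : lin_subst M d * A - unsub c M q * B = unsub c M H * X.
  have := congr1 (unsub c M) eH.
  by rewrite unsubB !unsubM unsubC !unsub_sub.
(* The denominator need not be homogeneous; any degree in which it has a nonzero component will
   do. *)
have [k hk] : exists k, pihomog mdeg k (k0 * r) != 0.
  apply: contrapT => nk; have /eqP := mulf_neq0 k00 r0; apply.
  have [j ->] := sum_pihomog (k0 * r); rewrite big1 // => i _.
  by apply/eqP; apply: contrapT => /negP h; apply: nk; exists (i : nat).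
pose d' := pihomog mdeg k.+2 d.
have d'E : d' = pihomog mdeg k (k0 * r) * y by rewrite /d' -addn2 pihomogM.
pose a0 := pihomog mdeg k.+2 q`_0; pose a1 := pihomog mdeg k.+1 q`_1.
pose a2 := pihomog mdeg k q`_2.
pose q' := a0%:P + a1%:P * 'X + a2%:P * 'X ^+ 2.
have cX : lin c ^+ 2 \is 2.-homog.
  by rewrite -[2%N]mul1n; apply: dhomogMn; exact: lin_homog.
have unsub3 (p0 p1 p2 : R) : unsub c M (p0%:P + p1%:P * 'X + p2%:P * 'X ^+ 2) =
    lin_subst M p0 + lin_subst M p1 * lin c + lin_subst M p2 * lin c ^+ 2.
  rewrite 2!unsubD; congr (_ + _ + _).
  - exact: unsubC.
  - by rewrite unsubM unsubC unsubX.
  by rewrite unsubM unsubC; congr (_ * _); rewrite unsubXn unsubX.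
have uq : pihomog mdeg k.+2 (unsub c M q) = unsub c M q'.
  have qE : q = (q`_0)%:P + (q`_1)%:P * 'X + (q`_2)%:P * 'X ^+ 2.
    apply/polyP => i; rewrite !coefD !coefCM coefC coefX coefXn.
    case: i => [|[|[|i]]] /=; rewrite ?mulr0 ?mulr1 ?addr0 ?add0r //.
    by apply: nth_default; apply: leq_trans sq _.
  transitivity (pihomog mdeg k.+2 (lin_subst M q`_0 + lin_subst M q`_1 * lin c
      + lin_subst M q`_2 * lin c ^+ 2)); first by rewrite -unsub3 -qE.
  rewrite unsub3 2!pihomogD pihomog_lin_subst; congr (_ + _ + _).
    have := pihomogM k.+1 (lin_subst M q`_1) (lin_homog c).
    by rewrite addn1 pihomog_lin_subst.
  by have := pihomogM k (lin_subst M q`_2) cX; rewrite addn2 pihomog_lin_subst.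
have [H2 eH2] : mpoly_dvd X (lin_subst M d' * A - unsub c M q' * B).
  have := pihomog_dvd (k.+2 + e) (unsub c M H) (eqn_homog X).
  by rewrite -eK pihomogB !pihomogM // pihomog_lin_subst uq.
have e0 : evF (d'%:P * a - q' * b) = 0.
  apply/evF_eq0/hidealE/hidealP; exists H2; rewrite -eH2.
  by rewrite unsubB !unsubM unsubC !unsub_sub.
have d'0 : d' != 0 by rewrite d'E mulf_neq0.
exists k, d', a0, a1, a2; split=> //; first exact: pihomogP.
split; try exact: pihomogP.
have b0 : evF b != 0 by apply/negP => /eqP/evF_eq0.
have fd0 : evF d'%:P != 0 by rewrite evFC_eq0.
have qE : evF q' = evF a0%:P + evF a1%:P * evF 'X + evF a2%:P * evF 'X ^+ 2.
  rewrite 2!evFD; congr (_ + _ + _); first exact: evFM.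
  by rewrite evFM; congr (_ * _); exact: evFXn.
transitivity (evF q' / evF d'%:P); last by congr (_ / _); exact: qE.
apply: etrans (coord_fracE A B) _.
apply: eq_frac; [exact: b0|exact: fd0|].
by rewrite -[RHS]e0 evFB !evFM.
Qed.

End FunctionField.

Section SubfieldVal.
Variables (E : fieldType) (S : divringClosed E).
Local Notation sv := (@subfield_val E S).
Local Notation F := (subfield_type S).

Lemma sv1 : sv 1 = 1. Proof. exact: (rmorph1 (val : F -> E)). Qed.
Lemma svB : {morph sv : x y / x - y}.
Proof. exact: (rmorphB (val : F -> E)). Qed.
Lemma svD : {morph sv : x y / x + y}.
Proof. exact: (rmorphD (val : F -> E)). Qed.
Lemma svM : {morph sv : x y / x * y}.
Proof. exact: (rmorphM (val : F -> E)). Qed.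
Lemma svXn k : {morph sv : x / x ^+ k}.
Proof. exact: (rmorphXn (val : F -> E)). Qed.
Lemma sv_div : {morph sv : x y / x / y}.
Proof. exact: (fmorph_div (val : F -> E)). Qed.
Lemma svMn k : {morph sv : x / x *+ k}.
Proof. exact: (rmorphMn (val : F -> E)). Qed.
Lemma sv0 : sv 0 = 0. Proof. exact: (rmorph0 (val : F -> E)). Qed.
Lemma sv_quad a b c t : sv (a + b * t + c * t ^+ 2) =
  sv a + sv b * sv t + sv c * sv t ^+ 2.
Proof. by rewrite 2!svD 2!svM svXn. Qed.
Lemma sv_cubic l q c g t : sv (l * t ^+ 3 + q * t ^+ 2 + c * t + g) =
  sv l * sv t ^+ 3 + sv q * sv t ^+ 2 + sv c * sv t + sv g.
Proof. by rewrite 3!svD 3!svM 2!svXn. Qed.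
Lemma sv_disc3 l q c g : sv (disc3 l q c g) = disc3 (sv l) (sv q) (sv c) (sv g).
Proof. exact: (morph_disc3 (val : {rmorphism F -> E})). Qed.
Lemma sv_inj : injective sv. Proof. exact: val_inj. Qed.

End SubfieldVal.

Section Pullback.
Variables (K : fieldType) (n d : nat) (X : hypersurface K n d).
Variable M : 'M[K]_(n.+1, n.+2).
Local Notation ff := (function_field X).
Local Notation fval := (@subfield_val {fraction coord_ring X} (@homog_frac _ _ _ X)).

Fact pullback_field_divring : divring_closed (@pullback_field _ _ _ X M).
Proof.
split.
- apply/asboolP; exists 0%N, 1, 1; rewrite dhomog1 rmorph1 hideal1; split=> //.
  by rewrite sv1 /coord_frac divff // coord_frac_def // hideal1.
- move=> x y /asboolP[e [A [B [hA hB nB xE]]]].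
  move=> /asboolP[e' [A' [B' [hA' hB' nB' yE]]]].
  apply/asboolP; exists (e + e')%N, (A * B' - A' * B), (B * B').
  rewrite rmorphB !rmorphM hidealM // svB xE yE.
  rewrite coord_fracD // dhomogM // rpredB //; first exact: dhomogM.
  by rewrite addnC dhomogM.
- move=> x y /asboolP[e [A [B [hA hB nB xE]]]].
  move=> /asboolP[e' [A' [B' [hA' hB' nB' yE]]]].
  apply/asboolP.
  have [A'I | nA'] := boolP (lin_subst M A' \in hideal X).
    exists 0%N, 0, 1; rewrite rpred0 dhomog1 rmorph1 hideal1; split=> //.
    move: A'I; rewrite -coord_class_eq0 => /eqP A'0.
    rewrite sv_div yE; transitivity (0 : {fraction coord_ring X}).
      by rewrite /coord_frac A'0 tofrac0 mul0r invr0 mulr0.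
    rewrite /coord_frac (rmorph0 (lin_subst M)) (rmorph0 (coord_class X)).
    by rewrite tofrac0 mul0r.
  exists (e + e')%N, (A * B'), (B * A').
  rewrite !rmorphM hidealM // sv_div xE yE.
  by rewrite coord_fracV !dhomogM.
Qed.

HB.instance Definition _ := GRing.isDivringClosed.Build ff (@pullback_field _ _ _ X M)
  pullback_field_divring.

End Pullback.

Section FunctionField.
Variables (K : closedFieldType) (n : nat) (X : hypersurface K n 4).
Hypothesis charK : [pchar K] =i pred0.
Variables (v : 'cV[K]_n.+2) (c : 'rV[K]_n.+2) (M : 'M[K]_(n.+1, n.+2))
  (N : 'M[K]_(n.+2, n.+1)).
Hypotheses (Mv : M *m v = 0) (cv : c *m v = 1%:M) (cN : c *m N = 0)
  (MN : M *m N = 1%:M) (vcNM : v *m c + N *m M = 1%:M).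

Local Notation R := {mpoly K[n.+1]}.
Local Notation f := (sub v N (Defs.eqn X)).
Local Notation evF := (evF X c M).
Local Notation ff := (function_field X).
Local Notation fval := (@subfield_val {fraction coord_ring X} (@homog_frac _ _ _ X)).
Local Notation k := (@pullback_field _ _ _ X M).

Hypothesis f3 : f`_3 != 0.
Hypothesis f4 : f`_4 = 0.

Let ev_small (q : {poly R}) : (size q <= 3)%N -> evF q = 0 -> q = 0.
Proof. exact: (evF_small charK Mv cv cN MN vcNM f3 f4). Qed.

Let evC_eq0 A : (evF A%:P == 0) = (A == 0).
Proof. exact: (evFC_eq0 charK Mv cv cN MN vcNM f3 f4). Qed.

Lemma cf_evF A B :
  coord_frac X (lin_subst M A) (lin_subst M B) = evF A%:P / evF B%:P.
Proof. by rewrite !evFE !unsubC. Qed.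

Lemma pullback_elt e A B : A \is e.-homog -> B \is e.-homog -> B != 0 ->
  exists2 x : ff, x \in k & fval x = evF A%:P / evF B%:P.
Proof.
move=> hA hB B0; have nB : lin_subst M B \notin hideal X.
  rewrite -coord_class_eq0 -tofrac_eq0.
  by have := evC_eq0 B; rewrite evFE unsubC (negPf B0) => ->.
have xP : evF A%:P / evF B%:P \in (@homog_frac _ _ _ X).
  rewrite -cf_evF; apply/asboolP; exists e, (lin_subst M A), (lin_subst M B).
  by split=> //; exact: lin_subst_homog.
exists (SubfieldType (S := @homog_frac _ _ _ X) xP) => //.
by apply/asboolP; exists e, A, B; split=> //; rewrite cf_evF.
Qed.

Lemma pullback_eltP x : x \in k -> exists A B : R, exists e,
  [/\ A \is e.-homog, B \is e.-homog, B != 0 & fval x = evF A%:P / evF B%:P].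
Proof.
case/asboolP => e [A [B [hA hB nB xE]]]; exists A, B, e; split=> //.
  by apply: contraNneq nB => ->; rewrite rmorph0 -coord_class_eq0 raddf0.
by rewrite -cf_evF.
Qed.

(** A coordinate whose powers serve as denominators, to turn forms into elements of degree 0. *)
Definition y0 : R := 'X_ord0.

Lemma y0_homog e : y0 ^+ e \is e.-homog.
Proof.
by rewrite -[X in X.-homog]mul1n; apply: dhomogMn; rewrite dhomogX /= mdeg1.
Qed.

Lemma y0_neq0 e : y0 ^+ e != 0.
Proof. by rewrite expf_neq0 // -msize_poly_eq0 msizeX mdeg1. Qed.

Lemma gen_exists : exists t : ff, fval t = evF 'X / evF y0%:P.
Proof.
have xP : evF 'X / evF y0%:P \in (@homog_frac _ _ _ X).
  apply/asboolP; exists 1%N, (lin c), (lin_subst M y0); split.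
  - exact: lin_homog.
  - by apply: lin_subst_homog; rewrite -[y0]expr1; exact: y0_homog.
  - rewrite -coord_class_eq0 -tofrac_eq0.
    have := evC_eq0 y0; rewrite evFE unsubC -[y0 == 0]negbK => ->.
    by rewrite negbK -[y0]expr1 y0_neq0.
  by rewrite !evFE unsubC unsubX.
by exists (SubfieldType (S := @homog_frac _ _ _ X) xP).
Qed.

Variable t : ff.
Hypothesis tE : fval t = evF 'X / evF y0%:P.

Let fy0 : evF y0%:P != 0.
Proof. by rewrite evC_eq0 -[y0]expr1 y0_neq0. Qed.

Lemma evFC_M A B : evF (A * B)%:P = evF A%:P * evF B%:P.
Proof. by rewrite polyCM evFM. Qed.

Lemma evFC_Xn A e : evF (A ^+ e)%:P = evF A%:P ^+ e.
Proof. by rewrite polyC_exp evFXn. Qed.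

Lemma frac_basis (F : fieldType) (a0 a1 a2 d x y : F) : d != 0 -> y != 0 ->
  (a0 + a1 * x + a2 * x ^+ 2) / d =
  a0 / d + a1 * y / d * (x / y) + a2 * y ^+ 2 / d * (x / y) ^+ 2.
Proof. by move=> d0 y0; field; rewrite d0 y0. Qed.

Lemma span_pullback (z : ff) : exists a b c', [/\ a \in k, b \in k, c' \in k
  & z = a + b * t + c' * t ^+ 2].
Proof.
case: z => z zP; have /asboolP[e [A [B [hA hB nB zE]]]] := zP.
have [j [d [a0 [a1 [a2 [d0 hd [h0 h1 h2 E]]]]]]] :=
  homog_span charK Mv cv cN MN vcNM f3 f4 hA hB nB.
have [a ak aE] := pullback_elt h0 hd d0.
have h1' : a1 * y0 \is j.+2.-homog.
  by rewrite -[j.+2]addn1 -[y0]expr1; apply: dhomogM => //; exact: y0_homog.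
have h2' : a2 * y0 ^+ 2 \is j.+2.-homog.
  by rewrite -[j.+2]addn2; apply: dhomogM => //; exact: y0_homog.
have [b bk bE] := pullback_elt h1' hd d0.
have [c' ck cE] := pullback_elt h2' hd d0.
exists a, b, c'; split=> //; apply: sv_inj.
rewrite [RHS]sv_quad tE aE bE cE [LHS]zE E evFC_M (evFC_M a2) evFC_Xn.
by apply: frac_basis; [rewrite evC_eq0 | exact: fy0].
Qed.

Lemma frac_relation (F : fieldType) (a0 b0 a1 b1 a2 b2 x y : F) :
  b0 != 0 -> b1 != 0 -> b2 != 0 -> y != 0 ->
  a0 / b0 + a1 / b1 * (x / y) + a2 / b2 * (x / y) ^+ 2 = 0 ->
  a0 * b1 * b2 * y ^+ 2 + a1 * b0 * b2 * y * x + a2 * b0 * b1 * x ^+ 2 = 0.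
Proof.
move=> b00 b10 b20 y0 e.
transitivity ((a0 / b0 + a1 / b1 * (x / y) + a2 / b2 * (x / y) ^+ 2) *
    (b0 * b1 * b2 * y ^+ 2)); last by rewrite e mul0r.
by field; rewrite b00 b10 b20 y0.
Qed.

Lemma indep_pullback (a b c' : ff) : a \in k -> b \in k -> c' \in k ->
  a + b * t + c' * t ^+ 2 = 0 -> [/\ a = 0, b = 0 & c' = 0].
Proof.
move=> /pullback_eltP[A0 [B0 [e0 [_ _ B00 aE]]]].
move=> /pullback_eltP[A1 [B1 [e1 [_ _ B10 bE]]]].
move=> /pullback_eltP[A2 [B2 [e2 [_ _ B20 cE]]]] e.
have fB0 : evF B0%:P != 0 by rewrite evC_eq0.
have fB1 : evF B1%:P != 0 by rewrite evC_eq0.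
have fB2 : evF B2%:P != 0 by rewrite evC_eq0.
have := congr1 fval e; rewrite sv_quad tE aE bE cE sv0.
move/(frac_relation fB0 fB1 fB2 fy0); rewrite -evFC_Xn -!evFC_M => e'.
pose q : {poly R} := (A0 * B1 * B2 * y0 ^+ 2)%:P + (A1 * B0 * B2 * y0)%:P * 'X
  + (A2 * B0 * B1)%:P * 'X ^+ 2.
have qE i : q`_i = nth 0 [:: A0 * B1 * B2 * y0 ^+ 2; A1 * B0 * B2 * y0; A2 * B0 * B1] i.
  rewrite !coefD !coefCM coefC coefX coefXn.
  by case: i => [|[|[|i]]] /=; rewrite ?mulr0 ?mulr1 ?addr0 ?add0r ?nth_nil.
have sq : (size q <= 3)%N.
  by apply/leq_sizeP => i i3; rewrite qE nth_default.
have q0 : q = 0.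
  apply: ev_small sq _; rewrite -[RHS]e' 2!evFD; congr (_ + _ + _).
    exact: evFM.
  by rewrite evFM; congr (_ * _); exact: evFXn.
have H i := congr1 (fun p : {poly R} => p`_i) q0.
have zero (x : ff) A B : fval x = evF A%:P / evF B%:P -> A = 0 -> x = 0.
  by move=> xE A0'; apply: sv_inj; rewrite xE A0' evF0 mul0r sv0.
split.
- apply: zero aE _; have := H 0%N; rewrite qE coef0 /= => /eqP.
  by rewrite mulf_eq0 (negPf (y0_neq0 2)) orbF !mulf_eq0 (negPf B10) (negPf B20) !orbF => /eqP.
- apply: zero bE _; have := H 1%N; rewrite qE coef0 /= => /eqP.
  rewrite mulf_eq0 -[y0]expr1 (negPf (y0_neq0 1)) orbF !mulf_eq0 (negPf B00).
  by rewrite (negPf B20) !orbF => /eqP.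
- apply: zero cE _; have := H 2%N; rewrite qE coef0 /= => /eqP.
  by rewrite !mulf_eq0 (negPf B00) (negPf B10) !orbF => /eqP.
Qed.

Lemma evF_disc3 (l q c' g : R) : evF (disc3 l q c' g)%:P =
  disc3 (evF l%:P) (evF q%:P) (evF c'%:P) (evF g%:P).
Proof. exact: (morph_disc3 (evF \o polyC)). Qed.

Lemma evF_f : evF (f`_3)%:P * evF 'X ^+ 3 + evF (f`_2)%:P * evF 'X ^+ 2
  + evF (f`_1)%:P * evF 'X + evF (f`_0)%:P = 0.
Proof.
have fE : f = (f`_3)%:P * 'X ^+ 3 + (f`_2)%:P * 'X ^+ 2 + (f`_1)%:P * 'X
    + (f`_0)%:P.
  apply/polyP => i; rewrite !coefD !coefCM coefC coefX !coefXn.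
  case: i => [|[|[|[|i]]]] /=; rewrite ?mulr0 ?mulr1 ?addr0 ?add0r //.
  by apply: nth_default; rewrite (size_f f3 f4).
have : evF f = 0.
  by apply/(evF_eq0 X charK Mv cv cN MN vcNM); exists 1; rewrite mul1r.
move=> <-; rewrite [in RHS]fE 3!evFD; congr (_ + _ + _ + _).
- by rewrite evFM; congr (_ * _); rewrite evFXn.
- by rewrite evFM; congr (_ * _); rewrite evFXn.
- by rewrite evFM.
Qed.

Lemma coef_homog i : (i <= 4)%N -> f`_i \is (4 - i).-homog.
Proof. by move=> i4; have := sub_bihomog v N (eqn_homog X) i; rewrite i4. Qed.

Lemma scaled_relation (F : fieldType) (l q c' g x y : F) : y != 0 ->
  l * x ^+ 3 + q * x ^+ 2 + c' * x + g = 0 ->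
  l / y * (x / y) ^+ 3 + q / y ^+ 2 * (x / y) ^+ 2 + c' / y ^+ 3 * (x / y)
  + g / y ^+ 4 = 0.
Proof.
move=> y0 e; transitivity ((l * x ^+ 3 + q * x ^+ 2 + c' * x + g) / y ^+ 4).
  by field.
by rewrite e mul0r.
Qed.

Lemma square_cross (F : fieldType) (D a b y : F) : b != 0 -> y != 0 ->
  (a / b) ^+ 2 = D / y ^+ 10 -> D * b ^+ 2 = (a * y ^+ 5) ^+ 2.
Proof.
move=> b0 y0 e; transitivity (D / y ^+ 10 * (b ^+ 2 * y ^+ 10)); first by field.
by rewrite -e; field.
Qed.

(** The discriminant is isobaric of weight 10 when its arguments have weights 1, 2, 3, 4. *)
Lemma scaled_disc (F : fieldType) (l q c' g y : F) : y != 0 ->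
  disc3 (l / y) (q / y ^+ 2) (c' / y ^+ 3) (g / y ^+ 4) =
  disc3 l q c' g / y ^+ 10.
Proof. by move=> y0; rewrite /disc3; field. Qed.

Let cubic_coefs : exists l q c' g : ff,
  [/\ [/\ l \in k, q \in k, c' \in k & g \in k],
     l != 0, l * t ^+ 3 + q * t ^+ 2 + c' * t + g = 0 &
     [/\ fval l = evF (f`_3)%:P / evF y0%:P,
        fval q = evF (f`_2)%:P / evF y0%:P ^+ 2,
        fval c' = evF (f`_1)%:P / evF y0%:P ^+ 3 &
        fval g = evF (f`_0)%:P / evF y0%:P ^+ 4]].
Proof.
have [l lk lE] := pullback_elt (coef_homog (isT : 3 <= 4)%N) (y0_homog 1) (y0_neq0 1).
have [q qk qE] := pullback_elt (coef_homog (isT : 2 <= 4)%N) (y0_homog 2) (y0_neq0 2).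
have [c' ck cE] := pullback_elt (coef_homog (isT : 1 <= 4)%N) (y0_homog 3) (y0_neq0 3).
have [g gk gE] := pullback_elt (coef_homog (isT : 0 <= 4)%N) (y0_homog 4) (y0_neq0 4).
rewrite !evFC_Xn expr1 in lE qE cE gE.
exists l, q, c', g; split; [by split | | | by split].
  apply/eqP => l0; move/eqP: lE; rewrite l0 sv0 eq_sym mulf_eq0 invr_eq0.
  by rewrite (negPf fy0) evC_eq0 (negPf f3).
apply: sv_inj; rewrite [LHS]sv_cubic tE lE qE cE gE sv0.
by apply: scaled_relation; [exact: fy0 | exact: evF_f].
Qed.

Lemma galois_disc_fraction : galois_ext k ->
  disc3 f`_3 f`_2 f`_1 f`_0 != 0 /\
  exists A B : R, B != 0 /\ disc3 f`_3 f`_2 f`_1 f`_0 * B ^+ 2 = A ^+ 2.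
Proof.
move=> gal; have [l [q [c' [g [[lk qk ck gk] l0 rel [lE qE cE gE]]]]]] := cubic_coefs.
have [d0 [e ek eE]] := galois_disc_square span_pullback indep_pullback lk qk ck gk
  l0 rel gal.
have dE : fval (disc3 l q c' g) =
    evF (disc3 f`_3 f`_2 f`_1 f`_0)%:P / evF y0%:P ^+ 10.
  apply: etrans (sv_disc3 _ _ _ _) _.
  by rewrite lE qE cE gE (scaled_disc _ _ _ _ fy0) evF_disc3.
split.
  apply: contraNneq d0 => D0; apply/eqP/sv_inj.
  by rewrite dE D0 evF0 mul0r sv0.
have [A [B [m [_ _ B0 ABE]]]] := pullback_eltP ek.
exists (A * y0 ^+ 5), B; split=> //.
have fB : evF B%:P != 0 by rewrite evC_eq0.
have := congr1 fval eE; rewrite svXn ABE dE => E.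
apply/eqP; rewrite -subr_eq0 -evC_eq0 polyCB evFB subr_eq0; apply/eqP.
rewrite evFC_M 2!evFC_Xn evFC_M evFC_Xn.
exact: square_cross fB fy0 E.
Qed.

Lemma pchar_ff : [pchar ff] =i pred0.
Proof.
apply/pcharf0P => j; apply/eqP/eqP => [|->//] /(congr1 fval).
rewrite svMn sv1 sv0 => e.
have : evF ((j%:R : R)%:P) = 0 by rewrite -[RHS]e; exact: (rmorph_nat (evF \o polyC)).
move/eqP; rewrite evC_eq0 => /eqP /(congr1 (mcoeff 0%MM)).
rewrite mcoeff0 -mpolyC_nat mcoeffC eqxx mulr1 => /eqP.
by rewrite natf_eq0 // => /eqP.
Qed.

Lemma kummer_galois_pullback : f`_2 = 0 -> f`_1 = 0 -> galois_ext k.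
Proof.
move=> f20 f10; have [l [q [c' [g [[lk qk ck gk] l0 rel [lE qE cE gE]]]]]] := cubic_coefs.
have q0 : q = 0 by apply: sv_inj; rewrite qE f20 evF0 mul0r sv0.
have c0 : c' = 0 by apply: sv_inj; rewrite cE f10 evF0 mul0r sv0.
have [w /eqP we] : exists w : K, root ('X^2 + 'X + 1) w.
  apply: closed_rootP; rewrite (_ : size _ = 3%N) //.
  by rewrite -addrA size_polyDl ?size_polyXn // size_XaddC.
have [w' _ wE] := @pullback_elt 0 w%:MP 1 (mpolyC_homog _ _) (dhomog1 _ _) (oner_neq0 _).
have t3 : t ^+ 3 \in k.
  have -> : t ^+ 3 = - g / l.
    apply: (mulfI l0); rewrite [RHS]mulrC divfK //; apply/eqP.
    by rewrite -addr_eq0 -rel q0 c0 !mul0r !addr0.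
  by rewrite rpred_div // rpredN.
have w1 : w' ^+ 2 + w' + 1 = 0; last first.
  exact: (kummer_galois span_pullback pchar_ff w1 t3).
apply: sv_inj; rewrite 2!svD svXn wE sv1 sv0 evF1 divr1.
move: we; rewrite !hornerE => we.
have -> : evF w%:MP%:P ^+ 2 + evF w%:MP%:P + 1 = evF ((w ^+ 2 + w + 1)%:MP)%:P.
  by rewrite !expr2 2!mpolyCD mpolyCM mpolyC1 2!polyCD polyCM polyC1 2!evFD evFM evF1.
by rewrite we mpolyC0 evF0.
Qed.

End FunctionField.

(** * Linear subspaces avoiding a closed set *)

Import Order.TTheory.
Local Open Scope classical_set_scope.

(** * Dickson's lemma *)

Section Dickson.

(** Each index is chosen to minimise [g] over the tail that is left. *)
Lemma nondecreasing_subseq (g : nat -> nat) : exists phi : nat -> nat,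
  (forall i j, (i < j)%N -> (phi i < phi j)%N) /\
  (forall i j, (i <= j)%N -> (g (phi i) <= g (phi j))%N).
Proof.
have amin N : exists k, (N <= k)%N /\ forall l, (N <= l)%N -> (g k <= g l)%N.
  have ex : exists v, `[< exists2 k, (N <= k)%N & g k = v >].
    by exists (g N); apply/asboolP; exists N.
  case: (ex_minnP ex) => v /asboolP[k Nk <-] mn; exists k; split=> // l Nl.
  by apply: mn; apply/asboolP; exists l.
have [am Ham] := choice amin.
pose phi := fix phi i := if i is i'.+1 then am (phi i').+1 else am 0%N.
exists phi; split.
  move=> i; elim=> // j IH; rewrite ltnS leq_eqVlt => /orP[/eqP->|/IH lt].
    by case: (Ham (phi j).+1).
  by apply: ltn_trans lt _; case: (Ham (phi j).+1).
move=> i; elim=> [|j IH]; first by rewrite leqn0 => /eqP ->.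
rewrite leq_eqVlt => /orP[/eqP->//|]; rewrite ltnS => /IH /leq_trans; apply.
case: j {IH} => [|i'] /=.
  have [_ H] := Ham 0%N; exact: H.
have [L H] := Ham (phi i').+1; apply: H; have [L' _] := Ham (am (phi i').+1).+1.
by apply: leq_trans L'; apply: leq_trans L _; apply: leqnSn.
Qed.

Lemma dickson r (f : nat -> 'X_{1..r}) : exists i j, (i < j)%N /\ (f i <= f j)%MM.
Proof.
have H (s : seq 'I_r) : exists phi : nat -> nat,
    (forall i j, (i < j)%N -> (phi i < phi j)%N) /\
    (forall c, c \in s -> forall i j, (i <= j)%N -> (f (phi i) c <= f (phi j) c)%N).
  elim: s => [|c s [phi [inc mono]]]; first by exists id.
  have [psi [inc' mono']] := nondecreasing_subseq (fun i => f (phi i) c).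
  exists (phi \o psi); split=> [i j ij|c']; first by apply/inc/inc'.
  rewrite inE => /orP[/eqP -> //|c's] i j ij /=; apply: mono => //.
  by move: ij; rewrite leq_eqVlt => /orP[/eqP ->//|/inc'/ltnW].
have [phi [inc mono]] := H (enum 'I_r).
exists (phi 0%N), (phi 1%N); split; first exact: inc.
by apply/mnm_lepP => c; apply: mono => //; rewrite mem_enum.
Qed.

End Dickson.

(** * Closed sets: descending chains, components and hyperplane sections *)

Section Closed.
Variables (K : fieldType) (m : nat).
Local Notation V := 'cV[K]_m.+1.
Local Notation pt := (Defs.point K m).
Implicit Types (Z A B Y : set pt) (P Q : pt) (G H : {mpoly K[m.+1]}).

Lemma line_vpick P : vpick (line P) != 0 /\ line P = <[vpick (line P)]>%VS.
Proof.
have P0 : line P != 0%VS.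
  by apply: contraTneq (line_dim P) => ->; rewrite dimv0.
split; first by rewrite vpick0.
apply/eqP; rewrite eq_sym eqEdim -memvE memv_pick dim_vline (eqP (line_dim P)).
by rewrite vpick0 P0.
Qed.

Lemma point_gen P : exists2 v : V, v != 0 & line P = <[v]>%VS.
Proof. by have [v0 e] := line_vpick P; exists (vpick (line P)). Qed.

Lemma vanishes_gen G P v d : G \is d.-homog -> line P = <[v]>%VS ->
  vanishes_at G P <-> ev v G = 0.
Proof.
move=> hG E; split=> [|e x]; first by apply; rewrite E memv_line.
by rewrite E => /vlineP[a ->]; rewrite (ev_homogZ _ _ hG) e mulr0.
Qed.

Definition vset Z G : Prop := forall P, Z P -> vanishes_at G P.

Lemma vsetB Z G H : vset Z G -> vset Z H -> vset Z (G - H).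
Proof.
by move=> g h P ZP v vP; rewrite rmorphB /= (g P ZP v vP) (h P ZP v vP) subr0.
Qed.

Lemma vsetM Z G H : vset Z G -> vset Z (H * G).
Proof. by move=> g P ZP v vP; rewrite rmorphM /= (g P ZP v vP) mulr0. Qed.

Lemma zariski_vset Z P : zariski_closed Z -> (forall G, vset Z G -> vanishes_at G P) -> Z P.
Proof.
move=> [S [_ ZE]] H; rewrite ZE => G SG; apply: H => Q.
by rewrite ZE => /(_ _ SG).
Qed.

Lemma closed_setI A B : zariski_closed A -> zariski_closed B ->
  zariski_closed (A `&` B).
Proof.
move=> [S [hS ->]] [T [hT ->]]; exists (S `|` T); split.
  by move=> G [/hS|/hT].
rewrite predeqE => P; split=> [[a b] G [/a|/b] //|H].
by split=> G SG; apply: H; [left|right].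
Qed.

Lemma minimal_lead (T : set {mpoly K[m.+1]}) G : T G ->
  exists2 G, T G & forall H, T H -> ~~ (mlead H < mlead G)%O.
Proof.
move: G; suff W mu : forall G, mlead G = mu -> T G ->
    exists2 G, T G & forall H, T H -> ~~ (mlead H < mlead G)%O.
  by move=> G; exact: W.
elim/(well_founded_ind (@ltom_wf m.+1)): mu => mu IH G Gmu TG.
have [[H [TH lt]]|nH] := pselect (exists H, T H /\ (mlead H < mlead G)%O).
  by apply: (IH (mlead H)) TH; rewrite -?Gmu.
exists G => // H TH; apply/negP => lt; apply: nH; by exists H.
Qed.

(** A basis argument with leading monomials. Among the polynomials vanishing on [Zs i.+1] but not on
    [Zs i], let [g i] have minimal leading monomial. By Dickson's lemma that of some [g i] divides
    that of a later [g j]. Subtracting from [g j] a multiple of [g i], which vanishes on [Zs j],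
    cancels the leading term and contradicts the minimality of [g j]. *)
Lemma closed_dcc (Zs : nat -> set pt) : (forall i, zariski_closed (Zs i)) ->
  (forall i, Zs i.+1 `<` Zs i) -> False.
Proof.
move=> cl dec.
have desc i j : (i <= j)%N -> Zs j `<=` Zs i.
  move=> ij; rewrite -(subnKC ij); elim: (j - i)%N => [|k IH]; first by rewrite addn0.
  by rewrite addnS; apply: subset_trans IH; case: (dec (i + k)%N).
pose T i := [set G | vset (Zs i.+1) G /\ ~ vset (Zs i) G].
have nT i : exists G, T i G.
  have [_ ns] := dec i; apply: contrapT => nG; apply: ns => P ZP.
  apply: (zariski_vset (cl i.+1)) => G vG; apply: contrapT => nv.
  by apply: nG; exists G; split=> // /(_ _ ZP).
have mT i : exists G, T i G /\ forall H, T i H -> ~~ (mlead H < mlead G)%O.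
  by have [G /minimal_lead[H TH mH]] := nT i; exists H.
have [g Hg] := choice mT.
have [i [j [ij le]]] := dickson (fun i => mlead (g i)).
have [[Tj nTj] mj] := Hg j; have [[Ti nTi] _] := Hg i.
have vij : vset (Zs j) (g i) by move=> P ZP; apply: Ti; exact: desc ij _ ZP.
have gi0 : g i != 0.
  by apply/eqP => gi0; apply: nTi => P _ v _; rewrite gi0 rmorph0.
have gj0 : g j != 0.
  by apply/eqP => gj0; apply: nTj => P _ v _; rewrite gj0 rmorph0.
have ci0 : mleadc (g i) != 0 by rewrite mleadc_eq0.
pose q := (mleadc (g j) / mleadc (g i)) *: 'X_[mlead (g j) - mlead (g i)].
have q0 : mleadc (g j) / mleadc (g i) != 0.
  by rewrite mulf_neq0 ?invr_eq0 ?mleadc_eq0.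
have qn0 : q != 0.
  by rewrite scaler_eq0 negb_or q0 -msize_poly_eq0 msizeX.
pose h := g j - q * g i.
have leadq : mlead (q * g i) = mlead (g j).
  by rewrite mleadM // mleadZ // mleadXm submK.
have Th : T j h.
  split.
    apply: vsetB => //; apply: vsetM => P ZP; apply: vij.
    by case: (dec j) => H _; exact: H.
  move=> vh; apply: nTj; rewrite (_ : g j = h - (- q) * g i).
    by apply: vsetB => //; exact: vsetM.
  by rewrite mulNr opprK subrK.
have h0 : h != 0.
  by apply/eqP => h0; case: Th => _; apply; rewrite h0 => P _ v _; rewrite rmorph0.
case/negP: (mj _ Th); rewrite lt_neqAle; apply/andP; split; last first.
  by apply: le_trans (mleadB_le _ _) _; rewrite leadq joinxx.
apply/negP => /eqP e; have := mleadc_eq0 h; rewrite (negPf h0) e.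
have lq : mlead q = (mlead (g j) - mlead (g i))%MM by rewrite mleadZ // mleadXm.
rewrite /h mcoeffB -{2}leadq mleadM // mleadcM lq {1}/q mcoeffZ mcoeffX eqxx.
by rewrite mulr1 divfK // subrr eqxx.
Qed.

(* The points [zs] meet every irreducible component of [Z], without the
   decomposition into components being constructed: a hyperplane avoiding [zs]
   lowers the dimension of [Z]. *)
Definition catches Z (zs : seq pt) : Prop :=
  (forall z, z \in zs -> Z z) /\
  forall Y, irreducible_closed Y -> Y `<=` Z -> exists Y',
    [/\ irreducible_closed Y', Y `<=` Y', Y' `<=` Z & exists2 z, z \in zs & Y' z].

Lemma catches_setU Z A B zsA zsB : zariski_closed A -> zariski_closed B ->
  A `<=` Z -> B `<=` Z -> Z `<=` A `|` B ->
  catches A zsA -> catches B zsB -> catches Z (zsA ++ zsB).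
Proof.
move=> cA cB AZ BZ ZAB [inA hA] [inB hB]; split.
  by move=> z; rewrite mem_cat => /orP[/inA/AZ|/inB/BZ].
move=> Y irY YZ; have [_ _ irr] := irY.
have [YA|YB] := irr A B cA cB (subset_trans YZ ZAB).
  have [Y' [irY' YY' Y'A [z zz Y'z]]] := hA Y irY YA.
  exists Y'; split=> //; first exact: subset_trans AZ.
  by exists z => //; rewrite mem_cat zz.
have [Y' [irY' YY' Y'B [z zz Y'z]]] := hB Y irY YB.
exists Y'; split=> //; first exact: subset_trans BZ.
by exists z => //; rewrite mem_cat zz orbT.
Qed.

(** Noetherian induction: one point catches an irreducible set, and if a reducible set cannot be
    caught, neither can one of its two proper closed pieces, which gives an infinite descent. *)
Lemma catchesP Z : zariski_closed Z -> exists zs, catches Z zs.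
Proof.
move=> cZ; apply: contrapT => nZ.
pose bad Z := zariski_closed Z /\ ~ exists zs, catches Z zs.
have step (W : {Z | bad Z}) : exists W' : {Z | bad Z}, sval W' `<` sval W.
  case: W => W [cW nW] /=.
  have [P WP] : W !=set0.
    apply: contrapT => /nonemptyPn W0; apply: nW; exists [::]; split=> // Y.
    by move=> [_ [Q YQ] _] /(_ _ YQ); rewrite W0.
  have nirr : ~ irreducible_closed W.
    move=> irW; apply: nW; exists [:: P]; split=> [z|Y irY YW].
      by rewrite inE => /eqP ->.
    by exists W; split=> //; exists P => //; rewrite inE.
  have [A [B [cA cB WAB nWA nWB]]] : exists A B, [/\ zariski_closed A,
      zariski_closed B, W `<=` A `|` B, ~ W `<=` A & ~ W `<=` B].
    apply: contrapT => nAB; apply: nirr; split=> //; first by exists P.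
    move=> A B cA cB WAB; apply: contrapT => /not_orP[nA nB].
    by apply: nAB; exists A, B.
  have cWA := closed_setI cW cA; have cWB := closed_setI cW cB.
  have [gA|nA] := pselect (exists zs, catches (W `&` A) zs); last first.
    exists (exist _ (W `&` A) (conj cWA nA)) => /=; split; first exact: subIsetl.
    by move=> WWA; apply: nWA => x /WWA [].
  have [gB|nB] := pselect (exists zs, catches (W `&` B) zs); last first.
    exists (exist _ (W `&` B) (conj cWB nB)) => /=; split; first exact: subIsetl.
    by move=> WWB; apply: nWB => x /WWB [].
  case: nW; case: gA => zsA hA; case: gB => zsB hB; exists (zsA ++ zsB).
  apply: (catches_setU cWA cWB _ _ _ hA hB); try exact: subIsetl.
  by move=> x Wx; have [Ax|Bx] := WAB x Wx; [left|right].
have [next Hnext] := choice step.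
pose W0 : {Z | bad Z} := exist _ Z (conj cZ nZ).
apply: (@closed_dcc (fun i => sval (iter i next W0))) => i.
  by case: (iter i next W0) => W [].
exact: Hnext.
Qed.

Definition hyperplane (r : 'rV[K]_m.+1) : set pt :=
  [set P | forall x, x \in line P -> lf r x = 0].

Lemma hyperplane_closed r : zariski_closed (hyperplane r).
Proof.
exists [set lin r]; split; first by move=> G ->; exists 1%N; exact: lin_homog.
rewrite predeqE => P; split=> [H G -> v /H|H x xP]; first by rewrite ev_lin.
by have := H _ erefl x xP; rewrite ev_lin.
Qed.

Lemma separating_form (U : {vspace V}) w : w \notin U ->
  exists r, (forall x, x \in U -> lf r x = 0) /\ lf r w != 0.
Proof.
move=> wU; pose g (x : V) := x - projv U x.
have gw : g w != 0.
  by apply: contraNneq wU => /eqP; rewrite subr_eq0 => /eqP ->; exact: memv_proj.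
have [i gi] : exists i, g w i 0 != 0.
  apply: contrapT => H; case/eqP: gw; apply/colP => i; rewrite [RHS]mxE.
  by apply/eqP; apply: contrapT => /negP h; apply: H; exists i.
have glin x : g x i 0 = lf (\row_j g (delta_mx j 0) i 0) x.
  have gS I (s : seq I) (G : I -> V) : g (\sum_(j <- s) G j) = \sum_(j <- s) g (G j).
    by rewrite /g linear_sum -sumrB.
  have gZ a y : g (a *: y) = a *: g y by rewrite /g linearZ scalerBr.
  rewrite /lf [RHS]mxE {1}[x]matrix_sum_delta.
  under eq_bigr => j _ do rewrite big_ord1.
  rewrite gS summxE; apply: eq_bigr => j _.
  by rewrite gZ [LHS]mxE [in RHS]mxE mulrC.
exists (\row_j g (delta_mx j 0) i 0); split; last by rewrite -glin.
by move=> x xU; rewrite -glin /g projv_id // subrr mxE.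
Qed.

Lemma point_closed P : zariski_closed [set P].
Proof.
exists [set G | exists2 r, G = lin r & hyperplane r P]; split.
  by move=> G [r -> _]; exists 1%N; exact: lin_homog.
rewrite predeqE => Q; split=> [-> G [r -> rP] v vP|H].
  by rewrite ev_lin; exact: rP.
apply/val_inj/eqP; rewrite /= eqEdim (eqP (line_dim P)) (eqP (line_dim Q)) leqnn andbT.
have [v v0 Qv] := point_gen Q; rewrite Qv -memvE; apply: contraT => vP.
have [r [rP rv]] := separating_form vP.
have := H (lin r) (ex_intro2 _ _ r erefl rP) v; rewrite ev_lin Qv memv_line.
by move=> /(_ isT) rv0; rewrite rv0 eqxx in rv.
Qed.

Lemma point_irreducible P : irreducible_closed [set P].
Proof.
split; first exact: point_closed.
  by exists P.
move=> A B _ _ H; have [AP|BP] := H P erefl.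
  by left=> Q ->.
by right=> Q ->.
Qed.

Lemma dim_le_empty Z P : dim_le Z (-1) -> ~ Z P.
Proof.
move=> [_ H] ZP; have : (0%N%:Z <= -1)%R; last by [].
apply: (H 0%N (fun _ => [set P])); split=> // i _; split.
  exact: point_irreducible.
by move=> Q ->.
Qed.

(** The last member of a chain in the section lies in an irreducible subset of [Z] that contains a
    point of [zs]. That point is off the hyperplane, so the chain becomes longer by one in [Z]. *)
Lemma dim_le_section Z zs r (k : int) : catches Z zs ->
  (forall z, z \in zs -> ~ hyperplane r z) -> dim_le Z k -> (0 <= k)%R ->
  dim_le (Z `&` hyperplane r) (k - 1).
Proof.
move=> [_ cat] zr [k1 dZ] k0; split; first by move: k0; lia.
move=> l Y [Yirr Ylt].
have [irl YlZ] := Yirr l (leqnn l).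
have [Y' [irY' YY' Y'Z [z zz Y'z]]] :=
  cat _ irl (subset_trans YlZ (@subIsetl _ _ _)).
have lt : Y l `<` Y'.
  split=> // Y'Y; apply: (zr z zz); have /YlZ[//] := Y'Y z Y'z.
have : (l.+1%:Z <= k)%R; last by lia.
apply: (dZ l.+1 (fun i => if (i <= l)%N then Y i else Y')); split=> i il.
  case: ifP => [il'|_]; last by split.
  have [? H] := Yirr i il'; split=> //.
  by apply: subset_trans H (@subIsetl _ _ _).
rewrite ltnS in il; rewrite il.
by move: il; rewrite leq_eqVlt => /orP[/eqP ->|il]; [rewrite ltnn | rewrite il; exact: Ylt].
Qed.

End Closed.

(** * Adding a generic vector to a subspace that avoids a closed set *)

Section GenericExtension.
Variables (K : fieldType) (m : nat).
Hypothesis charK : [pchar K] =i pred0.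
Local Notation V := 'cV[K]_m.+1.
Local Notation pt := (Defs.point K m).

(** On the line joining the two witnesses both restrictions are nonzero polynomials, and so is their
    product. *)
Lemma nonvanishM (W : {vspace V}) (p q : {mpoly K[m.+1]}) :
  (exists2 x, x \in W & ev x p != 0) -> (exists2 x, x \in W & ev x q != 0) ->
  exists2 x, x \in W & ev x (p * q) != 0.
Proof.
move=> [x xW px] [y yW qy].
have lp : ln x (y - x) p != 0.
  by apply: contraNneq px => p0; rewrite -[x]addr0 -(scale0r (y - x)) -ln_horner p0 horner0.
have lq : ln x (y - x) q != 0.
  apply: contraNneq qy => q0; rewrite -(subrK x y) addrC -[y - x]scale1r.
  by rewrite -ln_horner q0 horner0.
have [s] := poly_neq0_horner charK (mulf_neq0 lp lq).
rewrite -rmorphM ln_horner => h; exists (x + s *: (y - x)) => //.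
by rewrite memvD // memvZ // memvB.
Qed.

Lemma avoiding_form (L0 : {vspace V}) (ws : seq V) :
  (forall w, w \in ws -> w \notin L0) ->
  exists r, (forall x, x \in L0 -> lf r x = 0) /\ (forall w, w \in ws -> lf r w != 0).
Proof.
elim: ws => [|w ws IH] H.
  by exists 0; split=> // x _; rewrite /lf mul0mx mxE.
have [|r [rL rws]] := IH; first by move=> x xs; apply: H; rewrite inE xs orbT.
have [|r1 [r1L r1w]] := separating_form (H w _); first by rewrite inE eqxx.
(* The new vector is handled by adding a multiple of [r1]; each vector on which [r1] is nonzero
   excludes a single multiple. *)
have [c cP] := avoid_seq charK [seq - lf r x / lf r1 x | x <- w :: ws].
have key x : x \in w :: ws -> lf r1 x != 0 -> lf (r + c *: r1) x != 0.
  move=> xs r1x; apply: contra cP => /eqP; rewrite lfDl lfZl => e.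
  apply/mapP; exists x => //; apply/(canRL (mulfK r1x))/eqP.
  by rewrite -addr_eq0 addrC e.
exists (r + c *: r1); split=> [x xL|x].
  by rewrite lfDl lfZl rL // r1L // mulr0 addr0.
have [r1x0|r1x xs] := eqVneq (lf r1 x) 0; last exact: key.
rewrite inE => /orP[/eqP xw|xs]; first by rewrite -xw r1x0 eqxx in r1w.
by rewrite lfDl lfZl r1x0 mulr0 addr0 rws.
Qed.

(** Induction on [k]: [W] and [Z] are cut by one hyperplane, which lowers both dimensions by 1,
    until [Z] is empty. The hyperplane contains [L0] and a vector where [Phi] is nonzero, so both
    conditions persist. A point of [Z] in the span of [L0] and a vector of the smaller [W] lies in
    the hyperplane, so it already belongs to the smaller [Z]. *)
Lemma generic_extension_in k (W L0 : {vspace V}) (Z : set pt) (Phi : {mpoly K[m.+1]}) :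
  \dim W = (k + 3)%N -> (L0 <= W)%VS -> (\dim L0 <= 2)%N -> zariski_closed Z ->
  dim_le Z (k%:Z - 1) -> (forall Q, Z Q -> ~~ (line Q <= L0)%VS) ->
  (exists2 x, x \in W & ev x Phi != 0) ->
  exists b, [/\ b \in W, ev b Phi != 0
    & forall Q, Z Q -> ~~ (line Q <= L0 + <[b]>)%VS].
Proof.
elim: k W Z => [|k IH] W Z dW LW dL cZ dZ ZL [x xW px].
  by exists x; split=> // Q ZQ; case: (dim_le_empty dZ ZQ).
have [zs zsP] := catchesP cZ; have [zsZ _] := zsP.
have small (U : {vspace V}) : (\dim U <= 3)%N -> exists2 w, w \in W & w \notin U.
  move=> dU; apply/subvPn; apply: contraL dU => /dimvS.
  by rewrite dW -ltnNge => h; apply: leq_trans h; rewrite addSn ltnS leq_addl.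
have dLz z : (\dim (L0 + <[z : V]>) <= 3)%N.
  have [le _] := dimv_add_leqif L0 <[z]>; apply: leq_trans le _.
  by rewrite -[3%N]/(2 + 1)%N leq_add // dim_vline leq_b1.
(* For each [z] the product acquires a linear form that is zero on [L0 + line z], so its
   nonvanishing at [w] keeps [w] out of that space. *)
have [p [pW pP]] : exists p : {mpoly K[m.+1]}, (exists2 x, x \in W & ev x p != 0) /\
    forall w : V, ev w p != 0 -> ev w Phi != 0 /\
      forall z, z \in zs -> w \notin (L0 + line z)%VS.
  elim: (zs) => [|z zs' [p [pW pP]]].
    by exists Phi; split; [exists x | move=> w pw; split].
  have [v _ zv] := point_gen z.
  have [w wW wL] := small _ (dLz v).
  have [r [rL rw]] := separating_form wL.
  exists (p * lin r); split.
    by apply: nonvanishM => //; exists w => //; rewrite ev_lin.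
  move=> w'; rewrite rmorphM /= mulf_eq0 negb_or => /andP[/pP[Pw' zw'] rw'].
  split=> // z'; rewrite inE => /orP[/eqP ->|/zw' //].
  by apply: contra rw'; rewrite zv ev_lin => /rL ->.
have [w wW /pP[Pw wz]] := pW.
have zLw z : z \in zs -> ~~ (line z <= L0 + <[w]>)%VS.
  move=> zzs; have := wz z zzs; have [v v0 zv] := point_gen z.
  rewrite zv -memvE; apply: contra => /memv_addP[l lL [u /vlineP[a ->] e]].
  have [a0|a0] := eqVneq a 0.
    have := ZL z (zsZ z zzs); rewrite zv -memvE e a0 scale0r addr0.
    by rewrite lL.
  rewrite (_ : w = - a^-1 *: l + a^-1 *: v).
    by rewrite memv_add // memvZ // memv_line.
  by rewrite e scaleNr scalerDr scalerA mulVf // scale1r addKr.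
(* A form that is nonzero at [y] does not vanish on all of [W], which makes the dimension drop. *)
have [y yW yL] := small _ (dLz w).
have [|r [rL rP]] := @avoiding_form (L0 + <[w]>)%VS
  (y :: [seq vpick (line z) | z <- zs]).
  move=> u; rewrite inE => /orP[/eqP -> //|/mapP[z zzs ->]].
  apply: contra (zLw z zzs) => uL.
  by have [_ ->] := line_vpick z; rewrite -memvE.
pose h : 'Hom(V, 'cV[K]_1) := linfun (mulmx r).
have hE u : (u \in lker h) = (lf r u == 0).
  rewrite memv_ker lfunE /=; apply/eqP/eqP => [e|e].
    by rewrite /lf e mxE.
  by apply/colP => i; rewrite ord1 [RHS]mxE.
pose W' := (W :&: lker h)%VS.
have dW' : \dim W' = (k + 3)%N.
  have := limg_ker_dim h W; rewrite dW -/W'.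
  have d1 : (\dim (h @: W) <= 1)%N.
    by apply: leq_trans (dimvS (subvf _)) _; rewrite dimvf dim_matrix.
  have d2 : (0 < \dim (h @: W))%N.
    rewrite lt0n dimv_eq0; apply: contraTneq (rP y _) => [h0|]; last by rewrite inE eqxx.
    have : h y \in (h @: W)%VS by exact: memv_img.
    by rewrite h0 memv0 -memv_ker hE => ->.
  move: d1 d2; case: (\dim (h @: W)) => [|[|j]] // _ _.
  by rewrite addn1 addSn => -[].
have L0W' : (L0 <= W')%VS.
  rewrite subv_cap LW /=; apply/subvP => u uL; rewrite hE rL ?eqxx //.
  exact: (subvP (addvSl _ _)).
have wW' : w \in W'.
  rewrite memv_cap wW /= hE rL ?eqxx //.
  exact: (subvP (addvSr _ _)) (memv_line w).
have zr z : z \in zs -> ~ hyperplane r z.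
  move=> zzs /(_ _ (memv_pick _)) e.
  have := rP (vpick (line z)); rewrite e eqxx => H; apply/notF/H.
  by rewrite inE; apply/orP; right; apply/mapP; exists z.
have dZ' : dim_le (Z `&` hyperplane r) (k%:Z - 1).
  have kE : k.+1%:Z - 1 = k%:Z by rewrite intS [1 + _]addrC addrK.
  by rewrite -kE; apply: (dim_le_section zsP zr dZ); rewrite kE.
have cZ' := closed_setI cZ (hyperplane_closed r).
have [|b [bW' pb Zb]] := IH W' _ dW' L0W' dL cZ' dZ' _ (ex_intro2 _ _ w wW' Pw).
  by move=> Q [/ZL].
have bW : b \in W by move: bW'; rewrite memv_cap => /andP[].
exists b; split=> // Q ZQ; apply/negP => QL.
have /Zb/negP[] // : (Z `&` hyperplane r) Q.
split=> // u uQ; apply/eqP; rewrite -hE.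
have : u \in W'.
  apply: (subvP _ u (subvP QL u uQ)); rewrite subv_add L0W' /=.
  by rewrite -memvE.
by rewrite memv_cap => /andP[].
Qed.

End GenericExtension.

(** * The discriminant at a Galois point *)

(* The leading coefficient of the Hessian of l x^3 + q x^2 + c x + g, up to a
   constant; when [l != 0] and the discriminant is 0, its vanishing means that
   the double root is a triple root. *)
Definition hess3 (R : comNzRingType) (l q c : R) : R := q ^+ 2 - 3 * l * c.

Lemma morph_hess3 (A B : comNzRingType) (h : {rmorphism A -> B}) l q c :
  h (hess3 l q c) = hess3 (h l) (h q) (h c).
Proof. by rewrite /hess3; ring. Qed.

(** * Cubics with a parameter whose discriminant has a multiple zero at 0 *)

Section Local.
Variable K : fieldType.
Hypothesis charK : [pchar K] =i pred0.
Implicit Types p q l c g u : {poly K}.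

Lemma horner0_dvd p : p.[0] = 0 -> exists p1, p = p1 * 'X.
Proof.
move=> p0; have /factor_theorem[q ->] : root p 0 by apply/eqP.
by exists q; rewrite subr0.
Qed.

Lemma dvdXn_cancel k p u : u.[0] != 0 -> 'X^k %| p * u -> 'X^k %| p.
Proof.
move=> u0; rewrite Gauss_dvdpl //; apply: coprimep_expl.
by rewrite coprimep_sym coprimepX.
Qed.

(** The double root is (9 l g - q c) / (2 (q^2 - 3 l c)), a formula that remains valid for l = 0.
    The last conclusion, on half the second derivative, says that the root is not triple. *)
Lemma double_root (l q c g : K) : disc3 l q c g = 0 -> hess3 l q c != 0 ->
  exists x, [/\ l * x ^+ 3 + q * x ^+ 2 + c * x + g = 0,
    3 * l * x ^+ 2 + 2 * q * x + c = 0 & 3 * l * x + q != 0].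
Proof.
move=> d0 h0; pose h := hess3 l q c; pose N := 9 * l * g - q * c.
have n2 : (2 : K) != 0 by rewrite (natf_eq0 charK).
have h2 : 2 * h != 0 by rewrite mulf_neq0.
exists (N / (2 * h)); split.
- have -> : l * (N / (2 * h)) ^+ 3 + q * (N / (2 * h)) ^+ 2 + c * (N / (2 * h)) + g
      = (l * N ^+ 3 + 2 * q * N ^+ 2 * h + 4 * c * N * h ^+ 2 + 8 * g * h ^+ 3)
        / (2 * h) ^+ 3 by field; rewrite n2 h0.
  have -> : l * N ^+ 3 + 2 * q * N ^+ 2 * h + 4 * c * N * h ^+ 2 + 8 * g * h ^+ 3
      = disc3 l q c g * (9 * l * q * c - 27 * l ^+ 2 * g - 2 * q ^+ 3).
    by rewrite /N /h /hess3 /disc3; ring.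
  by rewrite d0 !mul0r.
- have -> : 3 * l * (N / (2 * h)) ^+ 2 + 2 * q * (N / (2 * h)) + c
      = (3 * l * N ^+ 2 + 4 * q * N * h + 4 * c * h ^+ 2) / (2 * h) ^+ 2.
    by field; rewrite n2 h0.
  have -> : 3 * l * N ^+ 2 + 4 * q * N * h + 4 * c * h ^+ 2
      = - 9 * l * disc3 l q c g by rewrite /N /h /hess3 /disc3; ring.
  by rewrite d0 mulr0 mul0r.
have -> : 3 * l * (N / (2 * h)) + q = (3 * l * N + 2 * q * h) / (2 * h).
  by field; rewrite n2 h0.
rewrite mulf_neq0 ?invr_eq0 //.
have : (3 * l * N + 2 * q * h) ^+ 2 != 0.
  have -> : (3 * l * N + 2 * q * h) ^+ 2 = 4 * h ^+ 3 - 27 * l ^+ 2 * disc3 l q c g.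
    by rewrite /N /h /hess3 /disc3; ring.
  by rewrite d0 mulr0 subr0 mulf_neq0 ?expf_neq0 // (natf_eq0 charK).
by rewrite expf_eq0.
Qed.

(** The value of the cubic at the constant [x], which is also its constant coefficient after
    translation by [x]. A zero derivative at 0 means that the hypersurface has no slope in the
    direction of the parameter. *)
Definition shift3 l q c g (x : K) : {poly K} :=
  l * (x ^+ 3)%:P + q * (x ^+ 2)%:P + c * x%:P + g.

Lemma disc3_shift l q c g (x : K) : disc3 l q c g =
  disc3 l (q + 3 * l * x%:P) (c + 2 * q * x%:P + 3 * l * x%:P ^+ 2)
    (shift3 l q c g x).
Proof. by rewrite /disc3 /shift3 !polyC_exp; ring. Qed.

Lemma natp_horner n x : (n%:R : {poly K}).[x] = n%:R.
Proof. by rewrite -polyC_natr hornerC. Qed.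

Let hE := (natp_horner, horner_exp, hornerD, hornerN, hornerM, hornerC).

Lemma deriv_mulX p : (p * 'X)^`().[0] = p.[0].
Proof. by rewrite derivM derivX !hornerE. Qed.

(** After translating the root to 0, [c1] and [g1] are divisible by ['X] and [b] is not. The
    discriminant is then congruent to -4 b^3 g1 modulo ['X^2], so ['X^2] divides [g1]. *)
Lemma shift3_double l q c g (x : K) : 'X^2 %| disc3 l q c g ->
  l.[0] * x ^+ 3 + q.[0] * x ^+ 2 + c.[0] * x + g.[0] = 0 ->
  3 * l.[0] * x ^+ 2 + 2 * q.[0] * x + c.[0] = 0 ->
  3 * l.[0] * x + q.[0] != 0 -> (shift3 l q c g x)^`().[0] = 0.
Proof.
rewrite (disc3_shift l q c g x); set b := q + _; set c1 := c + _ + _.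
set g1 := shift3 _ _ _ _ _ => dv fx f'x f''x.
have c10 : c1.[0] = 0 by rewrite !hE -[RHS]f'x; ring.
have g10 : g1.[0] = 0 by rewrite !hE.
have b0 : b.[0] != 0 by rewrite !hE addrC.
clearbody b c1 g1; have [c2 c2E] := horner0_dvd c10.
pose u := 4 * b ^+ 3 + 27 * l ^+ 2 * g1 - 18 * l * b * c1.
have u0 : u.[0] != 0.
  rewrite !hE g10 c10 !mulr0 addr0 subr0 mulf_neq0 ?expf_neq0 //.
  by rewrite (natf_eq0 charK).
have : 'X^2 %| g1 * u.
  have -> : g1 * u = c2 ^+ 2 * (b ^+ 2 - 4 * l * c1) * 'X^2 - disc3 l b c1 g1.
    by rewrite /disc3 /u c2E; ring.
  by rewrite dvdp_subr // dvdp_mull.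
move/(dvdXn_cancel u0)/dvdpP => [g2 ->].
by rewrite exprS expr1 mulrA deriv_mulX !hornerE.
Qed.

(** After translation [b], [c1] and [g1] are all divisible by ['X]. Modulo ['X^3] only -27 l^2 g1^2
    survives in the discriminant, so [g1] is divisible by ['X^2]. *)
Lemma shift3_triple l q c g : 'X^4 %| disc3 l q c g -> (hess3 l q c).[0] = 0 ->
  l.[0] != 0 -> exists x, [/\ x = - q.[0] / (3 * l.[0]),
    l.[0] * x ^+ 3 + q.[0] * x ^+ 2 + c.[0] * x + g.[0] = 0,
    3 * l.[0] * x ^+ 2 + 2 * q.[0] * x + c.[0] = 0 &
    (shift3 l q c g x)^`().[0] = 0].
Proof.
move=> dv h0 l0; pose x := - q.[0] / (3 * l.[0]); exists x.
have n3 : (3 : K) != 0 by rewrite (natf_eq0 charK).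
have n27 : (27 : K) != 0 by rewrite (natf_eq0 charK).
move: dv; rewrite (disc3_shift l q c g x); set b := q + _; set c1 := c + _ + _.
set g1 := shift3 _ _ _ _ _ => dv.
have b0 : b.[0] = 0 by rewrite !hE /x; field; rewrite n3 l0.
have h1 : hess3 l q c = b ^+ 2 - 3 * l * c1 by rewrite /hess3 /b /c1; ring.
have <- : g1.[0] = l.[0] * x ^+ 3 + q.[0] * x ^+ 2 + c.[0] * x + g.[0].
  by rewrite /g1 /shift3 !hE.
have <- : c1.[0] = 3 * l.[0] * x ^+ 2 + 2 * q.[0] * x + c.[0].
  by rewrite /c1 !hE; ring.
clearbody b c1 g1.
have c10 : c1.[0] = 0.
  move/eqP: h0; rewrite h1 !hE b0 expr0n /= sub0r oppr_eq0 !mulf_eq0 (negPf n3).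
  by rewrite (negPf l0) /= => /eqP.
have [d dE] := dvdpP _ _ dv.
have g10 : g1.[0] = 0.
  have : (disc3 l b c1 g1).[0] = 0 by rewrite dE !hE hornerX expr0n mulr0.
  have -> : (disc3 l b c1 g1).[0] = disc3 l.[0] b.[0] c1.[0] g1.[0].
    by rewrite /disc3 !hE.
  have -> : disc3 l.[0] b.[0] c1.[0] g1.[0] = - (27 * l.[0] ^+ 2 * g1.[0] ^+ 2).
    by rewrite b0 c10 /disc3; ring.
  move/eqP; rewrite oppr_eq0 !mulf_eq0 (negPf n27) (negPf l0) /= !orbb.
  by move/eqP.
have [b2 b2E] := horner0_dvd b0; have [c2 c2E] := horner0_dvd c10.
have [g2 g2E] := horner0_dvd g10.
have g20 : g2.[0] = 0.
  have : 27 * l ^+ 2 * g2 ^+ 2 = (b2 ^+ 2 * c2 ^+ 2 * 'X - 4 * l * c2 ^+ 3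
      - 4 * b2 ^+ 3 * g2 * 'X + 18 * l * b2 * c2 * g2 - d * 'X) * 'X.
    apply: (@mulIf _ ('X^2)); first by rewrite -size_poly_eq0 size_polyXn.
    transitivity (27 * l ^+ 2 * g1 ^+ 2); first by rewrite g2E; ring.
    transitivity (27 * l ^+ 2 * g1 ^+ 2 + (disc3 l b c1 g1 - d * 'X^4)).
      by rewrite dE subrr addr0.
    by rewrite /disc3 b2E c2E g2E; ring.
  move/(congr1 (horner^~ 0)); rewrite !hE hornerX mulr0 => /eqP.
  by rewrite !mulf_eq0 (negPf n27) (negPf l0) /= !orbb => /eqP.
by split=> //; rewrite g2E deriv_mulX.
Qed.

(** The Hessian gives q = 0 at the origin. Then the discriminant is -4 l c^3 modulo ['X^2], and as
    [l] has a simple zero, c = 0 there. Finally it is -27 l^2 g^2 modulo ['X^3], so that g = 0. *)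
Lemma vanishing_at_infinity l q c g : 'X^4 %| disc3 l q c g ->
  (hess3 l q c).[0] = 0 -> l.[0] = 0 -> l^`().[0] != 0 ->
  [/\ q.[0] = 0, c.[0] = 0 & g.[0] = 0].
Proof.
move=> /dvdpP[d dE] h0 l0 l'0.
have n4 : (4 : K) != 0 by rewrite (natf_eq0 charK).
have n27 : (27 : K) != 0 by rewrite (natf_eq0 charK).
have q0 : q.[0] = 0.
  move/eqP: h0; rewrite /hess3 !hE l0 mulr0 mul0r subr0 expf_eq0 /= => /eqP //.
have [l1 l1E] := horner0_dvd l0; have [q1 q1E] := horner0_dvd q0.
have l10 : l1.[0] != 0 by rewrite -deriv_mulX -l1E.
have nX k : 'X^k != 0 :> {poly K} by rewrite -size_poly_eq0 size_polyXn.
have c0 : c.[0] = 0.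
  have : 4 * l1 * c ^+ 3 = (q1 ^+ 2 * c ^+ 2 - 4 * q1 ^+ 3 * 'X * g
      - 27 * l1 ^+ 2 * g ^+ 2 + 18 * l1 * q1 * c * g - d * 'X^2) * 'X.
    apply: (@mulIf _ 'X); first by rewrite -['X]expr1 nX.
    transitivity (4 * l * c ^+ 3); first by rewrite l1E; ring.
    transitivity (4 * l * c ^+ 3 + (disc3 l q c g - d * 'X^4)).
      by rewrite dE subrr addr0.
    by rewrite /disc3 l1E q1E; ring.
  move/(congr1 (horner^~ 0)); rewrite !hE hornerX mulr0 => /eqP.
  by rewrite !mulf_eq0 (negPf n4) (negPf l10) /= !orbb => /eqP.
have [c1 c1E] := horner0_dvd c0; split=> //.
have : 27 * l1 ^+ 2 * g ^+ 2 = (q1 ^+ 2 * c1 ^+ 2 * 'X - 4 * l1 * c1 ^+ 3 * 'X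
    - 4 * q1 ^+ 3 * g + 18 * l1 * q1 * c1 * g - d * 'X) * 'X.
  apply: (@mulIf _ ('X^2)); first exact: nX.
  transitivity (27 * l ^+ 2 * g ^+ 2); first by rewrite l1E; ring.
  transitivity (27 * l ^+ 2 * g ^+ 2 + (disc3 l q c g - d * 'X^4)).
    by rewrite dE subrr addr0.
  by rewrite /disc3 l1E q1E c1E; ring.
move/(congr1 (horner^~ 0)); rewrite !hE hornerX mulr0 => /eqP.
by rewrite !mulf_eq0 (negPf n27) (negPf l10) /= !orbb => /eqP.
Qed.

End Local.

Section Slices.
Variables (K : fieldType) (m : nat).
Hypothesis charK : [pchar K] =i pred0.
Implicit Types (q : {poly {mpoly K[m]}}) (b w : 'cV[K]_m).

(** Restriction of [q] to the line [b + 'X *: w], with the variable of [q] frozen at [s]. *)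
Definition slice b w s q : {poly K} :=
  \sum_(i < size q) ln b w q`_i * (s ^+ i)%:P.

Lemma slice_horner b w s q t : (slice b w s q).[t] = ev2 (b + t *: w) s q.
Proof.
rewrite ev2E horner_sum; apply: eq_bigr => i _.
by rewrite hornerM hornerC ln_horner.
Qed.

Lemma sliceM b w s q q' : slice b w s (q * q') = slice b w s q * slice b w s q'.
Proof.
by apply: (poly_eq_horner charK) => t; rewrite hornerM !slice_horner ev2M.
Qed.

Lemma sliceC b w s c : slice b w s c%:P = ln b w c.
Proof.
by apply: (poly_eq_horner charK) => t; rewrite slice_horner ev2C ln_horner.
Qed.

Lemma slice_sub a b w s p : slice b w s (sub a 1%:M p) = ln (s *: a + b) w p.
Proof.
apply: (poly_eq_horner charK) => t.
by rewrite slice_horner sub_ev ln_horner mul1mx addrA.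
Qed.

Lemma slice0 b w s q : (slice b w s q).[0] = ev2 b s q.
Proof. by rewrite slice_horner scale0r addr0. Qed.

Lemma map_ev_root (b : 'cV[K]_m) q s : root (map_poly (ev b) q) s = (ev2 b s q == 0).
Proof. by rewrite ev2_def. Qed.

End Slices.

Lemma poly_deriv0_mpoly (K : fieldType) m (q : {poly {mpoly K[m]}}) :
  [pchar K] =i pred0 -> q^`() = 0 -> (size q <= 1)%N.
Proof.
move=> charK q0; apply/leq_sizeP => -[|i] // _.
have := congr1 (fun q : {poly {mpoly K[m]}} => q`_i) q0.
rewrite coef_deriv coef0 -scaler_nat => /eqP.
by rewrite scaler_eq0 (natf_eq0 charK) /= => /eqP.
Qed.

Section Hessian.
Variables (K : closedFieldType) (n : nat) (X : hypersurface K n 4).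
Hypothesis charK : [pchar K] =i pred0.
Variables (v : 'cV[K]_n.+2) (c : 'rV[K]_n.+2) (M : 'M[K]_(n.+1, n.+2))
  (N : 'M[K]_(n.+2, n.+1)).
Hypotheses (Mv : M *m v = 0) (cv : c *m v = 1%:M) (cN : c *m N = 0)
  (MN : M *m N = 1%:M) (vcNM : v *m c + N *m M = 1%:M).

Local Notation R := {mpoly K[n.+1]}.
Local Notation f := (sub v N (Defs.eqn X)).
Local Notation "'fL'" := (f`_3 : R).
Local Notation "'fQ'" := (f`_2 : R).
Local Notation "'fC'" := (f`_1 : R).
Local Notation "'fG'" := (f`_0 : R).

Hypothesis f3 : fL != 0.
Hypothesis f4 : f`_4 = 0.

Implicit Types (y w : 'cV[K]_n.+1).

Let fhom i : (i <= 4)%N -> f`_i \is (4 - i).-homog.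
Proof. by move=> i4; have := sub_bihomog v N (eqn_homog X) i; rewrite i4. Qed.

Lemma ev_coords x (y : 'cV[K]_n.+1) : ev (x *: v + N *m y) X =
  ev y fL * x ^+ 3 + ev y fQ * x ^+ 2 + ev y fC * x + ev y fG.
Proof.
rewrite -sub_ev ev2E (size_f f3 f4) !big_ord_recr big_ord0 /= expr0 expr1.
by rewrite add0r mulr1; ring.
Qed.

Lemma decompose (x : 'cV[K]_n.+2) : x = (lf c x) *: v + N *m (M *m x).
Proof.
rewrite -[LHS](mul1mx x) -vcNM mulmxDl -!mulmxA; congr (_ + _).
by apply/colP => k; rewrite /lf [LHS]mxE [RHS]mxE big_ord1 mulrC.
Qed.

Lemma singular_point (z : 'cV[K]_n.+2) : z != 0 -> (forall x, ev z (dirD x X) = 0) ->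
  exists2 Q, Sing X Q & line Q = <[z]>%VS.
Proof.
move=> z0 dz; have dim1 : \dim <[z]> == 1%N by rewrite dim_vline z0.
exists (Point dim1) => //; split=> [|i].
  apply/(vanishes_gen (eqn_homog X) (erefl : line (Point dim1) = _)).
  have := euler charK z (eqn_homog X); rewrite dz => /esym/eqP.
  by rewrite mulf_eq0 (natf_eq0 charK) => /eqP.
have hi : X^`M(i) \is 3.-homog.
  by rewrite -dirD_delta; exact: dirD_homog (eqn_homog X).
apply/(vanishes_gen hi (erefl : line (Point dim1) = _)).
by rewrite -dirD_delta.
Qed.

(** The hypotheses are the vanishing of the derivatives along [v] and along all [N *m w], and these
    directions span the space. *)
Lemma singular_coords x (y : 'cV[K]_n.+1) : y != 0 ->
  3 * ev y fL * x ^+ 2 + 2 * ev y fQ * x + ev y fC = 0 ->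
  (forall w, (shift3 (ln y w fL) (ln y w fQ) (ln y w fC) (ln y w fG) x)^`().[0] = 0) ->
  exists2 Q, Sing X Q & line Q = <[x *: v + N *m y]>%VS.
Proof.
move=> y0 dx dy; apply: singular_point => [|u].
  apply: contraNneq y0 => e; have := congr1 (mulmx M) e.
  by rewrite mulmx0 mulmxDr -scalemxAr Mv scaler0 add0r mulmxA MN mul1mx => ->.
rewrite (decompose u) dirDl dirDZl rmorphD /= mevalZ.
rewrite (@ev_dirD _ charK _ _ _ _ ((ev y fL)%:P * ('X + x%:P) ^+ 3
   + (ev y fQ)%:P * ('X + x%:P) ^+ 2 + (ev y fC)%:P * ('X + x%:P) + (ev y fG)%:P)) => [|s].
  rewrite (ev_dirD charK (q := shift3 (ln y (M *m u) fL) (ln y (M *m u) fQ)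
    (ln y (M *m u) fC) (ln y (M *m u) fG) x)) => [|s].
    rewrite dy addr0 (_ : _^`().[0] = 3 * ev y fL * x ^+ 2 + 2 * ev y fQ * x + ev y fC).
      by rewrite dx mulr0.
    by rewrite !(derivD, derivM, derivX, derivC) !hornerE /=; ring.
  rewrite -addrA scalemxAr -mulmxDr ev_coords /shift3.
  by rewrite !hornerD !hornerM !ln_horner !hornerC.
rewrite addrAC -scalerDl ev_coords !hornerE /=.
by rewrite [x + s]addrC.
Qed.

Local Notation D := (disc3 fL fQ fC fG).
Local Notation H1 := (hess3 fL fQ fC).

Lemma ln_disc3 y w : ln y w D = disc3 (ln y w fL) (ln y w fQ) (ln y w fC) (ln y w fG).
Proof.
exact: (morph_disc3 (ln y w)).
Qed.

Lemma ev_disc3 y : ev y D = disc3 (ev y fL) (ev y fQ) (ev y fC) (ev y fG).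
Proof. exact: (morph_disc3 (meval _)). Qed.

Lemma ev_hess3 y : ev y H1 = hess3 (ev y fL) (ev y fQ) (ev y fC).
Proof. exact: (morph_hess3 (meval _)). Qed.

Lemma ln0 (y w : 'cV[K]_n.+1) (p : R) : (ln y w p).[0] = ev y p.
Proof. by rewrite ln_horner scale0r addr0. Qed.

Lemma ln_hess0 y w : (hess3 (ln y w fL) (ln y w fQ) (ln y w fC)).[0] = ev y H1.
Proof.
by rewrite ev_hess3 /hess3 hornerD hornerN !hornerM natp_horner !ln0.
Qed.

Lemma singular_over_simple_double_root y : y != 0 ->
  (forall w, 'X^2 %| ln y w D) -> ev y H1 != 0 ->
  exists x, exists2 Q, Sing X Q & line Q = <[x *: v + N *m y]>%VS.
Proof.
move=> y0 dv h0; have D0 : disc3 (ev y fL) (ev y fQ) (ev y fC) (ev y fG) = 0.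
  rewrite -ev_disc3 -(ln0 _ 0); have /dvdpP[q ->] := dv 0.
  by rewrite hornerM horner_exp hornerX expr0n mulr0.
rewrite ev_hess3 in h0; have [x [fx f'x f''x]] := double_root charK D0 h0.
exists x; apply: singular_coords => // w.
have dvw := dv w; rewrite ln_disc3 in dvw.
by apply: (shift3_double charK dvw); rewrite !ln0.
Qed.

Lemma singular_over_triple_root y : y != 0 ->
  (forall w, 'X^4 %| ln y w D) -> ev y H1 = 0 -> ev y fL != 0 ->
  exists x, exists2 Q, Sing X Q & line Q = <[x *: v + N *m y]>%VS.
Proof.
move=> y0 dv h0 l0; pose x := - ev y fQ / (3 * ev y fL).
have key w : [/\ 3 * ev y fL * x ^+ 2 + 2 * ev y fQ * x + ev y fC = 0 &
    (shift3 (ln y w fL) (ln y w fQ) (ln y w fC) (ln y w fG) x)^`().[0] = 0].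
  have dvw := dv w; rewrite ln_disc3 in dvw.
  have := shift3_triple charK dvw; rewrite ln_hess0 !ln0 => /(_ h0 l0).
  by case=> _ [-> _ ? ?].
exists x; apply: singular_coords => //; first by case: (key 0).
by move=> w; case: (key w).
Qed.

(** The coefficient [fL] is a nonzero linear form, so some line through [y] meets its zero set
    transversally, as [vanishing_at_infinity] demands. *)
Lemma coefs_vanish y : (forall w, 'X^4 %| ln y w D) -> ev y H1 = 0 ->
  ev y fL = 0 -> [/\ ev y fQ = 0, ev y fC = 0 & ev y fG = 0].
Proof.
move=> dv h0 l0; have [r LE] := homog1P (fhom (isT : (3 <= 4)%N)).
have r0 : r != 0.
  apply: contraNneq f3 => r0; rewrite LE /lin big1 // => j _.
  by rewrite r0 mxE scale0r.
have [w rw] := lf_neq0 r0.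
have dvw := dv w; rewrite ln_disc3 in dvw.
have := vanishing_at_infinity charK dvw; rewrite ln_hess0 !ln0; apply=> //.
rewrite ln_deriv ln0 (_ : dirD w fL = (lf r w)%:MP) ?mevalC //.
apply: (mpoly_ev_eq charK) => x; rewrite mevalC.
rewrite (@ev_dirD _ charK _ _ _ _ ((lf r x)%:P + (lf r w) *: 'X)) => [|s].
  by rewrite derivD derivC derivZ derivX !hornerE.
by rewrite LE ev_lin lfD lfZ !hornerE mulrC.
Qed.

End Hessian.

Lemma Sing_closed (K : fieldType) n d (X : hypersurface K n d) :
  zariski_closed (Sing X).
Proof.
exists [set G : {mpoly K[n.+2]} | G = X \/ exists i : 'I_n.+2, G = X^`M(i)]%classic; split.
  move=> G [->|[i ->]]; first by exists d; exact: eqn_homog.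
  by exists d.-1; rewrite -dirD_delta; exact: dirD_homog (eqn_homog X).
rewrite predeqE => P; split=> [[PX dX] G [->|[i ->]] //|H]; split=> [|i].
  by apply: H; left.
by apply: H; right; exists i.
Qed.

Section Hessian.
Variables (K : closedFieldType) (n : nat) (X : hypersurface K n 4).
Hypothesis charK : [pchar K] =i pred0.
Hypothesis n_ge1 : (1 <= n)%N.
Variables (v : 'cV[K]_n.+2) (c : 'rV[K]_n.+2) (M : 'M[K]_(n.+1, n.+2))
  (N : 'M[K]_(n.+2, n.+1)).
Hypotheses (Mv : M *m v = 0) (cv : c *m v = 1%:M) (cN : c *m N = 0)
  (MN : M *m N = 1%:M) (vcNM : v *m c + N *m M = 1%:M).

Local Notation R := {mpoly K[n.+1]}.
Local Notation f := (sub v N (Defs.eqn X)).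
Local Notation "'fL'" := (f`_3 : R).
Local Notation "'fQ'" := (f`_2 : R).
Local Notation "'fC'" := (f`_1 : R).
Local Notation "'fG'" := (f`_0 : R).
Local Notation D := (disc3 fL fQ fC fG).
Local Notation H1 := (hess3 fL fQ fC).

Hypothesis f3 : fL != 0.
Hypothesis f4 : f`_4 = 0.
Hypothesis sX : dim_le (Sing X) (n%:Z - 2).
Hypothesis Pns : forall Q, Sing X Q -> ~~ (line Q <= <[v]>)%VS.

Implicit Types (y w : 'cV[K]_n.+1).

Let fhom i : (i <= 4)%N -> f`_i \is (4 - i).-homog.
Proof. by move=> i4; have := sub_bihomog v N (eqn_homog X) i; rewrite i4. Qed.

Lemma D_homog : D \is 10.-homog.
Proof.
have hL := fhom (isT : 3 <= 4)%N; have hQ := fhom (isT : 2 <= 4)%N.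
have hC := fhom (isT : 1 <= 4)%N; have hG := fhom (isT : 0 <= 4)%N.
have nat_hom k : (k%:R : R) \is 0.-homog by rewrite -mpolyC_nat mpolyC_homog.
have M1 (p q : R) i j l : (i + j = l)%N -> p \is i.-homog -> q \is j.-homog ->
  p * q \is l.-homog by move=> <-; exact: dhomogM.
have E1 (p : R) i k l : (i * k = l)%N -> p \is i.-homog -> p ^+ k \is l.-homog.
  by move=> <-; exact: dhomogMn.
rewrite /disc3; do ?[apply: rpredB | apply: rpredD].
- by apply: (M1 _ _ 4%N 6%N) => //; [apply: (E1 _ 2%N)|apply: (E1 _ 3%N)].
- apply: (M1 _ _ 1%N 9%N) => //; last exact: (E1 _ 3%N).
  exact: (M1 _ _ 0%N 1%N).
- apply: (M1 _ _ 6%N 4%N) => //.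
  by apply: (M1 _ _ 0%N 6%N) => //; exact: (E1 _ 2%N).
- apply: (M1 _ _ 2%N 8%N) => //; last exact: (E1 _ 4%N).
  by apply: (M1 _ _ 0%N 2%N) => //; exact: (E1 _ 1%N).
apply: (M1 _ _ 6%N 4%N) => //; apply: (M1 _ _ 3%N 3%N) => //.
by apply: (M1 _ _ 1%N 2%N) => //; exact: (M1 _ _ 0%N 1%N).
Qed.

Lemma H1_homog : H1 \is 4.-homog.
Proof.
have hL := fhom (isT : 3 <= 4)%N; have hQ := fhom (isT : 2 <= 4)%N.
have hC := fhom (isT : 1 <= 4)%N.
rewrite /hess3; apply: rpredB; first exact: (dhomogMn 2 hQ).
have h3 : (3%:R : R) \is 0.-homog by rewrite -mpolyC_nat mpolyC_homog.
exact: (dhomogM (dhomogM h3 hL) hC).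
Qed.

Lemma avoid_singular (L0 : {vspace 'cV[K]_n.+2}) (Phi : R) :
  (\dim L0 <= 2)%N -> (forall Q, Sing X Q -> ~~ (line Q <= L0)%VS) -> Phi != 0 ->
  exists b, ev (M *m b) Phi != 0 /\
    forall Q, Sing X Q -> ~~ (line Q <= L0 + <[b]>)%VS.
Proof.
move=> dL LS P0; have [y Py] := mpoly_neq0_ev charK P0.
(* The whole space has dimension n + 2 = (n - 1) + 3 and the bound on the singular locus is n - 2 =
   (n - 1) - 1, so the generic extension applies with k = n - 1. *)
have dV : \dim {: 'cV[K]_n.+2} = (n.-1 + 3)%N.
  rewrite dimvf; transitivity (n.+2 * 1)%N => //; rewrite muln1.
  by case: (n) n_ge1 => // k _; rewrite /= addn3.
have dX : dim_le (Sing X) (n.-1%:Z - 1).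
  rewrite (_ : n.-1%:Z - 1 = n%:Z - 2) //.
  by case: (n) n_ge1 => // k _; rewrite intS /= opprD addrACA subrr add0r.
have [|b [_ Pb bS]] := generic_extension_in charK dV (subvf L0) dL (@Sing_closed _ _ _ X)
  dX LS (Phi := lin_subst M Phi).
  by exists (N *m y); rewrite ?memvf // ev_lin_subst mulmxA MN mul1mx.
by exists b; split=> //; rewrite -ev_lin_subst.
Qed.

(** A form that is zero at [a] and nonzero at [b] keeps every [s *: a + b] away from 0. It exists
    because P^n has positive dimension. *)
Lemma lin_indep_form (a : 'cV[K]_n.+1) : exists r, r != 0 /\ lf r a = 0.
Proof.
have [w wa] : exists w, w \notin <[a]>%VS.
  apply: contrapT => H; have : (\dim {: 'cV[K]_n.+1} <= \dim <[a]>)%N.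
    apply: dimvS; apply/subvP => w _; apply: contrapT => /negP wa.
    by apply: H; exists w.
  rewrite dimvf dim_vline => h; have : (n.+1 * 1 <= 1)%N.
    exact: leq_trans h (leq_b1 _).
  by rewrite muln1 ltnS leqNgt n_ge1.
have [r [ra rw]] := separating_form wa; exists r; split.
  by apply: contraNneq rw => ->; rewrite /lf mul0mx mxE.
by apply: ra; exact: memv_line.
Qed.

Section Line.
Variables (a' : 'cV[K]_n.+2).
Local Notation a := (M *m a').
Local Notation la := (sub a 1%:M : R -> {poly R}).
Hypothesis Da : ev a D != 0.
Hypothesis La : ev a fL != 0.

Variables (E : {poly R}) (c0 : R).
Hypothesis c00 : c0 != 0.
Hypothesis DE : (c0 ^+ 2)%:P * la D = E ^+ 2.

Lemma ev2_la b s p : ev2 b s (la p) = ev (s *: a + b) p.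
Proof. by rewrite sub_ev mul1mx. Qed.

Lemma size_laD : size (la D) = 11%N.
Proof.
apply/eqP; rewrite eqn_leq (bihomog_size (sub_bihomog _ _ D_homog)) /= ltnNge.
apply/negP => /leq_sizeP/(_ 10%N (leqnn _)); rewrite sub_coef_top ?D_homog //.
by move/eqP; rewrite mpolyC_eq0 (negPf Da).
Qed.

Variables (b' : 'cV[K]_n.+2) (r : 'rV[K]_n.+1).
Local Notation b := (M *m b').
Hypothesis ra : lf r a = 0.
Hypothesis rb : lf r b != 0.
Hypothesis cb : ev b c0 != 0.
Hypothesis NS : forall Q, Sing X Q -> ~~ (line Q <= <[v]> + <[a']> + <[b']>)%VS.

Lemma line_neq0 s : s *: a + b != 0.
Proof.
apply: contraNneq rb => /(congr1 (lf r)).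
by rewrite lfD lfZ ra mulr0 add0r lf0 => ->.
Qed.

Lemma no_singular x s :
  ~ exists2 Q, Sing X Q & line Q = <[x *: v + N *m (s *: a + b)]>%VS.
Proof.
case=> Q /NS QS QE; case/negP: QS; rewrite QE -memvE.
have NME (z : 'cV[K]_n.+2) : N *m (M *m z) = z - lf c z *: v.
  by rewrite {2}(decompose vcNM z) addrC addKr.
have -> : x *: v + N *m (s *: a + b) =
    (x - s * lf c a' - lf c b') *: v + s *: a' + b'.
  by rewrite mulmxDr -scalemxAr !NME; apply/colP => i; rewrite !mxE; ring.
by rewrite !memv_add ?memvZ ?memv_line.
Qed.

(** The identity for c0^2 D holds with y free, so it restricts to the line in direction [w], where
    [c0] is a unit at [b]. *)
Lemma laD_slice k s w : 'X^k %| slice b w s E -> 'X^(k * 2) %| ln (s *: a + b) w D.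
Proof.
move=> kE; apply: (@dvdXn_cancel _ _ _ (ln b w c0 ^+ 2)).
  by rewrite horner_exp ln0 expf_neq0.
have e : ln b w c0 ^+ 2 * ln (s *: a + b) w D = slice b w s E ^+ 2.
  have lnXn : ln b w (c0 ^+ 2) = ln b w c0 ^+ 2 by exact: rmorphXn.
  rewrite -lnXn -(slice_sub charK a b w s) -(sliceC charK b w s) -(sliceM charK).
  by rewrite DE expr2 (sliceM charK).
by rewrite mulrC e exprM; apply: dvdp_exp2r.
Qed.

Lemma hess_root s : ev2 b s E = 0 -> ev (s *: a + b) H1 = 0.
Proof.
move=> Es; apply/eqP; apply: contraT => h0.
have [w|x] := singular_over_simple_double_root charK Mv MN vcNM f3 f4 (line_neq0 s) _ h0.
  apply: (@laD_slice 1); have [p ->] : exists p, slice b w s E = p * 'X by apply: horner0_dvd; rewrite slice0.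
  exact: dvdp_mulIr.
by move/no_singular.
Qed.

Lemma no_double_root (c1 : R) g m s : (c1%:P * E = m * g ^+ 2) -> ev b c1 != 0 ->
  ev2 b s g = 0 ->
  [/\ ev (s *: a + b) fL = 0, ev (s *: a + b) fQ = 0, ev (s *: a + b) fC = 0 &
      ev (s *: a + b) fG = 0].
Proof.
move=> gE c1b gs.
have E2 w : 'X^2 %| slice b w s E.
  apply: (@dvdXn_cancel _ _ _ (ln b w c1)); first by rewrite ln0.
  rewrite mulrC -(sliceC charK _ _ s) -(sliceM charK) gE expr2 !(sliceM charK).
  have [p ->] : exists p, slice b w s g = p * 'X by apply: horner0_dvd; rewrite slice0.
  by rewrite mulrACA -['X * 'X]expr2 mulrA dvdp_mulIr.
have D4 w : 'X^4 %| ln (s *: a + b) w D by exact: (@laD_slice 2 _ _ (E2 w)).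
have E0 : ev2 b s E = 0.
  have /dvdpP[p e] := E2 0; have := slice0 b 0 s E; rewrite e => <-.
  by rewrite hornerM hornerXn expr0n mulr0.
have h0 := hess_root E0.
have [L0|L0] := eqVneq (ev (s *: a + b) fL) 0.
  by have [? ? ?] := coefs_vanish charK f3 D4 h0 L0; split.
have [x] := singular_over_triple_root charK Mv MN vcNM f3 f4 (line_neq0 s) D4 h0 L0.
by move/no_singular.
Qed.

End Line.

Lemma hess_zero_of_square (A B : R) : D != 0 -> B != 0 -> D * B ^+ 2 = A ^+ 2 ->
  H1 = 0.
Proof.
move=> D0 B0 DB; apply/eqP; apply: contraT => h0.
have dimv (x : 'cV[K]_n.+2) : (\dim <[x]> <= 1)%N by rewrite dim_vline leq_b1.
(* D(a) and L(a) are the top coefficients of D and L along lines of direction [a]; their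
   nonvanishing keeps the degrees at 10 and 1. *)
have [a' [DLa S1]] :=
  avoid_singular (leq_trans (dimv v) (leqnSn 1)) Pns (mulf_neq0 D0 f3).
move: DLa; rewrite mevalM mulf_eq0 negb_or => /andP[Da La].
set a := M *m a' in Da La *.
have dim2 : (\dim (<[v]> + <[a']>) <= 2)%N.
  have [le _] := dimv_add_leqif <[v]> <[a']>; apply: leq_trans le _.
  by rewrite -[2%N]/(1 + 1)%N leq_add.
pose la := sub a (1%:M : 'M[K]_n.+1).
have ev2la b s p : ev2 b s (la p) = ev (s *: a + b) p by exact: ev2_la.
have la_inj p : la p = 0 -> p = 0.
  move=> e; apply: (mpoly_ev0 charK) => b.
  by rewrite -[b]add0r -(scale0r a) -ev2la e rmorph0.
have laB0 : la B != 0 by apply: contraNneq B0 => /la_inj ->.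
have laDB : la D * la B ^+ 2 = la A ^+ 2.
  by rewrite !expr2 -!subM -expr2 DB -expr2.
(* Divisibility of the squares descends to the polynomials themselves; the pseudo-quotient is the
   square root [E], up to the constant [c0]. *)
have : la B %| la A.
  rewrite -(@Pdiv.Idomain.dvdp_pexp2r _ _ _ 2) //.
  by rewrite -laDB Pdiv.Idomain.dvdp_mulIr.
rewrite Pdiv.Idomain.dvdp_eq; set c0 := _ ^+ _; set E := _ %/ _ => /eqP AE.
have c00 : c0 != 0 by rewrite expf_neq0 // lead_coef_eq0.
have DE : (c0 ^+ 2)%:P * la D = E ^+ 2.
  apply: (@mulIf _ (la B ^+ 2)); first by rewrite expf_neq0.
  by rewrite -mulrA laDB polyC_exp -!exprMn mul_polyC AE.
clearbody c0 E.
have [r [r0 ra]] := lin_indep_form a.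
have linr0 : lin r != 0.
  by have [x rx] := lf_neq0 r0; apply: contraNneq rx => e; rewrite -ev_lin e meval0.
have pick Phi : Phi != 0 -> exists b', [/\ ev (M *m b') Phi != 0,
    ev (M *m b') c0 != 0, lf r (M *m b') != 0 &
    forall Q, Sing X Q -> ~~ (line Q <= <[v]> + <[a']> + <[b']>)%VS].
  move=> P0; have [b' [Pb S2]] := avoid_singular dim2 S1
    (mulf_neq0 (mulf_neq0 P0 c00) linr0).
  exists b'; move: Pb; rewrite !mevalM !mulf_eq0 !negb_or ev_lin.
  by case/andP=> /andP[? ?] ?; split.
(* So [E] has degree 5, and its leading coefficient stays nonzero wherever [c0] does. *)
have leadE : lead_coef E ^+ 2 = c0 ^+ 2 * (ev a D)%:MP.
  rewrite -lead_coef_exp -DE mul_polyC lead_coefZ; congr (_ * _).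
  by rewrite lead_coefE size_laD //; exact: sub_coef_top charK D_homog.
have sE : size E = 6%N.
  have := size_exp E 2; rewrite -DE mul_polyC size_scale ?expf_neq0 // size_laD //=.
  by case: (size E) => [|[|[|[|[|[|[|k]]]]]]] //= /eqP; rewrite muln2 -addnn.
have leadEb b : ev b c0 != 0 -> ev b (lead_coef E) != 0.
  move=> cb; have : ev b (lead_coef E ^+ 2) != 0.
    by rewrite leadE mevalM mevalC mulf_neq0 // rmorphXn expf_neq0.
  by rewrite rmorphXn expf_eq0.
have sEb b : ev b c0 != 0 -> size (map_poly (ev b) E) = 6%N.
  by move=> /leadEb lb; rewrite size_map_poly_id0.
(* If [E] has no multiple factor, the Bezout relation between [E] and its derivative survives
   specialisation at a generic [b]. The five distinct roots obtained are zeros of the Hessian on the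
   line, where it is nonzero of degree at most 4. *)
have [co|nco] := boolP (coprimep E E^`()).
  have [[u w] /= uw] := Pdiv.Idomain.Bezout_coprimepP _ _ co.
  have /Pdiv.Idomain.eqpP[[c1 c2] /= /andP[c10 c20] E1] := uw.
  have [b' [Pb cb rb S2]] := pick _ (mulf_neq0 h0 c20).
  set b := M *m b' in Pb cb rb.
  move: Pb; rewrite mevalM mulf_eq0 negb_or => /andP[h1b c2b].
  pose e := map_poly (ev b) E.
  have sep : separable_poly e.
    rewrite unlock; apply/Bezout_eq1_coprimepP.
    exists ((ev b c2)^-1 *: map_poly (ev b) (c1 *: u),
            (ev b c2)^-1 *: map_poly (ev b) (c1 *: w)) => /=.
    rewrite -!scalerAl -scalerDr /e deriv_map -!rmorphM -rmorphD /=.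
    rewrite -!scalerAl -scalerDr E1 map_polyZ rmorph1 scalerA mulVf //.
    by rewrite scale1r.
  have [rs Ers] := closed_field_poly_normal e.
  have e0 : lead_coef e != 0 by rewrite lead_coef_eq0 -size_poly_eq0 sEb.
  have ers : e %= \prod_(z <- rs) ('X - z%:P) by rewrite {1}Ers eqp_scale.
  have urs : uniq rs by rewrite -separable_prod_XsubC -(eqp_separable ers).
  have srs : size rs = 5%N.
    by have := eqp_size ers; rewrite sEb // size_prod_XsubC => -[].
  pose p := map_poly (ev b) (la H1).
  have p0 : p != 0.
    apply: contraNneq h1b => p0; rewrite -[b]add0r -(scale0r a) -ev2la ev2_def.
    by rewrite -/p p0 horner0.
  have := max_poly_roots p0 (rs := rs); rewrite urs srs => H.
  have : (5 < size p)%N.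
    apply: H => //; apply/allP => z zrs.
    have rz : root e z.
      rewrite Ers rootE hornerZ mulf_eq0; apply/orP; right.
      by rewrite -/(root _ _) root_prod_XsubC.
    rewrite /p map_ev_root ev2la; apply/eqP; apply: (hess_root DE ra rb cb S2).
    by apply/eqP; rewrite -map_ev_root.
  rewrite ltnNge => /negP[]; apply: leq_trans (size_poly _ _) _.
  exact: (bihomog_size (sub_bihomog _ _ H1_homog)).
have [g [m [c1 [sg c10 gE]]]] : exists (g m : {poly R}) (c1 : R),
    [/\ (1 < size g)%N, c1 != 0 & c1%:P * E = m * g ^+ 2].
  have nsep : ~~ separable_poly E by rewrite unlock.
  have [[u [v' [uvE nuv]]]|[u [uE su u0]]] : (exists u v', u * v' %| E /\ ~~ coprimep u v')
      \/ (exists u, [/\ u %| E, (1 < size u)%N & u^`() = 0]).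
  - apply: contrapT => /not_orP[n1 n2]; case/negP: nsep; apply/separable_polyP; split.
      by move=> u v' uv; apply: contrapT => /negP nuv; apply: n1; exists u, v'.
    by move=> u uE su; apply/eqP => u0; apply: n2; exists u.
  - have : gcdp u v' ^+ 2 %| E.
      apply: Pdiv.Idomain.dvdp_trans uvE; rewrite expr2.
      apply: Pdiv.Idomain.dvdp_mul; first exact: Pdiv.Idomain.dvdp_gcdl.
      exact: Pdiv.Idomain.dvdp_gcdr.
    have uv0 : gcdp u v' != 0.
      rewrite Pdiv.Idomain.gcdp_eq0; apply: contraTN uvE => /andP[/eqP-> _].
      by rewrite mul0r Pdiv.Idomain.dvd0p -size_poly_eq0 sE.
    rewrite Pdiv.Idomain.dvdp_eq => /eqP e.
    exists (gcdp u v'); eexists; eexists; split; last by rewrite mul_polyC; exact: e.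
      by rewrite ltn_neqAle eq_sym nuv size_poly_gt0.
    by rewrite expf_neq0 // lead_coef_eq0 expf_neq0.
  - by have := poly_deriv0_mpoly charK u0; rewrite leqNgt su.
have nodbl b' s : ev (M *m b') c0 != 0 -> lf r (M *m b') != 0 ->
  (forall Q, Sing X Q -> ~~ (line Q <= <[v]> + <[a']> + <[b']>)%VS) ->
  ev (M *m b') c1 != 0 -> ev2 (M *m b') s g = 0 ->
  [/\ ev (s *: a + M *m b') fL = 0, ev (s *: a + M *m b') fQ = 0,
      ev (s *: a + M *m b') fC = 0 & ev (s *: a + M *m b') fG = 0].
  by move=> cb rb S2 c1b gs; exact: (no_double_root DE ra rb cb S2 gE c1b gs).
(* At a root of the multiple factor [g] over a generic [b] the coefficient L vanishes, so a Bezout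
   relation between [g] and L cannot exist. *)
have [co|nco'] := boolP (coprimep g (la fL)).
  have [[u w] /= uw] := Pdiv.Idomain.Bezout_coprimepP _ _ co.
  have /Pdiv.Idomain.eqpP[[k1 k2] /= /andP[k10 k20] E1] := uw.
  have lg0 : lead_coef g != 0.
    by rewrite lead_coef_eq0 -size_poly_eq0; case: (size g) sg.
  have [b' [Pb cb rb S2]] := pick _ (mulf_neq0 (mulf_neq0 c10 k20) lg0).
  move: Pb; rewrite !mevalM !mulf_eq0 !negb_or => /andP[/andP[c1b k2b] lgb].
  have [s rs] : exists s, root (map_poly (ev (M *m b')) g) s.
    apply: closed_rootP; rewrite size_map_poly_id0 //.
    by case: (size g) sg => [|[]].
  move: rs; rewrite map_ev_root => /eqP gs.
  have [L0 _ _ _] := nodbl b' s cb rb S2 c1b gs.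
  case/eqP: k2b; have := congr1 (ev2 (M *m b') s) E1.
  by rewrite !ev2Z ev2D !ev2M gs ev2la L0 rmorph1 !mulr0 addr0 mulr0 mulr1.
(* The root of L(s a + y) = s L(a) + L(y), a polynomial of degree 1 in s. It is now a root of [g],
   hence of the restrictions of Q, C and G as well. *)
pose st : R := - (ev a fL)^-1 *: fL.
have ev_horn (b : 'cV[K]_n.+1) (q : {poly R}) : ev b q.[st] = ev2 b (ev b st) q.
  by rewrite ev2_def horner_map.
have hL := fhom (isT : 3 <= 4)%N.
have [rL LE] := homog1P hL.
have laLst : (la fL).[st] = 0.
  apply: (mpoly_ev_eq charK) => b; rewrite ev_horn ev2la meval0 /st mevalZ.
  have La' : lf rL a != 0 by rewrite -ev_lin -LE.
  by rewrite LE !ev_lin lfD lfZ; field.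
have sL : size (la fL) = 2%N.
  apply/eqP; rewrite eqn_leq (bihomog_size (sub_bihomog _ _ hL)) /= ltnNge.
  apply/negP => /leq_sizeP/(_ 1%N (leqnn _)); rewrite (sub_coef_top _ _ charK hL).
  by move/eqP; rewrite mpolyC_eq0 (negPf La).
have gst : g.[st] = 0.
  have d0 : gcdp g (la fL) != 0.
    by rewrite Pdiv.Idomain.gcdp_eq0 negb_and -[la _ == 0]size_poly_eq0 sL orbT.
  have : la fL %| g.
    have dl := Pdiv.Idomain.dvdp_gcdr g (la fL).
    have : gcdp g (la fL) %= la fL.
      rewrite -(Pdiv.Idomain.dvdp_size_eqp dl) eqn_leq.
      rewrite Pdiv.Idomain.dvdp_leq -?size_poly_eq0 ?sL //=.
      by rewrite ltn_neqAle eq_sym nco' size_poly_gt0.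
    by move/Pdiv.Idomain.eqp_dvdl => <-; exact: Pdiv.Idomain.dvdp_gcdl.
  rewrite Pdiv.Idomain.dvdp_eq => /eqP /(congr1 (horner^~ st)) /eqP.
  rewrite hornerZ hornerM laLst mulr0 mulf_eq0 expf_eq0 lead_coef_eq0.
  by rewrite -size_poly_eq0 sL andbF => /eqP.
have key (kap : R) : kap \in [:: fQ; fC; fG] -> (la kap).[st] = 0.
  move=> kin; apply/eqP; apply: contraT => k0.
  have [b' [Pb cb rb S2]] := pick _ (mulf_neq0 c10 k0).
  move: Pb; rewrite mevalM mulf_eq0 negb_or => /andP[c1b].
  have gs : ev2 (M *m b') (ev (M *m b') st) g = 0 by rewrite -ev_horn gst meval0.
  have [_ Q0 C0 G0] := nodbl b' _ cb rb S2 c1b gs.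
  rewrite ev_horn ev2la; move: kin; rewrite !inE.
  by case/or3P => /eqP ->; rewrite ?Q0 ?C0 ?G0 eqxx.
have fac (kap : R) : kap \in [:: fQ; fC; fG] -> exists q, kap = q * fL.
  move=> /key k0; have /factor_theorem[q qE] : root (la kap) st by apply/eqP.
  (* At s = 0 the factor s - [st] becomes L(y) / L(a), and the restriction becomes the coefficient
     itself. *)
  exists ((ev a fL)^-1 *: q.[0]).
  have la0 : (la kap).[0] = kap.
    apply: (mpoly_ev_eq charK) => b.
    have -> : ev (b : 'cV[K]_n.+1) (la kap).[0] = ev2 b 0 (la kap).
      by rewrite ev2_def -horner_map /= meval0.
    by rewrite ev2la scale0r add0r.
  rewrite -[LHS]la0 qE hornerM hornerXsubC sub0r /st scaleNr opprK.
  by rewrite -scalerAl -scalerAr.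
have [q2 E2] := fac fQ (mem_head _ _).
have [q1 E1] : exists q, fC = q * fL by apply: fac; rewrite !inE eqxx orbT.
have [q0 E0] : exists q, fG = q * fL by apply: fac; rewrite !inE eqxx !orbT.
pose f' : {poly R} := 'X^3 + q2 *: 'X^2 + q1 *: 'X + q0%:P.
have ff' : fL%:P * f' = 1 * f.
  rewrite mul1r; apply/polyP => i.
  rewrite coefCM /f' !coefD !coefZ coefC coefX !coefXn.
  case: i => [|[|[|[|i]]]] /=; rewrite ?mulr0 ?mulr1 ?addr0 ?add0r //.
  - by rewrite E0 mulrC.
  - by rewrite E1 mulrC.
  - by rewrite E2 mulrC.
  - by rewrite mulr1.
  by rewrite mulr0; symmetry; apply: nth_default; rewrite (size_f f3 f4).
(* Primality of [f] leaves two cases: [f] divides L, impossible by degree in ['X], or L is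
   invertible, impossible since it vanishes at 0. *)
have [[h e]|[h e]] := f_prime charK Mv cv cN MN vcNM ff'.
  have hn0 : h != 0.
    by apply: contraNneq f3 => h00; rewrite -polyC_eq0 e h00 mul0r.
  have := size_polyC_leq1 fL; rewrite e size_mul ?(f_neq0 f3 f4) //.
  rewrite (size_f f3 f4) addnS /=; move: hn0; rewrite -size_poly_gt0.
  by case: (size h) => // k _; rewrite addn3.
have f00 : f != 0 by exact: (f_neq0 f3 f4).
have : fL%:P * h = 1.
  by apply: (mulIf f00); rewrite -mulrA -e ff'.
move/(congr1 (ev2 0 0)); rewrite ev2M ev2C rmorph1.
rewrite -(scale0r 0) (ev_homogZ _ _ hL) expr1 !mul0r => /eqP.
by rewrite eq_sym oner_eq0.
Qed.

End Hessian.

(** * The normal form at a Galois point *)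

Section Forms.
Variables (K : fieldType) (m : nat).
Implicit Types (l r : 'rV[K]_m) (x a : 'cV[K]_m).

Lemma form_kernel l r a : lf l a = 1 -> (forall x, lf l x = 0 -> lf r x = 0) ->
  r = lf r a *: l.
Proof.
move=> la H; apply: lf_eq => x; rewrite lfZl; apply/eqP; rewrite -subr_eq0.
rewrite mulrC -lfZ -lfB; apply/eqP/H.
by rewrite lfB lfZ la mulr1 subrr.
Qed.

Lemma form_mul_eq0 l r a : lf l a = 1 -> (forall x, lf l x * lf r x = 0) -> r = 0.
Proof.
move=> la H; have ra : lf r a = 0 by have := H a; rewrite la mul1r.
apply: lf_eq => x; rewrite [RHS]/lf mul0mx mxE.
have [lx|lx] := eqVneq (lf l x) 0; last first.
  by move/eqP: (H x); rewrite mulf_eq0 (negPf lx) => /eqP.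
by have := H (x + a); rewrite !lfD lx la ra add0r mul1r addr0.
Qed.

(** The kernel of [l] is not the union of two proper subspaces. *)
Lemma form_mul_kernel l r r' a : lf l a = 1 ->
  (forall x, lf l x = 0 -> lf r x * lf r' x = 0) ->
  r = lf r a *: l \/ r' = lf r' a *: l.
Proof.
move=> la H; have [e|] := pselect (forall x, lf l x = 0 -> lf r x = 0).
  by left; exact: form_kernel.
move=> /existsNP[x /not_implyP[lx /eqP rx]]; right; apply: form_kernel => // y ly.
have r'x : lf r' x = 0.
  by move/eqP: (H x lx); rewrite mulf_eq0 (negPf rx) => /eqP.
apply/eqP; apply: contraT => r'y.
have ry : lf r y = 0.
  by move/eqP: (H y ly); rewrite mulf_eq0 (negPf r'y) orbF => /eqP.
have := H (x + y); rewrite !lfD lx ly ry r'x !addr0 add0r => /(_ erefl) /eqP.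
by rewrite mulf_eq0 (negPf rx) (negPf r'y).
Qed.

End Forms.

Section Datum.
Variables (K : fieldType) (m : nat) (F : {mpoly K[m]}).
Hypothesis charK : [pchar K] =i pred0.
Hypothesis F4 : F \is 4.-homog.
Implicit Types (v w x u : 'cV[K]_m) (l L : 'rV[K]_m).

(* Equivalently F = l^3 L + G with G constant along v: the normal form of a
   quartic at an inner Galois point [v]. *)
Definition datum v l L : Prop :=
  [/\ lf l v = 1, lf L v = 0, L != 0 & forall x s,
    ev (x + s *: v) F = ev x F + ((lf l x + s) ^+ 3 - lf l x ^+ 3) * lf L x].

Definition period u : Prop := forall x s, ev (x + s *: u) F = ev x F.

Let nz k : (k.+1%:R : K) != 0.
Proof. by rewrite (natf_eq0 charK). Qed.

Lemma F_0 : ev (0 : 'cV[K]_m) F = 0.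
Proof. by rewrite -(scale0r 0) (ev_homogZ _ _ F4) expr0n mul0r. Qed.

Lemma datum_root v l L : datum v l L -> ev v F = 0.
Proof.
case=> _ _ _ /(_ 0 1); rewrite add0r scale1r F_0 add0r => ->.
by rewrite !lf0 mulr0.
Qed.

Lemma datum_neq0 v l L : datum v l L -> v != 0.
Proof.
by case=> lv _ _ _; apply/eqP => v0; move/eqP: lv; rewrite v0 lf0 eq_sym oner_eq0.
Qed.

Lemma datum_dirD v l L x : datum v l L ->
  ev x (dirD v F) = 3 * lf l x ^+ 2 * lf L x.
Proof.
case=> _ _ _ e; rewrite (@ev_dirD _ charK _ _ _ _ ((ev x F)%:P
   + (((lf l x)%:P + 'X) ^+ 3 - (lf l x)%:P ^+ 3) * (lf L x)%:P)) => [|s].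
  by rewrite !(derivD, derivN, derivM, derivX, derivC) !hornerE /=; ring.
by rewrite e !hornerE /=; ring.
Qed.

Lemma period_dirD u : dirD u F = 0 -> period u.
Proof. by move=> d0 x s; exact: (dirD0_shift charK). Qed.

(** Translation by [u] preserves [F], hence also its increment along [v], which gives [key]. At x =
    0, a nonzero value L(u) would make l(u)^3 equal to both 1 and 0. *)
Lemma period_forms v l L u : datum v l L -> period u -> lf l u = 0 /\ lf L u = 0.
Proof.
move=> [lv Lv L0 e] pu.
have key x s : ((lf l x + lf l u + s) ^+ 3 - (lf l x + lf l u) ^+ 3) *
    (lf L x + lf L u) = ((lf l x + s) ^+ 3 - lf l x ^+ 3) * lf L x.
  have pu1 y : ev (y + u) F = ev y F by have := pu y 1; rewrite scale1r.
  apply: (addrI (ev x F)); transitivity (ev (x + s *: v) F); last exact: e.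
  by rewrite -[in LHS]pu1 -!lfD -e addrAC pu1.
have Lu : lf L u = 0.
  apply/eqP; apply: contraT => Lu0.
  have := key 0 (1 - lf l u); rewrite !lf0 mulr0 !add0r => /eqP.
  rewrite mulf_eq0 (negPf Lu0) orbF addrCA subrr addr0 expr1n subr_eq0 => /eqP e1.
  have := key 0 (- lf l u); rewrite !lf0 mulr0 !add0r subrr => /eqP.
  by rewrite mulf_eq0 (negPf Lu0) orbF expr0n sub0r -e1 oppr_eq0 oner_eq0.
split=> //; have [x Lx] := lf_neq0 L0.
pose y := x - lf l x *: v.
have ly : lf l y = 0 by rewrite lfB lfZ lv mulr1 subrr.
have Ly : lf L y = lf L x by rewrite lfB lfZ Lv mulr0 subr0.
(* On the kernel of [l], the sum of the relations for s = 1 and s = -1 reads 6 l(u) = 0. *)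
have k1 := key y 1; have k2 := key y (-1).
move: k1 k2; rewrite ly Lu addr0 Ly !add0r => /(mulIf Lx) k1 /(mulIf Lx) k2.
apply: (mulfI (nz 5)); rewrite mulr0.
transitivity ((lf l u + 1) ^+ 3 - lf l u ^+ 3 - (1 ^+ 3 - 0 ^+ 3)
  + ((lf l u - 1) ^+ 3 - lf l u ^+ 3 - ((-1) ^+ 3 - 0 ^+ 3))); first by ring.
by rewrite k1 k2 !subrr addr0.
Qed.

(* The shape of [(l', L')] forced by [D_v D_v' F = D_v' D_v F] when the forms
   of the two points span the same plane. *)
Definition linked v l L v' l' L' : Prop :=
  [/\ lf l v' != 0, lf L v' != 0,
    forall x, lf l' x = lf l x / (3 * lf l v') + 2 * lf L x / (3 * lf L v') &
    forall x, lf L' x = 3 * lf l v' ^+ 2 * (lf L v' * lf l x - lf l v' * lf L x)].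

Section Pair.
Hypothesis nondeg : forall u, period u -> u = 0.
Variables (v1 v2 : 'cV[K]_m) (l1 L1 l2 L2 : 'rV[K]_m).
Hypotheses (d1 : datum v1 l1 L1) (d2 : datum v2 l2 L2).
Hypothesis v12 : forall k, v1 != k *: v2.
Local Notation p := (lf l1 v2).
Local Notation q := (lf L1 v2).
Local Notation p' := (lf l2 v1).
Local Notation q' := (lf L2 v1).

Lemma second_derivative x :
  lf l1 x * lf (2 * p *: L1 + q *: l1) x = lf l2 x * lf (2 * p' *: L2 + q' *: l2) x.
Proof.
have gen v w l L : datum v l L ->
    ev x (dirD w (dirD v F)) = 3 * (lf l x * lf (2 * lf l w *: L + lf L w *: l) x).
  move=> d; rewrite (@ev_dirD _ charK _ _ _ _
    (3 * ((lf l x)%:P + (lf l w) *: 'X) ^+ 2 * ((lf L x)%:P + (lf L w) *: 'X))).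
    have n3 : (3%:R : {poly K}) = 3%:R%:P by rewrite polyC_natr.
    rewrite n3 !(derivD, derivN, derivM, derivX, derivZ, derivC) !hornerE /=.
    by rewrite lfDl !lfZl; ring.
  move=> s; rewrite (datum_dirD _ d) !lfD !lfZ !hornerE /=.
  by ring.
apply: (mulfI (nz 2)); rewrite -(gen _ _ _ _ d1) -(gen _ _ _ _ d2).
by rewrite dirD_comm.
Qed.

(** On the kernel of [l1] the product of [l2] and [m2] vanishes, so one of them is a multiple of
    [l1]. If [l2] is, so is [L1] of [L2], and [v1 - p' *: v2] is a period, hence 0, against [v12].
    Otherwise m1 = k l2 and m2 = k l1 with one constant [k]: k = 0 gives the first alternative, and
    k nonzero can be solved for [l2] and [L2]. *)
Lemma datum_pair :
  [/\ p = 0, q = 0, p' = 0 & q' = 0] \/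
  linked v1 l1 L1 v2 l2 L2.
Proof.
have [l1v1 L1v1 L10 e1] := d1; have [l2v2 L2v2 L20 e2] := d2.
have S := second_derivative.
set m1 := 2 * p *: L1 + q *: l1 in S; set m2 := 2 * p' *: L2 + q' *: l2 in S.
have m1v1 : lf m1 v1 = q by rewrite lfDl !lfZl l1v1 L1v1; ring.
have m1v2 : lf m1 v2 = 3 * p * q by rewrite lfDl !lfZl; ring.
have m2v1 : lf m2 v1 = 3 * p' * q' by rewrite lfDl !lfZl; ring.
have m2v2 : lf m2 v2 = q' by rewrite lfDl !lfZl l2v2 L2v2; ring.
have [|e|e] := @form_mul_kernel _ _ l1 l2 m2 v1 l1v1.
- by move=> x lx; rewrite -S lx mul0r.
- have el x : lf l2 x = p' * lf l1 x by rewrite {1}e lfZl.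
  have pp : p' * p = 1 by rewrite -el.
  have p'0 : p' != 0 by apply: contra_eq_neq pp => ->; rewrite mul0r eq_sym oner_eq0.
  have m12 : m1 = p' *: m2.
    apply/eqP; rewrite -subr_eq0; apply/eqP.
    apply: (@form_mul_eq0 _ _ l1 _ v1 l1v1) => x.
    by rewrite lfDl -scaleN1r !lfZl mulrDr S (el x); ring.
  have E1 : q = 3 * p' ^+ 2 * q' by rewrite -m1v1 m12 lfZl m2v1; ring.
  have E2 : 3 * p * q = p' * q' by rewrite -m1v2 m12 lfZl m2v2.
  have q'0 : q' = 0.
    have : 8 * (p' * q') = 0.
      have E3 : 9 * (p' * p) * (p' * q') = p' * q' by rewrite -[RHS]E2 E1; ring.
      transitivity (9 * (p' * p) * (p' * q') - p' * q'); first by rewrite pp; ring.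
      by rewrite E3 subrr.
    by move/eqP; rewrite !mulf_eq0 (negPf (nz 7)) (negPf p'0) /= => /eqP.
  have q0 : q = 0 by rewrite E1 q'0 mulr0.
  have LL x : lf L1 x = p' ^+ 3 * lf L2 x.
    have /(congr1 (fun r => lf r x)) := m12.
    rewrite /m1 /m2 q0 q'0 !scale0r !addr0 !lfZl => E.
    apply: (mulfI (nz 1)); transitivity (p' * (2 * p * lf L1 x)).
      by rewrite -[LHS]mul1r -pp; ring.
    by rewrite E; ring.
  have pd : period (v1 - p' *: v2).
    apply: period_dirD; apply: (mpoly_ev_eq charK) => x.
    rewrite -scaleN1r dirDl !dirDZl meval0 mevalD !mevalZ.
    by rewrite (datum_dirD x d1) (datum_dirD x d2) (LL x) (el x); ring.
  by have := nondeg pd; move/eqP; rewrite subr_eq0 (negPf (v12 _)).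
set k := lf m2 v1 in e; have m1k x : lf m1 x = k * lf l2 x.
  have : m1 - k *: l2 = 0.
    apply: (@form_mul_eq0 _ _ l1 _ v1 l1v1) => y.
    by rewrite lfDl -scaleN1r !lfZl mulrDr S {1}e lfZl; ring.
  by move/eqP; rewrite subr_eq0 => /eqP ->; rewrite lfZl.
have m2k x : lf m2 x = k * lf l1 x by rewrite {1}e lfZl.
have kE : k = 3 * p' * q' by [].
have kE' : k = 3 * p * q by rewrite -m1v2 m1k l2v2 mulr1.
have [k0|k0] := eqVneq k 0.
  left; have q0 : q = 0 by rewrite -m1v1 m1k k0 mul0r.
  have q'0 : q' = 0 by rewrite -m2v2 m2k k0 mul0r.
  have van r s L : L != 0 -> (forall x, lf (2 * r *: L + s *: l1) x = 0) -> s = 0 -> r = 0.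
    move=> /lf_neq0[x Lx] H s0; move/eqP: (H x).
    rewrite s0 scale0r addr0 lfZl !mulf_eq0 (negPf Lx) orbF (negPf (nz 1)) /=.
    by move/eqP.
  split=> //; first by apply: van L10 _ q0 => x; rewrite -/m1 m1k k0 mul0r.
  apply: (van p' q' L2 L20) => // x; have := m2k x.
  by rewrite k0 mul0r /m2 q'0 !scale0r !addr0.
right; move: (k0); rewrite kE' !mulf_eq0 !negb_or => /andP[/andP[_ p0] q0].
move: (k0); rewrite kE !mulf_eq0 !negb_or => /andP[/andP[_ p'0] q'0].
have E1 x : lf l2 x = lf l1 x / (3 * p) + 2 * lf L1 x / (3 * q).
  apply: (mulfI k0); rewrite -m1k kE' /m1 lfDl !lfZl.
  by field; rewrite (nz 2) p0 q0.
have p'E : p' = 1 / (3 * p) by rewrite E1 l1v1 L1v1; field; rewrite (nz 2) p0 q0.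
have q'E : q' = 3 * p ^+ 2 * q.
  apply: (mulfI (mulf_neq0 (nz 2) p'0)); rewrite -kE kE' p'E.
  by field; rewrite (nz 2) p0.
split=> // x; have := m2k x; rewrite /m2 lfDl !lfZl (E1 x) p'E q'E kE'.
move=> E; apply: (mulfI (nz 1)); apply: (mulIf (x := 1 / (3 * p))).
  by rewrite mulf_neq0 ?oner_eq0 // invr_eq0 mulf_neq0 ?(nz 2).
transitivity (3 * p * q * lf l1 x - 3 * p ^+ 2 * q *
    (lf l1 x / (3 * p) + 2 * lf L1 x / (3 * q))).
  by rewrite -E; field; rewrite (nz 2) p0 q0.
by field; rewrite (nz 2) p0 q0.
Qed.

End Pair.

Section Class.
Variables (v1 v2 : 'cV[K]_m) (l1 L1 l2 L2 : 'rV[K]_m).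
Hypotheses (d1 : datum v1 l1 L1) (d2 : datum v2 l2 L2).
Hypothesis link : linked v1 l1 L1 v2 l2 L2.
Local Notation p := (lf l1 v2).
Local Notation q := (lf L1 v2).

Definition block_form k x : K := lf l1 x ^+ 3 * lf L1 x - k * lf L1 x ^+ 4.

(** The constant is the one for which the block form vanishes at [v2], as [F] does. Along [v1] any
    constant would do, since [L1] is zero at [v1]. *)
Lemma block_shift x s : ev (x + s *: v2) F =
  ev x F + block_form ((p / q) ^+ 3) (x + s *: v2) - block_form ((p / q) ^+ 3) x.
Proof.
have [p0 q0 E1 E2] := link; have [_ _ _ e2] := d2.
rewrite e2 E1 E2 /block_form !lfD !lfZ.
by field; rewrite (nz 2) p0 q0.
Qed.

Lemma block_coef_neq0 : (p / q) ^+ 3 != 0.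
Proof. by have [p0 q0 _ _] := link; rewrite expf_neq0 // mulf_neq0 ?invr_eq0. Qed.

Lemma block_shift1 k x s : ev (x + s *: v1) F =
  ev x F + block_form k (x + s *: v1) - block_form k x.
Proof.
have [lv Lv _ e1] := d1.
by rewrite e1 /block_form !lfD !lfZ lv Lv; ring.
Qed.

Hypothesis nondeg : forall u, period u -> u = 0.

(** Let r be the part of [v3] left after matching [l1] and [L1] on the plane of [v1] and [v2]. All
    the forms vanish at r, so g = D_r F is constant along [v1] and [v2]. By the links g depends only
    on [l1] and [L1], whose values are all attained on that plane, so g = g(0) = 0. Thus r is a
    period. *)
Lemma class_span v3 l3 L3 : datum v3 l3 L3 -> linked v1 l1 L1 v3 l3 L3 ->
  exists a b, v3 = a *: v1 + b *: v2.
Proof.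
move=> d3 link3; have [p0 q0 E1 E2] := link; have [p30 q30 F1 F2] := link3.
have [lv Lv _ _] := d1.
pose b := lf L1 v3 / q; pose a := lf l1 v3 - b * p; exists a, b.
pose r := v3 - (a *: v1 + b *: v2).
have lr : lf l1 r = 0 by rewrite /r /a lfB lfD !lfZ lv; ring.
have Lr : lf L1 r = 0 by rewrite /r /b lfB lfD !lfZ Lv; field.
have l2r : lf l2 r = 0 by rewrite E1 lr Lr; ring.
have L2r : lf L2 r = 0 by rewrite E2 lr Lr; ring.
pose g := dirD r F.
have killed v l L : datum v l L -> lf l r = 0 -> lf L r = 0 -> dirD v g = 0.
  move=> d lr0 Lr0; rewrite /g dirD_comm; apply: (mpoly_ev_eq charK) => x.
  rewrite meval0 (@ev_dirD _ charK _ _ _ _ (ev x (dirD v F))%:P) => [|s].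
    by rewrite derivC horner0.
  by rewrite hornerC !(datum_dirD _ d) !lfD !lfZ lr0 Lr0 !mulr0 !addr0.
have gE x : ev x g = 3 * lf l3 x ^+ 2 * lf L3 x - (a * (3 * lf l1 x ^+ 2 * lf L1 x)
    + b * (3 * lf l2 x ^+ 2 * lf L2 x)).
  rewrite /g /r -scaleN1r !(dirDl, dirDZl) !(mevalD, mevalZ).
  by rewrite (datum_dirD x d1) (datum_dirD x d2) (datum_dirD x d3); ring.
have g0 : g = 0.
  apply: (mpoly_ev_eq charK) => x; rewrite meval0.
  pose b' := lf L1 x / q; pose a' := lf l1 x - b' * p.
  have lu : lf l1 (0 + a' *: v1 + b' *: v2) = lf l1 x.
    by rewrite !lfD lf0 !lfZ lv /a'; ring.
  have Lu : lf L1 (0 + a' *: v1 + b' *: v2) = lf L1 x.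
    by rewrite !lfD lf0 !lfZ Lv /b'; field.
  transitivity (ev (0 + a' *: v1 + b' *: v2) g).
    by rewrite !gE !F1 !F2 !E1 !E2 lu Lu.
  rewrite (dirD0_shift charK _ _ (killed _ _ _ d2 l2r L2r)).
  rewrite (dirD0_shift charK _ _ (killed _ _ _ d1 lr Lr)) gE !lf0.
  by ring.
by have /eqP := nondeg (period_dirD g0); rewrite subr_eq0 => /eqP.
Qed.

(** Both [F] at the new point and [F] at [v2] are 0; expanding from [b *: v2] along [v1] gives (b p
    + a)^3 = (b p)^3. The three possible ratios a / b include 0, that of [v2] itself. *)
Lemma class_root a b l3 L3 : datum (a *: v1 + b *: v2) l3 L3 -> b != 0 ->
  (a / b + p) ^+ 3 = p ^+ 3.
Proof.
move=> d3 b0; have [p0 q0 _ _] := link; have [_ _ _ e1] := d1.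
have := datum_root d3; rewrite addrC e1 (ev_homogZ _ _ F4) (datum_root d2).
rewrite mulr0 add0r !lfZ => /eqP; rewrite !mulf_eq0 (negPf b0) (negPf q0) !orbF.
rewrite subr_eq0 => /eqP e; apply: (mulfI (expf_neq0 3 b0)).
transitivity ((b * p + a) ^+ 3); first by field.
by rewrite e; ring.
Qed.

End Class.
End Datum.

Lemma lf_mulmx (K : fieldType) m r (l : 'rV[K]_r) (M : 'M[K]_(r, m)) x :
  lf (l *m M) x = lf l (M *m x).
Proof. by rewrite /lf mulmxA. Qed.

Lemma dual_form (K : fieldType) m (v : 'cV[K]_m) : v != 0 ->
  exists c : 'rV[K]_m, c *m v = 1%:M.
Proof.
move=> v0; have [i vi] : exists i, v i 0 != 0.
  apply: contrapT => H; case/eqP: v0; apply/colP => i; rewrite [RHS]mxE.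
  by apply/eqP; apply: contrapT => /negP h; apply: H; exists i.
exists ((v i 0)^-1 *: delta_mx 0 i); apply/matrixP => j k; rewrite !ord1.
by rewrite -scalemxAl -rowE [LHS]mxE [X in _ * X]mxE [RHS]mxE mulVf // eqxx.
Qed.

Lemma lfE (K : fieldType) m (l : 'rV[K]_m) x : l *m x = (lf l x)%:M.
Proof. by apply/matrixP => i j; rewrite !ord1 [RHS]mxE eqxx mulr1n. Qed.

Lemma projection_matrix (K : fieldType) n (v : 'cV[K]_n.+2) : v != 0 ->
  exists M : 'M[K]_(n.+1, n.+2), \rank M = n.+1 /\ M *m v = 0.
Proof.
move=> v0; have rv : \rank v = 1%N.
  apply/eqP; rewrite eqn_leq rank_leq_col lt0n mxrank_eq0 //.
have : exists M : 'M[K]_(\rank (kermx v), n.+2),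
    \rank M = \rank (kermx v) /\ M *m v = 0.
  exists (row_base (kermx v)); split; first by rewrite eq_row_base.
  by apply/sub_kermxP; rewrite eq_row_base.
by rewrite mxrank_ker rv subn1.
Qed.

(** Write y = l(y) a + y' with l(y') = 0 and expand in powers of l(y): the constant term Q(y')
    vanishes and l(y) factors out. *)
Lemma linear_divides_quadric (K : fieldType) m (charK : [pchar K] =i pred0)
    (Q : {mpoly K[m]}) (l : 'rV[K]_m) :
  Q \is 2.-homog -> l != 0 -> (forall y, lf l y = 0 -> ev y Q = 0) ->
  exists r, forall y : 'cV[K]_m, ev y Q = lf l y * lf r y.
Proof.
move=> hQ l0 H; have [a0 la0] := lf_neq0 l0.
pose a := (lf l a0)^-1 *: a0; have la : lf l a = 1 by rewrite lfZ mulVf.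
clearbody a.
have bq := sub_bihomog a (1%:M : 'M[K]_m) hQ; set q := sub a _ Q in bq.
have [r1 r1E] : exists r, q`_1 = lin r by apply: (homog1P (bq 1%N)).
pose r := r1 - lf r1 a *: l + ev a Q *: l; exists r => y.
have rE z : lf r z = lf r1 z - lf r1 a * lf l z + ev a Q * lf l z.
  by rewrite /r !lfDl lfZl -scaleN1r !lfZl; ring.
pose y' := y - lf l y *: a.
have ly' : lf l y' = 0 by rewrite lfB lfZ la mulr1 subrr.
have yE : y = lf l y *: a + y' by rewrite addrC subrK.
clearbody y' r; rewrite yE; move: (lf l y) => k {yE}.
have line t : ev (t *: a + y') Q = t * lf r1 y' + t ^+ 2 * ev a Q.
  have := sub_ev a (1%:M : 'M[K]_m) Q y' t; rewrite mul1mx -/q => <-.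
  have q0 : ev y' q`_0 = 0.
    have <- : ev2 y' 0 q = ev y' q`_0.
      by rewrite ev2_def horner_coef0 coef_map.
    by rewrite sub_ev scale0r add0r mul1mx H.
  have q2 : q`_2 = (ev a Q)%:MP by exact: sub_coef_top.
  have sq : (size (map_poly (ev y') q) <= 3)%N.
    by apply: leq_trans (size_poly _ _) (bihomog_size bq).
  rewrite ev2_def (horner_coef_wide _ sq) !big_ord_recr big_ord0 /= !coef_map /=.
  by rewrite q0 q2 mevalC r1E ev_lin; ring.
by rewrite line rE !(lfD, lfZ) la ly'; ring.
Qed.

(** * Galois points and normal forms *)

Section GaloisPoints.
Variables (K : closedFieldType) (n : nat) (X : hypersurface K n 4).
Hypothesis charK : [pchar K] =i pred0.
Let X4 : (Defs.eqn X) \is 4.-homog := eqn_homog X.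

Lemma datum_Delta P v l L : line P = <[v]>%VS -> datum X v l L -> Delta X P.
Proof.
move=> Pv d; have v0 := datum_neq0 d; have [lv Lv L0 e] := d.
have PX : points X P.
  by apply/(vanishes_gen X4 Pv); exact: datum_root d.
have sm : smooth_locus X P.
  split=> // -[_ dX]; have [u Lu] := lf_neq0 L0.
  have : ev v (dirD u X) = 0.
    rewrite /dirD raddf_sum big1 // => i _ /=; rewrite mevalZ.
    have hi : X^`M(i) \is 3.-homog by rewrite -dirD_delta; exact: dirD_homog X4.
    by have [-> //] := vanishes_gen hi Pv; rewrite mulr0.
  (* The normal form shows that the differential of [F] at [v] is [L], which is nonzero. *)
  rewrite (@ev_dirD _ charK _ _ _ _ ((ev u X) *: 'X^4 +
    ((lf l u *: 'X + 1%:P) ^+ 3 - (lf l u *: 'X) ^+ 3) * (lf L u *: 'X))) => [|s].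
    rewrite !(derivD, derivN, derivM, derivX, derivZ, derivC) !hornerE /=.
    by move=> H; case/eqP: Lu; rewrite -[RHS]H; ring.
  rewrite addrC -[v in s *: u + v]scale1r e (ev_homogZ _ _ X4) !lfZ !hornerE /=.
  by ring.
split=> //; split; first by left.
have [M [rM Mv]] := projection_matrix v0.
exists M; split.
  by split=> // x; rewrite Pv => /vlineP[k ->]; rewrite -scalemxAr Mv scaler0.
(* With [l] itself as the coordinate dual to [v], the equation has no quadratic and no linear
   term. *)
have cv : l *m v = 1%:M by rewrite lfE lv.
have [N [cN MN vcNM]] := projection_coords rM Mv cv.
have fE : sub v N X = (lin (L *m N))%:P * 'X^3 + (lin_subst N X)%:P.
  apply: (polympoly_ev_eq charK) => u s.
  rewrite sub_ev ev2D ev2M !ev2C rmorphXn /= ev2X ev_lin ev_lin_subst addrC e.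
  have -> : lf l (N *m u) = 0 by rewrite -lf_mulmx cN /lf mul0mx mxE.
  by rewrite lf_mulmx; ring.
have [u Lu] := lf_neq0 L0.
have f3 : (sub v N X)`_3 != 0.
  rewrite fE coefD coefCM coefXn coefC /= mulr1 addr0.
  apply: contraNneq Lu => e0; apply/eqP; have := congr1 (ev (M *m u)) e0.
  rewrite ev_lin meval0 lf_mulmx mulmxA => E; rewrite -[RHS]E.
  have -> : N *m M = 1%:M - v *m l by rewrite -vcNM addrC addKr.
  rewrite mulmxBl mul1mx lfB -mulmxA (lfE l u) mul_mx_scalar lfZ Lv mulr0 subr0.
  by [].
have f4 : (sub v N X)`_4 = 0.
  by rewrite fE coefD coefCM coefXn coefC /= mulr0 addr0.
have [t tE] := gen_exists charK Mv cv cN MN vcNM f3 f4.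
apply: (kummer_galois_pullback charK Mv cv cN MN vcNM f3 f4 tE).
  by rewrite fE coefD coefCM coefXn coefC /= mulr0 addr0.
by rewrite fE coefD coefCM coefXn coefC /= mulr0 addr0.
Qed.

Hypothesis n_ge1 : (1 <= n)%N.
Hypothesis sX : dim_le (Sing X) (n%:Z - 2).

(** The coefficient of degree 3 is the differential of the equation at [v], so smoothness makes it
    nonzero. *)
Lemma tangent_coef_neq0 P (v : 'cV[K]_n.+2) (c : 'rV[K]_n.+2)
    (M : 'M[K]_(n.+1, n.+2)) (N : 'M[K]_(n.+2, n.+1)) : smooth_locus X P -> line P = <[v]>%VS ->
  v *m c + N *m M = 1%:M -> (sub v N (Defs.eqn X))`_4 = 0 ->
  (sub v N (Defs.eqn X))`_3 != 0.
Proof.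
move=> [PX nS] Pv vcNM f4; apply/eqP => f3; apply: nS; split=> // i.
have Xv : ev v X = 0 by apply/(vanishes_gen X4 Pv).
have hi : X^`M(i) \is 3.-homog by rewrite -dirD_delta; exact: dirD_homog X4.
apply/(vanishes_gen hi Pv); rewrite -dirD_delta; move: (delta_mx i 0) => w.
rewrite (decompose vcNM w) dirDl dirDZl mevalD mevalZ (euler charK v X4) Xv.
rewrite !mulr0 add0r; move: (M *m w) => u; set f := sub v N X.
have hf := sub_bihomog v N X4.
rewrite (@ev_dirD _ charK _ _ _ _
    (ev u f`_0 *: 'X^4 + ev u f`_1 *: 'X^3 + ev u f`_2 *: 'X^2)) => [|s].
  by rewrite !(derivD, derivZ, derivXn) !hornerE /=; ring.
have := sub_ev v N X (s *: u) 1; rewrite scale1r -scalemxAr => <-; rewrite -/f.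
have sf : (size (map_poly (ev (s *: u)) f) <= 5)%N.
  by apply: leq_trans (size_poly _ _) (bihomog_size hf).
rewrite ev2_def (horner_coef_wide _ sf) !big_ord_recr big_ord0 /= !coef_map /=.
rewrite f3 f4 !meval0 (ev_homogZ _ _ (hf 0%N)) (ev_homogZ _ _ (hf 1%N)).
by rewrite (ev_homogZ _ _ (hf 2%N)) !hornerE /=; ring.
Qed.

Lemma Delta_datum P : Delta X P ->
  exists v l L, line P = <[v]>%VS /\ datum X v l L.
Proof.
move=> [[_ [M [[rM kM] gal]]] sm]; have [v v0 Pv] := point_gen P.
have Mv : M *m v = 0 by apply: kM; rewrite Pv memv_line.
have [c cv] := dual_form v0.
have [N [cN MN vcNM]] := projection_coords rM Mv cv.
have Xv : ev v X = 0 by apply/(vanishes_gen X4 Pv); case: sm.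
have f4 : (sub v N (Defs.eqn X))`_4 = 0 by rewrite (sub_coef_top _ _ charK X4) Xv mpolyC0.
have f3 := tangent_coef_neq0 sm Pv vcNM f4.
have [t tE] := gen_exists charK Mv cv cN MN vcNM f3 f4.
have [D0 [A [B [B0 DAB]]]] := galois_disc_fraction charK Mv cv cN MN vcNM f3 f4 tE gal.
have Pns Q : Sing X Q -> ~~ (line Q <= <[v]>)%VS.
  move=> SQ; apply/negP => le; case: sm => _; apply; suff <- : Q = P by [].
  by apply: val_inj; apply/eqP; rewrite /= -dimv_leqif_eq ?Pv // -Pv !(eqP (line_dim _)).
have := hess_zero_of_square charK n_ge1 Mv cv cN MN vcNM f3 f4 sX Pns D0 B0 DAB.
clear t tE D0 A B B0 DAB gal; rewrite /hess3.
have hf := sub_bihomog v N X4; set f := sub v N X in hf f3 f4 *.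
have [rL rLE] : exists r, f`_3 = lin r by apply: homog1P; exact: (hf 3%N).
have rL0 : rL != 0.
  by apply: contraNneq f3 => r0; rewrite rLE r0 /lin big1 // => i _; rewrite mxE scale0r.
have [y0 Ly0] := lf_neq0 rL0.
move=> H; have H1 (y : 'cV[K]_n.+1) : ev y f`_2 ^+ 2 = 3 * lf rL y * ev y f`_1.
  have := congr1 (ev y) H; rewrite -mulrA mulr_natl mevalB rmorphXn rmorphMn /=.
  rewrite mevalM rLE ev_lin meval0 -mulr_natl => /eqP.
  by rewrite subr_eq0 mulrA => /eqP.
have [|r rE] := linear_divides_quadric charK (hf 2%N) rL0.
  by move=> y ry; apply/eqP; rewrite -sqrf_eq0 H1 ry mulr0 mul0r.
have n3 : (3 : K) != 0 by rewrite (natf_eq0 charK).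
have CE (y : 'cV[K]_n.+1) : 3 * ev y f`_1 = lf rL y * lf r y ^+ 2.
  have : (3%:R *: f`_1 - lin rL * lin r ^+ 2) = 0.
    apply: (mulfI (x := f`_3)) => //; rewrite mulr0.
    apply: (mpoly_ev_eq charK) => z; rewrite meval0 mevalM mevalB mevalZ mevalM.
    rewrite rmorphXn /= rLE !ev_lin mulrBr.
    transitivity (3 * lf rL z * ev z f`_1 - (lf rL z * lf r z) ^+ 2); first by ring.
    by rewrite -H1 rE subrr.
  move/(congr1 (ev y)); rewrite meval0 mevalB mevalZ mevalM rmorphXn /= !ev_lin.
  by move/eqP; rewrite subr_eq0 => /eqP.
(* Completing the cube: Q = L r and 3 C = L r^2, so the terms divisible by x are those of L (x + r /
   3)^3. *)
exists v, (c + 3^-1 *: (r *m M)), (rL *m M); split=> //; split.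
- by rewrite lfDl lfZl lf_mulmx Mv lf0 mulr0 addr0 /lf cv mxE.
- by rewrite lf_mulmx Mv lf0.
- apply: contra_neq Ly0 => e; have <- : M *m (N *m y0) = y0 by rewrite mulmxA MN mul1mx.
  by rewrite -lf_mulmx e /lf mul0mx mxE.
move=> x s; rewrite lfDl lfZl !lf_mulmx.
move: (lf c x) (M *m x) (decompose vcNM x) => k y ->.
rewrite addrAC -scalerDl !(ev_coords f3 f4) -/f rLE ev_lin rE.
have -> : ev y f`_1 = 3^-1 * (lf rL y * lf r y ^+ 2) by rewrite -CE mulKf.
by field.
Qed.

End GaloisPoints.

(** * Counting Galois points *)

Section DualSystem.
Variables (K : fieldType) (m : nat).
Implicit Types (d e : 'cV[K]_m * 'rV[K]_m) (ds : seq ('cV[K]_m * 'rV[K]_m)).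

Definition orthogonal_pairs d e := (lf d.2 e.1 == 0) && (lf e.2 d.1 == 0).

(** The forms certify the independence of the vectors and supply the coordinates on their span. *)
Definition dual_system ds :=
  all (fun d => lf d.2 d.1 == 1) ds && pairwise orthogonal_pairs ds.

Lemma dual_system_cat ds ds' : dual_system (ds ++ ds') =
  [&& dual_system ds, dual_system ds' & allrel orthogonal_pairs ds ds'].
Proof.
rewrite /dual_system all_cat pairwise_cat.
by case: all; case: all; case: pairwise; case: pairwise; case: allrel.
Qed.

Lemma dual_system_matrix ds : dual_system ds ->
  exists (A : 'M[K]_(size ds, m)) (B : 'M[K]_(m, size ds)), [/\ A *m B = 1%:M,
    forall x, B *m (A *m x) = \sum_(d <- ds) lf d.2 x *: d.1 &
    forall L, (forall d, d \in ds -> lf L d.1 = 0) -> L *m B = 0].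
Proof.
case/andP=> /allP un pw; pose x0 : 'cV[K]_m * 'rV[K]_m := (0, 0).
exists (\matrix_(a, j) (nth x0 ds a).2 0 j), (\matrix_(i, a) (nth x0 ds a).1 i 0).
split.
- apply/matrixP => a b; rewrite !mxE; transitivity (lf (nth x0 ds a).2 (nth x0 ds b).1).
    by rewrite /lf mxE; apply: eq_bigr => i _; rewrite !mxE.
  have [<-|ab] := eqVneq a b; first by apply/eqP/un/mem_nth.
  move/(pairwiseP x0): pw => pw.
  have [lt|lt|e] := ltngtP a b; last by move/eqP: ab; case; exact: val_inj.
    by have /andP[/eqP] := pw _ _ (ltn_ord a) (ltn_ord b) lt.
  by have /andP[_ /eqP] := pw _ _ (ltn_ord b) (ltn_ord a) lt.
- move=> x; rewrite (big_nth x0) big_mkord; apply/matrixP => i j; rewrite !ord1.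
  rewrite [LHS]mxE summxE; apply: eq_bigr => a _; rewrite [RHS]mxE [RHS]mulrC.
  rewrite [X in X * _]mxE; congr (_ * _).
  by rewrite /lf !mxE; apply: eq_bigr => k _; rewrite [X in X * _]mxE.
move=> L H; apply/matrixP => i a; rewrite !ord1 [RHS]mxE.
rewrite -(H (nth x0 ds a)) ?mem_nth // /lf !mxE.
by apply: eq_bigr => k _; rewrite [X in _ * X]mxE.
Qed.

Lemma dual_system_size ds : dual_system ds -> (size ds <= m)%N.
Proof.
case/dual_system_matrix=> A [B [AB _ _]].
by have := mulmx1_min AB.
Qed.

Lemma dual_system_lt ds (L : 'rV[K]_m) : dual_system ds -> L != 0 ->
  (forall d, d \in ds -> lf L d.1 = 0) -> (size ds < m)%N.
Proof.
case/dual_system_matrix=> A [B [AB _ kB]] L0 /kB LB.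
have rB : \rank B = size ds.
  apply/eqP; rewrite eqn_leq rank_leq_col -{1}(mxrank1 K (size ds)) -AB.
  exact: mxrankM_maxr.
have := mulmx0_rank_max LB; rewrite rB; apply: leq_trans.
by rewrite -add1n leq_add2r lt0n mxrank_eq0.
Qed.

Lemma dual_system_complement ds : dual_system ds -> (m <= (size ds).+1)%N ->
  exists (g : 'rV[K]_m) (e : 'cV[K]_m), (size ds = m -> g = 0) /\
    forall x, x = \sum_(d <- ds) lf d.2 x *: d.1 + lf g x *: e.
Proof.
case/dual_system_matrix=> A [B [AB BA _]] le.
(* The projection along the span of the vectors. Its rank is at most 1, and a rank factorisation
   provides [g] and [e]. *)
pose E := 1%:M - B *m A.
have EB : E *m B = 0 by rewrite mulmxBl mul1mx -mulmxA AB mulmx1 subrr.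
have rB : \rank B = size ds.
  apply/eqP; rewrite eqn_leq rank_leq_col -{1}(mxrank1 K (size ds)) -AB.
  exact: mxrankM_maxr.
have := mulmx0_rank_max EB; rewrite rB => rE.
have [r [C [R [CR]]]] : exists r (C : 'M[K]_(m, r)) (R : 'M[K]_(r, m)),
    C *m R = E /\ (r + size ds <= m)%N.
  by exists (\rank E), (col_base E), (row_base E); rewrite mulmx_base.
have xE (x : 'cV[K]_m) : x = B *m (A *m x) + E *m x.
  by rewrite mulmxBl mul1mx mulmxA addrC subrK.
case: r C R CR => [|[|r]] C R CR sr.
- exists 0, 0; split=> // x; rewrite scaler0 addr0 -BA {1}(xE x) -CR.
  by rewrite [C]thinmx0 mul0mx mul0mx addr0.
- exists R, C; split=> [e|x]; first by move: sr; rewrite e; lia.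
  rewrite -BA {1}(xE x) -CR; congr (_ + _); rewrite -mulmxA.
  by rewrite lfE mul_mx_scalar.
by move: sr le; lia.
Qed.

End DualSystem.

(** * Classes of Galois points *)

Section Blocks.
Variables (K : fieldType) (m : nat) (F : {mpoly K[m]}).
Hypothesis charK : [pchar K] =i pred0.
Hypothesis F4 : F \is 4.-homog.
Hypothesis nondeg : forall u, period F u -> u = 0.
Variables (I : eqType) (s : seq I) (v : I -> 'cV[K]_m) (l L : I -> 'rV[K]_m).
Hypothesis data : {in s, forall i, datum F (v i) (l i) (L i)}.
Hypothesis prop : {in s &, forall i j, i != j -> forall k, v i != k *: v j}.

(** By [datum_pair] this single value decides between the two alternatives. *)
Definition related i j := (i == j) || (lf (L i) (v j) != 0).

Let pair i j : i \in s -> j \in s -> i != j ->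
  [/\ lf (l i) (v j) = 0, lf (L i) (v j) = 0, lf (l j) (v i) = 0 &
      lf (L j) (v i) = 0] \/ linked (v i) (l i) (L i) (v j) (l j) (L j).
Proof.
by move=> si sj ij; exact: (datum_pair charK nondeg (data si) (data sj) (prop si sj ij)).
Qed.

Lemma related_linked i j : i \in s -> j \in s -> i != j -> related i j ->
  linked (v i) (l i) (L i) (v j) (l j) (L j).
Proof.
move=> si sj ij; rewrite /related (negPf ij) /=.
by have [[_ ->]|//] := pair si sj ij; rewrite eqxx.
Qed.

Lemma unrelated i j : i \in s -> j \in s -> ~~ related i j ->
  [/\ lf (l i) (v j) = 0, lf (L i) (v j) = 0, lf (l j) (v i) = 0 &
      lf (L j) (v i) = 0].
Proof.
move=> si sj; rewrite negb_or negbK => /andP[ij /eqP Lij].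
by have [//|[_]] := pair si sj ij; rewrite Lij eqxx.
Qed.

Lemma related_sym i j : i \in s -> j \in s -> related i j = related j i.
Proof.
suff H i' j' : i' \in s -> j' \in s -> related i' j' -> related j' i'.
  by move=> si sj; apply/idP/idP; exact: H.
move=> si sj r; apply: contraT => nr.
have [_ _ _ Lij] := unrelated sj si nr.
by move: r nr; rewrite /related Lij eqxx orbF eq_sym => ->.
Qed.

(** The form of [j] is a combination of the two forms of [i], which vanish at [v k] if [i] and [k]
    are unrelated. *)
Lemma related_trans i j k : i \in s -> j \in s -> k \in s ->
  related i j -> related j k -> related i k.
Proof.
move=> si sj sk; have [<- //|ij] := eqVneq i j.
have [<- //|jk] := eqVneq j k; move=> rij rjk; apply: contraT => nik.
have [lik Lik _ _] := unrelated si sk nik.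
have [_ _ _ E] := related_linked si sj ij rij.
by move: rjk; rewrite /related (negPf jk) E lik Lik !mulr0 subr0 mulr0 eqxx.
Qed.

(** The members other than [i] are combinations of [v i] and [v j]; their ratios, shifted by [p],
    are distinct roots of X^3 - p^3. *)
Lemma class_size i j t : i \in s -> j \in t -> uniq t -> {subset t <= s} ->
  i \notin t -> {in t, forall k, related i k} -> (size t <= 3)%N.
Proof.
move=> si tj ut ts ti rt; have sj := ts j tj.
have ne k : k \in t -> i != k by apply: contraTneq => <-.
have lk k (tk : k \in t) := related_linked si (ts k tk) (ne k tk) (rt k tk).
set p := lf (l i) (v j).
have ab k : exists ab : K * K, k \in t -> v k = ab.1 *: v i + ab.2 *: v j.
  have [tk|] := boolP (k \in t); last by exists (0, 0).
  have [a [b e]] := class_span charK (data si) (data sj) (lk j tj) nondeg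
    (data (ts k tk)) (lk k tk).
  by exists (a, b).
have [f fE] := choice ab.
have b0 k : k \in t -> (f k).2 != 0.
  move=> tk; apply/eqP => b0; have := fE k tk.
  rewrite b0 scale0r addr0 => e; have := prop (ts k tk) si; rewrite eq_sym.
  by move/(_ (ne k tk) (f k).1); rewrite e eqxx.
pose z k := (f k).1 / (f k).2 + p.
pose P : {poly K} := 'X^3 - (p ^+ 3)%:P.
have sP : size P = 4%N by rewrite size_XnsubC.
rewrite -ltnS -[4%N]sP -(size_map z); apply: max_poly_roots.
- by rewrite -size_poly_eq0 sP.
- apply/allP => _ /mapP[k tk ->]; rewrite rootE /P !hornerE subr_eq0.
  apply/eqP; apply: (class_root F4 (data si) (data sj) (lk j tj) (l3 := l k) (L3 := L k) _ (b0 k tk)).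
  by rewrite -fE //; exact: data (ts k tk).
rewrite map_inj_in_uniq // => k k' tk tk' /addIr e; apply/eqP; apply: contraT => kk'.
have := prop (ts k tk) (ts k' tk') kk' ((f k).2 / (f k').2).
rewrite (fE k tk) (fE k' tk') scalerDr !scalerA divfK ?b0 //.
have -> : (f k).2 / (f k').2 * (f k').1 = (f k).1.
  by rewrite mulrAC -mulrA -e mulrC divfK ?b0.
by rewrite eqxx.
Qed.

(* A block [(i, Some j)] stands for a class with at least two points, spanned
   by those of [i] and [j], and [(i, None)] for the class of [i] alone. *)
Definition block_pairs (b : I * option I) : seq ('cV[K]_m * 'rV[K]_m) :=
  if b.2 is Some j then
    let p := lf (l b.1) (v j) in let q := lf (L b.1) (v j) in
    [:: (v b.1, l b.1 - (p / q) *: L b.1); (v j, q^-1 *: L b.1)]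
  else [:: (v b.1, l b.1)].

Definition block_ok (b : I * option I) := (b.1 \in s) &&
  (if b.2 is Some j then [&& j \in s, b.1 != j & related b.1 j] else true).

Definition block_weight (b : I * option I) := if b.2 is Some _ then 4%N else 1%N.

Definition separated (b c : I * option I) := ~~ related b.1 c.1.

(** The class of the first remaining point is split off; any other member of it may serve as its
    partner in the block. *)
Lemma blocks_exist : uniq s -> exists B, [/\ all block_ok B,
  pairwise separated B & (size s <= \sum_(b <- B) block_weight b)%N].
Proof.
move=> us.
suff H k t : (size t < k)%N -> uniq t -> {subset t <= s} -> exists B, [/\
    all block_ok B, {subset [seq b.1 | b <- B] <= t}, pairwise separated B &
    (size t <= \sum_(b <- B) block_weight b)%N].
  by have [B [? _ ? ?]] := H (size s).+1 s (leqnn _) us (fun _ h => h); exists B.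
elim: k t => // k IH [|i t] st ut ts; first by exists [::]; rewrite big_nil.
have si := ts i (mem_head _ _); have /andP[it ut'] := ut.
have ts' x : x \in t -> x \in s by move=> tx; apply: ts; rewrite inE tx orbT.
have [|||B [okB subB sepB leB]] := IH [seq x <- t | ~~ related i x].
- by rewrite size_filter; apply: leq_ltn_trans (count_size _ _) _.
- exact: filter_uniq.
- by move=> x; rewrite mem_filter => /andP[_]; exact: ts'.
pose C := [seq x <- t | related i x].
have sC : size (i :: t) = (size C + size [seq x <- t | ~~ related i x]).+1.
  by rewrite /= !size_filter count_predC.
have sub1 j : {subset [seq b.1 | b <- (i, j) :: B] <= i :: t}.
  move=> x; rewrite /= !inE => /orP[->//|/subB].
  by rewrite mem_filter => /andP[_ ->]; rewrite orbT.
have sep1 j : pairwise separated ((i, j) :: B).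
  rewrite /= sepB andbT; apply/allP => c cB.
  have := subB c.1 (map_f _ cB); rewrite mem_filter => /andP[]; rewrite /separated.
  by [].
case eC: C => [|j C'].
  exists ((i, None) :: B); split=> //; first by rewrite /= okB /block_ok si.
  by rewrite sC eC big_cons add0n add1n ltnS.
have jC : j \in C by rewrite eC mem_head.
have jt : j \in t by move: jC; rewrite mem_filter => /andP[].
exists ((i, Some j) :: B); split=> //.
  rewrite /= okB /block_ok /= si ts' //= andbT; apply/andP; split.
    by apply: contraNneq it => ->.
  by move: jC; rewrite mem_filter => /andP[].
rewrite sC big_cons -addSn leq_add // ltnS (@class_size i j) ?filter_uniq //.
- by move=> x; rewrite mem_filter => /andP[_]; exact: ts'.
- by rewrite mem_filter negb_and it orbT.
by move=> x; rewrite mem_filter => /andP[].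
Qed.

Lemma block_pairs_kill b c d : block_ok b -> block_ok c -> separated b c ->
  d \in block_pairs c -> lf (l b.1) d.1 = 0 /\ lf (L b.1) d.1 = 0.
Proof.
case/andP=> sb _ /andP[sc ok] sep.
have [lz Lz _ _] := unrelated sb sc sep.
case: c ok sc sep lz Lz => i [j|] /= ok si sep lz Lz; last first.
  by rewrite inE => /eqP -> /=.
have /and3P[sj ij rij] := ok.
have nbj : ~~ related b.1 j.
  apply: contra sep => rbj; apply: (related_trans sb sj si rbj).
  by rewrite related_sym.
have [lz' Lz' _ _] := unrelated sb sj nbj.
by rewrite !inE => /orP[] /eqP -> /=.
Qed.

Lemma block_pairs_form b d : d \in block_pairs b ->
  exists x y, d.2 = x *: l b.1 + y *: L b.1.
Proof.
case: b => i [j|] /=; rewrite !inE; last first.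
  by move/eqP=> ->; exists 1, 0; rewrite scale1r scale0r addr0.
case/orP=> /eqP -> /=.
  by exists 1, (- (lf (l i) (v j) / lf (L i) (v j))); rewrite scale1r scaleNr.
by exists 0, (lf (L i) (v j))^-1; rewrite scale0r add0r.
Qed.

Lemma separated_sym b c : block_ok b -> block_ok c -> separated b c = separated c b.
Proof. by move=> /andP[sb _] /andP[sc _]; rewrite /separated related_sym. Qed.

Lemma block_pairs_dual b : block_ok b -> dual_system (block_pairs b).
Proof.
case: b => i [j|] /andP[/= si]; last first.
  by move=> _; rewrite /dual_system /=; have [-> _ _ _] := data si; rewrite eqxx.
case/and3P=> sj ij rij; have [p0 q0 _ _] := related_linked si sj ij rij.
have [lv Lv _ _] := data si.
rewrite /dual_system /= /orthogonal_pairs /= !lfDl -scaleN1r !lfZl lv Lv.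
by rewrite mulr0 mulr0 addr0 mulr0 mulVf // mulN1r divfK // subrr !eqxx.
Qed.

Lemma blocks_dual B : all block_ok B -> pairwise separated B ->
  dual_system (flatten [seq block_pairs b | b <- B]).
Proof.
elim: B => // b B IH /= /andP[okb okB] /andP[sb sepB].
rewrite dual_system_cat block_pairs_dual // IH //=.
apply/allrelP => d e db /flattenP[_ /mapP[c cB ->] ec].
have okc := allP okB c cB; have sbc := allP sb c cB.
have [x [y dE]] := block_pairs_form db; have [x' [y' eE]] := block_pairs_form ec.
have [lz Lz] := block_pairs_kill okb okc sbc ec.
rewrite separated_sym // in sbc.
have [lz' Lz'] := block_pairs_kill okc okb sbc db.
by rewrite /orthogonal_pairs dE eE !lfDl !lfZl lz Lz lz' Lz' !mulr0 addr0 eqxx.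
Qed.

Lemma blocks_cover B b c : all block_ok B -> pairwise separated B ->
  b \in B -> c \in B -> b = c \/ separated b c.
Proof.
move=> okB sepB bB cB; have okb := allP okB b bB; have okc := allP okB c cB.
move: sepB cB {okB}; case/splitPr: bB => B1 B2.
rewrite pairwise_cat allrel_consr /= => /and3P[/andP[s1 _] _ /andP[s2 _]].
rewrite mem_cat inE => /or3P[c1|/eqP->|c2]; [right|by left|right].
  by rewrite separated_sym //; exact: (allP s1 c c1).
exact: (allP s2 c c2).
Qed.

(** A pair carries weight 4 on two vectors, a single point weight 1 on one vector: two per vector,
    less one for each single point. *)
Lemma blocks_size B :
  (\sum_(b <- B) block_weight b + count (fun b => b.2 == None) B =
   2 * size (flatten [seq block_pairs b | b <- B]))%N.
Proof.
elim: B => [|[i [j|]] B IH]; first by rewrite big_nil.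
  by rewrite big_cons /= !mulnS -IH /block_weight /=; clear -IH; lia.
by rewrite big_cons /= mulnS -IH /block_weight /=; clear -IH; lia.
Qed.

(** The form [L] of a single point is nonzero and kills the vectors of all blocks, so they do not
    span. *)
Lemma single_block B b : all block_ok B -> pairwise separated B ->
  b \in B -> b.2 = None -> (size (flatten [seq block_pairs b | b <- B]) < m)%N.
Proof.
move=> okB sepB bB b0; have okb := allP okB b bB.
have [_ Lv L0 _] := data (proj1 (andP okb)).
apply: (dual_system_lt (blocks_dual okB sepB) L0) => d.
case/flattenP=> _ /mapP[c cB ->] dc.
have [e|sbc] := blocks_cover okB sepB bB cB.
  by move: dc Lv; rewrite -e; case: (b) b0 => i o /= ->; rewrite inE => /eqP -> /=.
by have [] := block_pairs_kill okb (allP okB c cB) sbc dc.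
Qed.

End Blocks.

Section Count.
Variables (K : fieldType) (n : nat) (F : {mpoly K[n.+2]}).
Hypothesis charK : [pchar K] =i pred0.
Hypothesis F4 : F \is 4.-homog.
Hypothesis nondeg : forall u, period F u -> u = 0.
Variables (I : eqType) (s : seq I) (v : I -> 'cV[K]_n.+2) (l L : I -> 'rV[K]_n.+2).
Hypothesis data : {in s, forall i, datum F (v i) (l i) (L i)}.
Hypothesis prop : {in s &, forall i j, i != j -> forall k, v i != k *: v j}.
Hypothesis us : uniq s.

(** Without single points, 2 size B <= n + 2. With one, there are at most n + 1 vectors, so the
    count is at most 2 (n + 1) - 1, strictly below the bound for either parity of n. *)
Lemma data_count : (size s <= 4 * (n./2 + 1))%N /\
  (size s = 4 * (n./2 + 1) -> exists B, [/\
    all (block_ok s v L) B, pairwise (separated v L) B,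
    all (fun b => b.2 != None) B & size B = n./2 + 1])%N.
Proof.
have [B [okB sepB leB]] := blocks_exist charK F4 nondeg data prop us.
have E := blocks_size v l L B.
have le := dual_system_size (blocks_dual charK nondeg data prop okB sepB).
have hn := odd_double_half n.
have [aS|] := boolP (all (fun b => b.2 != None) B).
  have c0 : count (fun b : I * option I => b.2 == None) B = 0%N.
    apply/eqP; rewrite -leqn0 leqNgt -has_count -all_predC.
    exact: aS.
  have sB : (\sum_(b <- B) block_weight b = 4 * size B)%N.
    elim: B aS {okB sepB leB E le c0} => [|[i [j|]] B IH] //=; first by rewrite big_nil.
    by move=> /IH; rewrite big_cons mulnS => ->.
  rewrite sB c0 in E leB; move: (size (flatten _)) le E => N le E.
  split; first by lia.
  move=> e; exists B; split=> //; lia.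
case/allPn=> b bB; rewrite negbK => /eqP b0.
have lt := single_block charK nondeg data prop okB sepB bB b0.
have c0 : (0 < count (fun b : I * option I => b.2 == None) B)%N.
  by rewrite -has_count; apply/hasP; exists b => //; apply/eqP.
move: (size (flatten _)) (count _ _) lt E c0 hn leB => N c.
by move: (\sum_(b <- B) block_weight b) (size s) (odd n) => w z [] /=; split; lia.
Qed.

End Count.

(** * The extremal quartic *)

Section Quartic.
Variables (K : fieldType) (n : nat).
Local Notation k := (n./2.+1).

(** The coordinates are paired as i and k + i; for odd n the last one stays alone. *)
Lemma ev_quartic (y : 'cV[K]_n.+2) (z : nat -> K) :
  (forall i, (i < n.+2)%N -> y (inord i) 0 = z i) ->
  ev y (quartic K n) =
    \sum_(0 <= i < k) (z (k + i)%N * z i ^+ 3 + z (k + i)%N ^+ 4) +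
    (if odd n then z n.+1 ^+ 4 else 0).
Proof.
move=> yz; have hn := odd_double_half n.
have k2 : (n.+2 = k + k + odd n)%N by lia.
rewrite /quartic mevalD big_split /= -addrA; congr (_ + _).
  rewrite raddf_sum /=; apply: eq_big_nat => i /andP[_ lt].
  by rewrite mevalM rmorphXn /= !mevalXU addn1 !yz //; lia.
rewrite raddf_sum /= (big_cat_nat (n := k + k)) /=; [|lia|lia]; congr (_ + _).
  rewrite -{1}[k]add0n big_addn addnK; apply: eq_big_nat => i /andP[_ lt].
  by rewrite rmorphXn /= mevalXU yz addnC //; lia.
have [o|o] := boolP (odd n); last first.
  by rewrite big_geq // k2 (negPf o) addn0.
have e : (k + k)%N = n.+1 by rewrite o in k2; lia.
by rewrite e big_nat1 rmorphXn /= mevalXU yz.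
Qed.

End Quartic.

(** * Reduction to the quartic in the case of equality *)

Section Normalize.
Variables (K : closedFieldType) (n : nat) (F : {mpoly K[n.+2]}).
Hypothesis charK : [pchar K] =i pred0.
Hypothesis F4 : F \is 4.-homog.
Hypothesis nondeg : forall u, period F u -> u = 0.
Local Notation k := (n./2.+1).

Lemma closed_root d (a : K) : (0 < d)%N -> exists b, b ^+ d = a.
Proof.
case: d => // d _; have [b e] := @solve_monicpoly K d.+1 (fun i => if i == 0%N then a else 0) isT.
by exists b; rewrite e big_ord_recl expr0 mulr1 big1 ?addr0 // => i _; rewrite mul0r.
Qed.

Lemma block_normalize (l L : 'rV[K]_n.+2) c : c != 0 -> exists l' L' : 'rV[K]_n.+2,
  forall x, block_form l L c x = lf L' x * lf l' x ^+ 3 + lf L' x ^+ 4.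
Proof.
(* Scaling [L] by a fourth root [b] of -c normalises the quartic term, and then [l] needs a factor
   whose cube is 1 / b. *)
move=> c0; have [b bE] := @closed_root 4 (- c) isT; have [a aE] := @closed_root 3 b^-1 isT.
have b0 : b != 0 by apply: contraNneq c0 => b0; rewrite -oppr_eq0 -bE b0 expr0n.
exists (a *: l), (b *: L) => x; rewrite /block_form !lfZl !exprMn aE bE.
by field.
Qed.

(** A vector in the kernel of [S] would be a period of [F], so [S] is invertible. *)
Lemma quartic_equiv (S : 'M[K]_n.+2) :
  (forall x : 'cV[K]_n.+2, ev x F = ev (S *m x) (quartic K n)) ->
  exists2 T, T \in unitmx & lin_subst T F = quartic K n.
Proof.
move=> FS; have uS : S \in unitmx.
  rewrite -unitmx_tr -row_free_unit -kermx_eq0; apply/eqP/row_matrixP => i.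
  rewrite row0; apply: trmx_inj; rewrite trmx0; apply: nondeg => x s.
  have: row i (kermx S^T) *m S^T = 0 by apply/sub_kermxP; exact: row_sub.
  move/(congr1 trmx); rewrite trmx_mul trmxK trmx0 => e.
  by rewrite !FS mulmxDr -scalemxAr e scaler0 addr0.
exists (invmx S); first by rewrite unitmx_inv.
by apply: (mpoly_ev_eq charK) => x; rewrite ev_lin_subst FS mulKVmx.
Qed.

Variables (I : eqType) (s : seq I) (v : I -> 'cV[K]_n.+2) (l L : I -> 'rV[K]_n.+2).
Hypothesis data : {in s, forall i, datum F (v i) (l i) (L i)}.
Hypothesis prop : {in s &, forall i j, i != j -> forall k, v i != k *: v j}.
Variable B : seq (I * option I).
Hypothesis okB : all (block_ok s v L) B.
Hypothesis sepB : pairwise (separated v L) B.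
Hypothesis allB : all (fun b => b.2 != None) B.
Hypothesis sB : size B = (n./2 + 1)%N.

Local Notation ds := (flatten [seq block_pairs v l L b | b <- B]).

Definition block_coef (b : I * option I) : K :=
  if b.2 is Some j then (lf (l b.1) (v j) / lf (L b.1) (v j)) ^+ 3 else 1.

Local Notation bf b := (block_form (l b.1) (L b.1) (block_coef b)).

Lemma block_shift_all b d (x : 'cV[K]_n.+2) t : b \in B -> d \in block_pairs v l L b ->
  ev (x + t *: d.1) F = ev x F + bf b (x + t *: d.1) - bf b x.
Proof.
move=> bB; have /andP[] := allP okB b bB; have := allP allB b bB.
case: b {bB} => i [j|] //= _ si /and3P[sj ij rij].
have lk := related_linked charK nondeg data prop si sj ij rij.
rewrite !inE => /orP[] /eqP -> /=; first exact: (block_shift1 (data si)).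
exact: (block_shift charK (data sj) lk).
Qed.

Lemma sum_blocks_shift d (x : 'cV[K]_n.+2) t : d \in ds ->
  ev (x + t *: d.1) F - \sum_(b <- B) bf b (x + t *: d.1) =
  ev x F - \sum_(b <- B) bf b x.
Proof.
case/flattenP=> _ /mapP[b bB ->] db; rewrite (block_shift_all _ _ bB db).
have uB : uniq B.
  apply: pairwise_uniq sepB => c; by rewrite /separated /related eqxx.
rewrite (bigD1_seq b) //= [X in _ = _ - X](bigD1_seq b) //=.
have -> : \sum_(c <- B | c != b) bf c (x + t *: d.1) = \sum_(c <- B | c != b) bf c x.
  rewrite big_seq_cond [RHS]big_seq_cond; apply: eq_bigr => c /andP[cB cb].
  have okc := allP okB c cB; have okb := allP okB b bB.
  have [e|sbc] := blocks_cover charK nondeg data prop okB sepB cB bB.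
    by rewrite e eqxx in cb.
  have [lz Lz] := block_pairs_kill charK nondeg data prop okc okb sbc db.
  by rewrite /block_form !lfD !lfZ lz Lz !mulr0 !addr0.
by ring.
Qed.

Lemma block_form_homog (l' L' : 'rV[K]_n.+2) c (t : K) x :
  block_form l' L' c (t *: x) = t ^+ 4 * block_form l' L' c x.
Proof. by rewrite /block_form !lfZ; ring. Qed.

(** [F] minus the block forms is constant along every vector of the dual system, so it depends only
    on the remaining coordinate [g], and homogeneity makes it a multiple of its fourth power. For
    even n the vectors already span and no coordinate remains. *)
Lemma sum_blocks_normal : exists (g : 'rV[K]_n.+2) (C : K),
  (~~ odd n -> g = 0) /\
  forall x : 'cV[K]_n.+2, ev x F = \sum_(b <- B) bf b x + lf g x ^+ 4 * C.
Proof.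
have dual := blocks_dual charK nondeg data prop okB sepB.
have := blocks_size v l L B.
have -> : count (fun b : I * option I => b.2 == None) B = 0%N.
  by apply/eqP; rewrite -leqn0 leqNgt -has_count -all_predC.
move=> _; have sd : size ds = (2 * (n./2 + 1))%N.
  rewrite -sB; elim: (B) allB => [|[i [j|]] B' IH] //= /IH ->.
  by rewrite mulnS.
have hn := odd_double_half n.
have [|g [e [ge xE]]] := dual_system_complement dual.
  by rewrite sd; clear -hn; lia.
exists g, (ev e F - \sum_(b <- B) bf b e); split.
  by move=> o; apply: ge; rewrite sd; clear -hn o; lia.
move=> x; apply/eqP; rewrite addrC -subr_eq; apply/eqP.
have shift ds' (c : _ -> K) (y : 'cV[K]_n.+2) : {subset ds' <= ds} ->
    ev (\sum_(d <- ds') c d *: d.1 + y) F -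
      \sum_(b <- B) bf b (\sum_(d <- ds') c d *: d.1 + y) =
    ev y F - \sum_(b <- B) bf b y.
  elim: ds' => [|d ds' IH] sub; first by rewrite big_nil add0r.
  rewrite big_cons -addrA addrC sum_blocks_shift ?sub ?mem_head //.
  by apply: IH => d' dd'; apply: sub; rewrite inE dd' orbT.
rewrite {1 2}(xE x) (shift ds (fun d => lf d.2 x)) // (ev_homogZ _ _ F4).
under eq_bigr do rewrite block_form_homog.
by rewrite -mulr_sumr mulrBr.
Qed.

Lemma data_quartic : exists2 T, T \in unitmx & lin_subst T F = quartic K n.
Proof.
have [g [C [g0 FE]]] := sum_blocks_normal.
have nrm b : exists lL : 'rV[K]_n.+2 * 'rV[K]_n.+2, b \in B ->
    forall x, bf b x = lf lL.2 x * lf lL.1 x ^+ 3 + lf lL.2 x ^+ 4.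
  have [bB|] := boolP (b \in B); last by exists (0, 0).
  have [|l' [L' H]] := @block_normalize (l b.1) (L b.1) (block_coef b); last by exists (l', L').
  have /andP[] := allP okB b bB; have := allP allB b bB.
  case: b {bB} => i [j|] //= _ si /and3P[sj ij rij].
  exact: block_coef_neq0 (related_linked charK nondeg data prop si sj ij rij).
have [f fE] := choice nrm; have [c cE] := @closed_root 4 C isT.
have b0 : I * option I by move: sB; rewrite addn1; case: (B) => // b.
(* The forms that replace the variables of the quartic: those that are cubed, then their partners,
   then for odd n the remaining form scaled by a fourth root of [C]. *)
pose r i := if (i < k)%N then (f (nth b0 B i)).1
  else if (i < k + k)%N then (f (nth b0 B (i - k))).2 else c *: g.
pose S := \matrix_(i < n.+2, j < n.+2) r i 0 j.
apply: (quartic_equiv (S := S)) => x.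
rewrite (ev_quartic (z := fun i => lf (r i) x)); last first.
  move=> i lt; rewrite /S /lf !mxE; apply: eq_bigr => j _.
  by rewrite mxE inordK.
rewrite FE (big_nth b0) sB addn1; congr (_ + _).
  apply: eq_big_nat => i /andP[_ lt]; rewrite fE ?mem_nth ?sB ?addn1 //.
  rewrite /r lt ltn_add2l lt addKn.
  by rewrite ltnNge leq_addr.
have hn := odd_double_half n.
case: ifP => o; last by rewrite g0 ?o // /lf mul0mx mxE expr0n mul0r.
rewrite /r !ifF ?lfZl ?exprMn ?cE 1?mulrC //; clear -hn o; lia.
Qed.

End Normalize.

(** * The Galois points of the quartic *)

Section QuarticData.
Variables (K : closedFieldType) (n : nat).
Hypothesis charK : [pchar K] =i pred0.
Local Notation k := (n./2.+1).
Local Notation Q := (quartic K n).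
Implicit Types x : 'cV[K]_n.+2.

Definition coord_form j : 'rV[K]_n.+2 := delta_mx 0 (inord j).
Definition coord_vec j : 'cV[K]_n.+2 := delta_mx (inord j) 0.

Lemma coord_formE j x : lf (coord_form j) x = x (inord j) 0.
Proof. by rewrite /lf /coord_form -rowE mxE. Qed.

Lemma coord_vecE i j : (i < n.+2)%N -> (j < n.+2)%N ->
  coord_vec i (inord j) 0 = (j == i)%:R.
Proof. by move=> li lj; rewrite mxE andbT -val_eqE /= !inordK. Qed.

Lemma ev_quartic_shift i a b x s : (i < k)%N ->
  let X := x (inord i) 0 in let Y := x (inord (k + i)) 0 in
  ev (x + s *: (a *: coord_vec i + b *: coord_vec (k + i))) Q =
  ev x Q + ((Y + s * b) * (X + s * a) ^+ 3 + (Y + s * b) ^+ 4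
    - (Y * X ^+ 3 + Y ^+ 4)).
Proof.
move=> lt X Y; have hn := odd_double_half n.
have i1 : (i < n.+2)%N by clear -lt hn; lia.
have i2 : (k + i < n.+2)%N by clear -lt hn; lia.
rewrite (@ev_quartic _ _ x (fun j => x (inord j) 0)) //.
rewrite (ev_quartic (z := fun j => x (inord j) 0 +
    s * (a * (j == i)%:R + b * (j == k + i)%N%:R))); last first.
  by move=> j lj; rewrite -(coord_formE j (x + _)) !(lfD, lfZ) !coord_formE !coord_vecE.
have -> : (n.+1 == i) = false by clear -lt hn; lia.
rewrite !big_mkord (bigD1 (Ordinal lt)) //= [in RHS](bigD1 (Ordinal lt)) //=.
have -> : (k + i == i)%N = false by clear -lt; lia.
have -> : (i == k + i)%N = false by clear -lt; lia.
rewrite !eqxx -/X -/Y.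
under eq_bigr => j ji.
  have ne : (j == i :> nat) = false by apply: negbTE; apply: contraNneq ji => e; apply/eqP/val_inj.
  have -> : (k + j == i)%N = false by clear -lt; lia.
  have -> : (j == k + i :> nat) = false by move: (ltn_ord j); clear; lia.
  rewrite eqn_add2l ne !mulr0 addr0 mulr0 !addr0.
  over.
rewrite /= mulr0n mulr1n !mulr0 add0r addr0 !mulr1.
move: (\sum_(j < k | j != Ordinal lt) _) => S.
have [o|o] := boolP (odd n); last by ring.
have -> : (n.+1 == k + i)%N = false by clear -lt hn o; lia.
by rewrite mulr0n !mulr0; ring.
Qed.

Lemma cube_roots : exists rs : seq K,
  [/\ size rs = 3, uniq rs & {in rs, forall a, a ^+ 3 = -1}].
Proof.
have [w] := @solve_monicpoly K 2 (fun _ => -1) isT.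
rewrite !big_ord_recl big_ord0 /= expr0 expr1 addr0 mulr1 => w2.
have n3 : (3 : K) != 0 by rewrite (natf_eq0 charK).
have w3 : w ^+ 3 = 1 by transitivity (- w - w ^+ 2); [rewrite exprS {1}w2; ring | rewrite w2; ring].
(* Here [w] is a primitive cube root of unity and 1 + w = -w^2. Any coincidence among the three
   would make 3 vanish. *)
exists [:: -1; - w; 1 + w]; split=> //.
  rewrite /= !inE negb_or !andbT; apply/andP; split; [apply/andP; split|].
  - apply: contra_neqN n3 => /eqP/oppr_inj e.
    by transitivity (w ^+ 2 + w + 1); [rewrite -e; ring | rewrite w2; ring].
  - apply: contra_neqN n3 => /eqP e; have {e}we : w = -2 by rewrite -[w](addKr 1) -e; ring.
    by transitivity (w ^+ 2 + w + 1); [rewrite we; ring | rewrite w2; ring].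
  apply: contra_neqN n3 => /eqP e.
  have we : 2 * w = -1 by transitivity ((1 + w) + w - 1); [ring | rewrite -e; ring].
  transitivity (4 * (w ^+ 2 + w + 1)); last by rewrite w2; ring.
  transitivity ((2 * w) ^+ 2 + 2 * (2 * w) + 4); last by ring.
  by rewrite we; ring.
move=> a; rewrite !inE => /or3P[] /eqP ->; first by ring.
  by transitivity (- w ^+ 3); [ring | rewrite w3].
transitivity (w ^+ 3 + 3 * w ^+ 2 + 3 * w + 1); first by ring.
by rewrite w3 w2; ring.
Qed.

(* The four Galois points in each plane spanned by two coordinate vectors
   paired by the quartic. *)
Definition quartic_vec (j : nat * option K) : 'cV[K]_n.+2 :=
  if j.2 is Some a then a *: coord_vec j.1 + 1 *: coord_vec (k + j.1)
  else 1 *: coord_vec j.1 + 0 *: coord_vec (k + j.1).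

Definition admissible (j : nat * option K) : Prop :=
  (j.1 < k)%N /\ if j.2 is Some a then a ^+ 3 = -1 else True.

Let bound i : (i < k)%N -> (i < n.+2)%N /\ (k + i < n.+2)%N.
Proof. by have hn := odd_double_half n; clear -hn; lia. Qed.

Lemma quartic_vec_coord j i : (j.1 < k)%N -> (i < k)%N ->
  lf (coord_form i) (quartic_vec j) =
    (if j.2 is Some a then a else 1) * (i == j.1)%:R /\
  lf (coord_form (k + i)) (quartic_vec j) =
    (if j.2 is Some a then 1 else 0) * (i == j.1)%:R.
Proof.
case: j => j o /= lj li; have [j1 j2] := bound lj; have [i1 i2] := bound li.
have e1 : (k + i == j)%N = false by clear -lj; lia.
have e2 : (i == k + j)%N = false by clear -li; lia.
by rewrite /quartic_vec /=; case: o => [a|];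
  rewrite !(lfD, lfZ) !coord_formE !coord_vecE // eqn_add2l e1 e2 mulr0n;
  split; ring.
Qed.

Lemma quartic_datum j : admissible j -> exists l L, datum Q (quartic_vec j) l L.
Proof.
have n3 : (3 : K) != 0 by rewrite (natf_eq0 charK).
case=> lt; have [] := quartic_vec_coord lt lt; rewrite eqxx !mulr1.
case: j lt => i [a|] /= lt c1 c2 a3; last first.
  exists (coord_form i), (coord_form (k + i)); split=> //.
    by apply/eqP => /(congr1 (fun r => lf r (coord_vec (k + i)))) /eqP;
      rewrite coord_formE coord_vecE ?(bound lt).2 // eqxx /lf mul0mx mxE oner_eq0.
  move=> x s; rewrite /quartic_vec /= ev_quartic_shift // !coord_formE.
  by ring.
(* The forms that [linked] prescribes, starting from the coordinate vector with its two coordinate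
   forms, for p = a and q = 1; there 1 / a = -a^2. *)
exists ((2 / 3) *: coord_form (k + i) - (a ^+ 2 / 3) *: coord_form i),
  ((3 * a ^+ 2) *: coord_form i + 3 *: coord_form (k + i)).
split.
- rewrite lfDl -scaleN1r !lfZl c1 c2.
  by transitivity (2 / 3 - a ^+ 3 / 3); [ring | rewrite a3; field].
- rewrite lfDl !lfZl c1 c2.
  by transitivity (3 * a ^+ 3 + 3); [ring | rewrite a3; ring].
- apply/eqP => /(congr1 (fun r => lf r (coord_vec (k + i)))) /eqP.
  rewrite lfDl !lfZl !coord_formE !coord_vecE ?(bound lt).1 ?(bound lt).2 //.
  rewrite eqxx ltn_eqF ?mulr0 ?add0r ?mulr1 ?(negPf n3); last by clear -lt; lia.
  by rewrite /lf mul0mx mxE (negPf n3).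
move=> x s; rewrite /quartic_vec /= ev_quartic_shift // !lfDl -scaleN1r !lfZl.
rewrite !coord_formE; move: (x (inord i) 0) (x (inord (k + i)) 0) => X Y; congr (_ + _).
have [Z [XE ZE]] : exists Z, X = a * Z /\ a ^+ 2 * X = - Z.
  exists (- a ^+ 2 * X); split; last by ring.
  by transitivity (- a ^+ 3 * X); [rewrite a3; ring | ring].
transitivity (a ^+ 3 * ((Y + s) * (Z + s) ^+ 3 - Y * Z ^+ 3) + (Y + s) ^+ 4 - Y ^+ 4).
  by rewrite XE; ring.
transitivity (((2 / 3 * Y - (a ^+ 2 * X) / 3 + s) ^+ 3 - (2 / 3 * Y - (a ^+ 2 * X) / 3) ^+ 3)
    * (3 * (a ^+ 2 * X) + 3 * Y)); first by rewrite ZE a3; field.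
by ring.
Qed.

Lemma quartic_vec_prop j j' : admissible j -> admissible j' -> j != j' ->
  forall c, quartic_vec j != c *: quartic_vec j'.
Proof.
move=> [lt ad] [lt' ad'] jj' c; apply: contraNneq jj' => e.
have a0 (a : K) : a ^+ 3 = -1 -> a != 0.
  by move=> a3; apply: contra_eq_neq a3 => ->; rewrite expr0n eq_sym oppr_eq0 oner_eq0.
have [c1 c2] := quartic_vec_coord lt lt; have [c1' c2'] := quartic_vec_coord lt' lt.
move: c1 c2; rewrite e !lfZ c1' c2' eqxx !mulr1.
have [ij|_] := eqVneq j.1 j'.1; last first.
  rewrite !mulr0; case: (j.2) ad => [a /a0/eqP a00 /esym //|_ /eqP].
  by rewrite eq_sym oner_eq0.
rewrite !mulr1; case: j j' lt lt' ad ad' ij {e c1' c2'} => [i o] [i' o'] /= _ _ ad ad' ->.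
case: o o' ad ad' => [a|] [a'|] _ _ //.
- by move=> <-; rewrite mulr1 => ->; rewrite mul1r.
- by move=> _ /eqP; rewrite mulr0 eq_sym oner_eq0.
by rewrite mulr1 => + c0; rewrite c0 mul0r => /eqP; rewrite eq_sym oner_eq0.
Qed.

End QuarticData.

Lemma datum_transport (K : fieldType) m (F G : {mpoly K[m]}) (T : 'M[K]_m) c
    (v : 'cV[K]_m) l L : T \in unitmx -> c != 0 ->
  (forall x : 'cV[K]_m, ev (T *m x) F = c * ev x G) ->
  datum G v l L -> datum F (T *m v) (l *m invmx T) (c *: (L *m invmx T)).
Proof.
move=> uT c0 FG [lv Lv L0 e]; split.
- by rewrite lf_mulmx mulKmx.
- by rewrite lfZl lf_mulmx mulKmx // Lv mulr0.
- apply: contraNneq L0 => /eqP; rewrite scaler_eq0 (negPf c0) /= => /eqP h.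
  by rewrite -(mulmxKV uT L) h mul0mx.
move=> x s; rewrite -{1 2}(mulKVmx uT x) scalemxAr -mulmxDr !FG e lfZl !lf_mulmx.
by ring.
Qed.

(** * Lower bounds for the number of Galois points *)

Section Counting.
Variables (K : closedFieldType) (n : nat) (X : hypersurface K n 4).
Hypothesis charK : [pchar K] =i pred0.
Hypothesis finD : finite_set (Delta X).
Local Notation F := (Defs.eqn X).

(** Stated for every [v], with an arbitrary point when [v] is 0, so that [choice] yields a total
    function. *)
Lemma point_of (v : 'cV[K]_n.+2) : exists P : Defs.point K n.+1,
  v != 0 -> line P = <[v]>%VS.
Proof.
have [v0|v0] := eqVneq v 0; last first.
  have d : \dim <[v]>%VS == 1%N by rewrite dim_vline v0.
  by exists (Point d).
have d : \dim <[const_mx 1 : 'cV[K]_n.+2]>%VS == 1%N.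
  rewrite dim_vline; suff -> : (const_mx 1 : 'cV[K]_n.+2) != 0 by [].
  by apply/eqP => /colP/(_ 0)/eqP; rewrite !mxE oner_eq0.
by exists (Point d).
Qed.

Lemma Delta_card_ge (J : eqType) (t : seq J) (w : J -> 'cV[K]_n.+2) : uniq t ->
  {in t, forall j, exists l L, datum F (w j) l L} ->
  {in t &, forall i j, i != j -> forall c, w i != c *: w j} ->
  (size t <= #|` fset_set (Delta X)|)%N.
Proof.
move=> ut dt pt; have [P PE] := choice (fun j => point_of (w j)).
have lineP j : j \in t -> line (P j) = <[w j]>%VS.
  by move=> /dt[l [L d]]; apply: PE; exact: datum_neq0 d.
rewrite -(size_map P); apply: uniq_leq_size.
  rewrite map_inj_in_uniq // => i j ti tj e; apply/eqP; apply: contraT => ij.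
  have : w i \in <[w j]>%VS by rewrite -lineP // -e lineP // memv_line.
  by case/vlineP=> c wc; have := pt i j ti tj ij c; rewrite wc eqxx.
move=> _ /mapP[j tj ->]; rewrite in_fset_set //; apply/mem_set.
have [l [L d]] := dt j tj; exact (datum_Delta charK (lineP j tj) d).
Qed.

Lemma finite_Delta_nondeg v l L : datum F v l L -> forall u, period F u -> u = 0.
Proof.
move=> d u pu; apply/eqP; apply: contraT => u0.
have [lu Lu] := period_forms charK d pu; have [lv Lv L0 e] := d.
(* One more vector than [Delta] has points. They share the forms of [v], and are pairwise
   non-proportional because l(v) = 1 and l(u) = 0. *)
have := @Delta_card_ge nat (iota 0 (#|` fset_set (Delta X)|).+1)
  (fun i => v + i%:R *: u) (iota_uniq _ _).
rewrite size_iota ltnn; apply=> [i _|i j _ _ ij c].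
  exists l, L; split=> //; rewrite ?lfD ?lfZ ?lu ?Lu ?mulr0 ?addr0 //.
  by move=> x s; rewrite scalerDr addrA scalerA pu e.
apply: contraNneq ij => h.
have /esym := congr1 (lf l) h.
rewrite !lfZ !lfD !lfZ lu !mulr0 !addr0 lv mulr1 => c1.
move: h; rewrite c1 scale1r => /addrI /eqP.
rewrite -subr_eq0 -scalerBl scaler_eq0 (negPf u0) orbF.
have H a b : (a <= b)%N -> (b%:R - a%:R == 0 :> K) = (b == a).
  by move=> ab; rewrite -natrB // (natf_eq0 charK) subn_eq0 eqn_leq ab andbT.
by case/orP: (leq_total i j) => ?; [rewrite -oppr_eq0 opprB|]; rewrite H // eq_sym.
Qed.

Lemma equiv_quartic_card_ge : proj_equivalent X (quartic K n) ->
  (4 * (n./2 + 1) <= #|` fset_set (Delta X)|)%N.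
Proof.
case=> T [c [uT c0 E]]; have [rs [srs urs rs3]] := cube_roots charK.
pose t := [seq (i, o) | i <- iota 0 n./2.+1, o <- None :: [seq Some a | a <- rs]].
have st : size t = (4 * (n./2 + 1))%N.
  by rewrite size_allpairs size_iota /= size_map srs mulnC addn1.
have ut : uniq t.
  apply: allpairs_uniq; rewrite ?iota_uniq //.
    rewrite cons_uniq map_inj_uniq ?urs ?andbT; last by move=> ? ? [].
    by apply/mapP => -[].
  by move=> [? ?] [? ?].
have adm j : j \in t -> admissible n j.
  case/allpairsP=> -[i o] [ii oo ->]; split.
    by move: ii; rewrite mem_iota add0n.
  by move: oo => /=; rewrite inE => /orP[/eqP->//|/mapP[a ra ->]]; exact: rs3.
have ET (x : 'cV[K]_n.+2) : ev (T *m x) F = c * ev x (quartic K n).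
  by rewrite -ev_lin_subst E mevalZ.
rewrite -st; apply: (Delta_card_ge (w := fun j => T *m quartic_vec n j)) => //.
  move=> j /adm aj; have [l [L d]] := quartic_datum charK aj.
  by exists (l *m invmx T), (c *: (L *m invmx T)); exact: datum_transport ET d.
move=> i j /adm ai /adm aj ij k; rewrite scalemxAr.
apply: contra_neq (quartic_vec_prop ai aj ij k) => h.
by rewrite -[LHS](mulKmx uT) h mulKmx.
Qed.

End Counting.

Theorem corollary1 (K : closedFieldType) (charK : [pchar K] =i pred0)
    (n : nat) (n_ge1 : (1 <= n)%N) (X : hypersurface K n 4)
    (sX : dim_le (Sing X) (n%:Z - 2)) (finD : finite_set (Delta X)) :
  (#|` fset_set (Delta X)| <= 4 * (n./2 + 1))%N /\
  (#|` fset_set (Delta X)| = (4 * (n./2 + 1))%N <->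
   proj_equivalent X (quartic K n)).
Proof.
set N := #|` _|; have X4 := eqn_homog X.
suff [le eq] : (N <= 4 * (n./2 + 1))%N /\
    (N = (4 * (n./2 + 1))%N -> proj_equivalent X (quartic K n)).
  split=> //; split=> // /(equiv_quartic_card_ge charK finD) ge.
  by apply/eqP; rewrite eqn_leq le.
(* The absence of periods is derived from a Galois point, so the empty case is separate; there 0 is
   smaller than the bound. *)
have [[P DP]|D0] := pselect (exists P, Delta X P); last first.
  have -> : N = 0%N.
    apply/eqP; rewrite cardfs_eq0; apply/eqP/fsetP => P.
    by rewrite in_fset_set // in_fset0; apply/negP => /set_mem DP; case: D0; exists P.
  by split=> //; rewrite addn1.
have [v0 [l0 [L0 [_ d0]]]] := Delta_datum charK n_ge1 sX DP.
have nondeg := finite_Delta_nondeg charK finD d0.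
have dat Q : exists d : 'cV[K]_n.+2 * ('rV[K]_n.+2 * 'rV[K]_n.+2),
    Q \in fset_set (Delta X) -> line Q = <[d.1]>%VS /\ datum X d.1 d.2.1 d.2.2.
  have [DQ|_] := boolP (Q \in fset_set (Delta X)); last by exists (0, (0, 0)).
  move: DQ; rewrite in_fset_set // => /set_mem DQ.
  have [v [l [L H]]] := Delta_datum charK n_ge1 sX DQ.
  by exists (v, (l, L)).
have [f fE] := choice dat.
pose s : seq (Defs.point K n.+1) := enum_fset (fset_set (Delta X)).
have data : {in s, forall Q, datum X (f Q).1 (f Q).2.1 (f Q).2.2}.
  by move=> Q sQ; have [] := fE Q sQ.
have prop : {in s &, forall Q R, Q != R -> forall k, (f Q).1 != k *: (f R).1}.
  move=> Q R sQ sR QR k; apply: contraNneq QR => e.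
  have [lQ dQ] := fE Q sQ; have [lR dR] := fE R sR.
  apply/eqP/val_inj/eqP; rewrite /= lQ lR eqEdim !dim_vline.
  rewrite (datum_neq0 dQ) (datum_neq0 dR) leqnn andbT e -memvE.
  by rewrite memvZ // memv_line.
have us : uniq s by exact: fset_uniq.
have [le eq] := data_count charK X4 nondeg data prop us.
split=> // /eq[B [okB sepB allB sB]].
have [T uT TE] := data_quartic charK X4 nondeg data prop okB sepB allB sB.
by exists T, 1; rewrite oner_eq0 scale1r.
Qed.
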